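(* Let $K\subset\mathbb{R}^n$ be a generalized Orlicz ball in isotropic position, with constant $L_K$, and let $X_1,\dots,X_n$ be the coordinates of a random vector uniformly distributed on $K$. Then for any $t>0$ and $a>0$, $$\mathbb{P}\Big(\max_{1\le k\le n}\Big|\sum_{i=1}^k(X_i^2-L_K^2)\Big|>nt\Big)\le 2\,\mathbb{P}\Big(\max_{1\le k\le n}|X_k^2-L_K^2|>a\Big)+4\exp\Bigg(-\frac{nt^2}{4(at+5L_K^4)}\Big(1+\frac23\ln\Big(1+\frac{at}{5L_K^4}\Big)\Big)\Bigg).$$
   Context: A function $f:[0,\infty)\to[0,\infty]$ is a Young function if it is convex, $f(0)=0$, $f(x)\neq 0$ for some $x$, and $f(x)\neq\infty$ for some $x\neq 0$. Given $n$ Young functions $f_1,\dots,f_n$, the set $K=\{(x_1,\dots,x_n)\in\mathbb{R}^n:\sum_{i=1}^n f_i(|x_i|)\le 1\}$ is called a generalized Orlicz ball. Uniform distribution on $K$ means normalized Lebesgue measure on $K$. Such a $K$ is in isotropic position if its Lebesgue measure is $1$ and there is a constant $L_K>0$ with $\mathbb{E}X_i^2=L_K^2$ for all $i=1,\dots,n$, where $(X_1,\dots,X_n)$ is uniformly distributed on $K$. *)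

(* Defs.v *)
From HB Require Import structures.
From mathcomp Require Import all_boot all_order all_algebra.
From mathcomp Require Import all_classical all_reals all_analysis
  measurable_realfun.

Set Implicit Arguments.
Unset Strict Implicit.
Unset Printing Implicit Defensive.

Import Order.TTheory GRing.Theory Num.Theory.
Import numFieldNormedType.Exports.

Local Open Scope classical_set_scope.
Local Open Scope ring_scope.

(* Points of R^n are n-tuples, with the product of the Borel sigma-algebras. *)
Notation euclid R n := (n.-tuple (measurableTypeR R)).

Section lebesgue_tuple.
Context {R : realType}.

Definition cons_pair n (p : measurableTypeR R * euclid R n) : euclid R n.+1 :=
  cons_tuple p.1 p.2.

Lemma measurable_cons_pair n : measurable_fun setT (@cons_pair n).
Proof. exact: measurable_cons. Qed.

Section step.
Variables (n : nat) (mu : {sigma_finite_measure set (euclid R n) -> \bar R}).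

Definition lebesgue_cons : set (euclid R n.+1) -> \bar R :=
  pushforward (lebesgue_measure \x mu)%E (@cons_pair n).

Let pf : {measure set (euclid R n.+1) -> \bar R} :=
  measure_function_pushforward__canonical__measure_function_Measure
    (lebesgue_measure \x mu)%E (@measurable_cons_pair n).

Let lebesgue_cons0 : lebesgue_cons set0 = 0%E.
Proof. exact: (measure0 pf). Qed.

Let lebesgue_cons_ge0 A : (0 <= lebesgue_cons A)%E.
Proof. exact: (measure_ge0 pf). Qed.

Let lebesgue_cons_sigma_additive : semi_sigma_additive lebesgue_cons.
Proof. exact: (@measure_semi_sigma_additive _ _ _ pf). Qed.

HB.instance Definition _ := isMeasure.Build _ _ _ lebesgue_cons
  lebesgue_cons0 lebesgue_cons_ge0 lebesgue_cons_sigma_additive.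

Let uncons (u : euclid R n.+1) : measurableTypeR R * euclid R n :=
  (thead u, behead_tuple u).

Let measurable_uncons : measurable_fun setT uncons.
Proof.
apply/measurable_fun_pairP; split; last exact: measurable_behead.
exact: measurable_tnth.
Qed.

Let cons_pairK : cancel (@cons_pair n) uncons.
Proof.
move=> [x u]; rewrite /uncons /cons_pair/= theadE.
by congr pair; exact: val_inj.
Qed.

Let lebesgue_cons_sigma_finite : sigma_finite setT lebesgue_cons.
Proof.
have /sigma_finiteP[F [TF ndF Foo]] :=
  sigma_finiteT (@lebesgue_measure R : {sigma_finite_measure set _ -> \bar R}).
have /sigma_finiteP[G [TG ndG Goo]] := sigma_finiteT mu.
exists (fun k => uncons @^-1` (F k `*` G k)).
  rewrite -preimage_bigcup (_ : \bigcup_k _ = setT) ?preimage_setT//.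
  apply/seteqP; split=> // -[x u] _.
  have [i _ Fx] : (\bigcup_k F k) x by rewrite -TF.
  have [j _ Gu] : (\bigcup_k G k) u by rewrite -TG.
  exists (maxn i j) => //; split => /=.
  - by move: x Fx; exact/subsetPset/ndF/leq_maxl.
  - by move: u Gu; exact/subsetPset/ndG/leq_maxr.
move=> k; have [mFk Fkoo] := Foo k; have [mGk Gkoo] := Goo k; split.
  by rewrite -[X in measurable X]setTI; apply: measurable_uncons => //;
    exact: measurableX.
rewrite /lebesgue_cons /pushforward -comp_preimage.
suff -> : uncons \o @cons_pair n = id.
  by rewrite preimage_id product_measure1E// lte_mul_pinfty// ge0_fin_numE.
by apply/funext => p /=; exact: cons_pairK.
Qed.

HB.instance Definition _ := Measure_isSigmaFinite.Build _ _ _ lebesgue_cons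
  lebesgue_cons_sigma_finite.
End step.

(* Lebesgue measure on the Borel sets of R^n, as an iterated product; it is
   determined by lebesgue_tuple_box. *)
Fixpoint lebesgue_tuple n : {sigma_finite_measure set (euclid R n) -> \bar R} :=
  match n with
  | 0 => dirac ([tuple] : euclid R 0)
  | m.+1 => lebesgue_cons (lebesgue_tuple m)
  end.

End lebesgue_tuple.

Lemma lebesgue_tupleS_box (R : realType) n (A : set (measurableTypeR R))
    (B : set (euclid R n)) : measurable A -> measurable B ->
  lebesgue_tuple n.+1 [set u | A (thead u) /\ B (behead_tuple u)] =
  (lebesgue_measure A * lebesgue_tuple n B)%E.
Proof.
move=> mA mB; rewrite -product_measure1E//=.
rewrite /lebesgue_cons /pushforward; congr ((_ \x _)%E _).
have uE x (u : euclid R n) : behead_tuple (cons_pair (x, u)) = u.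
  exact: val_inj.
by apply/seteqP; split=> -[x u]; rewrite /setX/= uE theadE.
Qed.

Lemma lebesgue_tuple_box (R : realType) n
    (A : 'I_n -> set (measurableTypeR R)) : (forall i, measurable (A i)) ->
  lebesgue_tuple n [set u | forall i, A i (tnth u i)] =
  (\prod_(i < n) lebesgue_measure (A i))%E.
Proof.
elim: n A => [|n ih] A mA.
  rewrite big_ord0 /= diracE mem_set// => i; by case: i.
rewrite big_ord_recl -ih// -lebesgue_tupleS_box//; last first.
  have -> : [set u : euclid R n | forall i, A (lift ord0 i) (tnth u i)] =
      \bigcap_(i in [set: 'I_n]) (fun u => tnth u i) @^-1` A (lift ord0 i).
    by apply/seteqP; split=> u /= Au i => [_|]; exact: Au.
  apply: fin_bigcap_measurable => // i _.
  by rewrite -[X in measurable X]setTI; exact: measurable_tnth.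
congr (lebesgue_tuple _ _); apply/seteqP; split=> u /=.
  move=> Au; split; first exact: Au.
  move=> i; have := Au (lift ord0 i).
  by rewrite [in tnth u _](tuple_eta u) tnthS.
move=> [A0 AS] i; case: (unliftP ord0 i) => [j|] ->//.
by rewrite [in tnth u _](tuple_eta u) tnthS.
Qed.

Section generalized_orlicz_ball.
Context {R : realType}.
Local Open Scope ereal_scope.

(* Only the values of f on [0, +oo[ are constrained. Since 0 * +oo = 0 in
   \bar R, the endpoints t = 0 and t = 1 of convexity are trivially true. *)
Definition young_function (f : R -> \bar R) :=
  [/\ forall x, (0 <= x)%R -> 0 <= f x,
      forall (t x y : R), (0 <= t <= 1)%R -> (0 <= x)%R -> (0 <= y)%R ->
        f (t * x + (1 - t) * y)%R <= t%:E * f x + (1 - t)%:E * f y,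
      f 0%R = 0,
      exists2 x, (0 <= x)%R & f x != 0 &
      exists2 x, (0 < x)%R & f x != +oo].

Definition orlicz_ball n (f : 'I_n -> R -> \bar R) : set (euclid R n) :=
  [set x | \sum_(i < n) f i `|tnth x i|%R <= 1].

Lemma young_function_nondecreasing f : young_function f ->
  forall x y : R, (0 <= x)%R -> (x <= y)%R -> f x <= f y.
Proof.
case=> f_ge0 f_conv f0 _ _ x y x0 xy.
have [y0|y0] := eqVneq y 0%R.
  by move: xy; rewrite y0 => xy; rewrite (@le_anti _ _ x 0%R)// x0 xy.
have yp : (0 < y)%R by rewrite lt_def y0 (le_trans x0).
have t01 : (0 <= x / y <= 1)%R.
  by rewrite divr_ge0 ?(ltW yp)//= ler_pdivrMr// mul1r.
have := f_conv (x / y)%R y 0%R t01 (ltW yp) (lexx _).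
rewrite f0 mule0 adde0 mulr0 addr0 divfK// => /le_trans; apply.
rewrite -[leRHS]mul1e; apply: lee_wpmul2r; last by rewrite lee_fin; case/andP: t01.
exact: f_ge0 (ltW yp).
Qed.

Lemma measurable_orlicz_ball n (f : 'I_n -> R -> \bar R) :
  (forall i, young_function (f i)) -> measurable (orlicz_ball f).
Proof.
move=> yf.
have mf i : measurable_fun [set: R] (fun x : R => f i (Num.max 0 x)%R).
  apply: (measurability _ (ErealGenOInfty.measurableE R)) => _ [_ [r ->] <-].
  rewrite setTI; apply: is_interval_measurable => s t/=.
  rewrite !in_itv/= !andbT => fs ft u /andP[su ut].
  rewrite in_itv/= andbT (lt_le_trans fs)//.
  apply: young_function_nondecreasing => //; first by rewrite le_max lexx.
  by rewrite ge_max !le_max lexx su orbT.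
have mn i : measurable_fun [set: euclid R n]
    (fun x : euclid R n => `|tnth x i : R|%R).
  apply: (measurableT_comp (@normr_measurable R setT)).
  exact: measurable_tnth.
have mS : measurable_fun [set: euclid R n]
    (fun x : euclid R n => \sum_(i < n) f i `|tnth x i|%R).
  apply: emeasurable_sum => i.
  have := measurableT_comp (mf i) (mn i).
  by apply: eq_measurable_fun => x _ /=; rewrite max_r.
rewrite /orlicz_ball -[X in measurable X]setTI.
by apply: measurable_lee => //; exact: measurable_cst.
Qed.

End generalized_orlicz_ball.

Section uniform_law.
Context {R : realType} {n : nat}.
Implicit Types K : set (euclid R n).
Local Open Scope ereal_scope.

(* Normalized Lebesgue measure on K; a Dirac mass is used as a junk value when
   K is not measurable or its measure is 0 or +oo (see uniform_lawE). *)
Definition uniform_law K : probability (euclid R n) R :=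
  let junk := dirac (nseq_tuple n (0%R : measurableTypeR R)) in
  if pselect (measurable K) is left mK
  then mnormalize (mrestr (lebesgue_tuple n) mK) junk else junk.

Lemma uniform_lawE K A : measurable K ->
  0 < lebesgue_tuple n K < +oo ->
  uniform_law K A = lebesgue_tuple n (A `&` K) / lebesgue_tuple n K.
Proof.
move=> mK /andP[K0 Koo]; rewrite /uniform_law; case: pselect => // {}mK /=.
rewrite /mnormalize/= /mrestr setTI gt_eqF// lt_eqF//=.
by rewrite -[in RHS](@fineK _ (lebesgue_tuple n K)) ?ge0_fin_numE// inver
  fine_eq0 ?ge0_fin_numE// gt_eqF.
Qed.

Definition isotropic K (L : R) :=
  [/\ lebesgue_tuple n K = 1, (0 < L)%R &
      forall i, 'E_(uniform_law K)[fun x => ((tnth x i : R) ^+ 2)%R]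
                = (L ^+ 2)%:E].

Definition uniformly_distributed d (T : measurableType d) (P : probability T R)
    (X : {RV P >-> euclid R n}) K :=
  forall A, measurable A -> distribution P X A = uniform_law K A.

End uniform_law.
Arguments uniformly_distributed {R n d T} P X K.

(* Main.v *)
Require Import Defs.
From HB Require Import structures.
From mathcomp Require Import all_boot all_order all_algebra.
From mathcomp Require Import all_classical all_reals all_analysis
  measurable_realfun.
From mathcomp Require Import ring lra.

Set Implicit Arguments.
Unset Strict Implicit.
Unset Printing Implicit Defensive.

Import Order.TTheory GRing.Theory Num.Theory.
Import numFieldNormedType.Exports.

Local Open Scope classical_set_scope.
Local Open Scope ring_scope.

(** Condition on the first coordinate of the ball: the other coordinates have a
    density of the form V (r - phi_2 x_2 - ... - phi_n x_n), and a quantile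
    coupling together with log-concavity of V shows that their absolute values
    increase stochastically with the level r, hence decrease stochastically with
    |x_1|. Consequently the expectation of a function that is supermodular in
    |x_1| and the remaining |x_i| can only increase when x_1 is replaced by an
    independent copy. For monotone y the maximum of 0 and the partial sums of
    y x_i, composed with g z = e^(l z) - l z, has this property, so its
    expectation is at most a product of one-dimensional moments, as for
    independent summands. With y x = +-(x^2 - L^2) truncated at a, those moments
    are bounded as in Bennett's inequality, by E (X^2 - L^2)^2 <= 5 L^4, a
    consequence of the log-concavity of the marginals. *)

(** Removing a coordinate from the uniform law on a ball leaves a law that is no longer uniform, so
    an induction cannot stay within balls. The densities [W (1 - phi_1 x_1 - ... - phi_n x_n)], with
    [W] nondecreasing and log-concave, are stable under both operations that occur: fixing a
    coordinate lowers the level, integrating it out changes the weight. Comparisons of conditional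
    expectations are cross-multiplied because the normalizing masses may vanish. The coupling has to
    move [|x|] and the residual level together; each is a separate one-dimensional comparison, and
    both are read off the same quantile. The maximum includes 0 so that it obeys a recursion in the
    first coordinate, which fits the removal of that coordinate. Constants: the two-sided
    exponential law has E X^4 = 6 (E X^2)^2, whence E (X^2 - L^2)^2 <= 6 L^4 - 2 L^4 + L^4 = 5 L^4.
    Bounding e^(l z) by 2 g z doubles this variance in the exponent and puts a factor 2 in front;
    the two signs of y turn it into 4. *)

(** * Symmetric intervals and one-dimensional Brunn-Minkowski inequalities *)

Section balanced.
Context {R : realType}.
Implicit Types (A B C D : set R) (x y : R).

(** These are the symmetric intervals around 0, possibly empty or unbounded. Sublevel sets of gauges
    have this form, which gives their measurability without any regularity of the gauge. *)
Definition balanced A := forall x y, `|x| <= `|y| -> A y -> A x.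

Lemma balanced_interval A : balanced A -> is_interval A.
Proof.
move=> bA x y Ax Ay z /andP[xz zy].
have [z0|z0] := leP 0 z.
  by apply: bA Ay; rewrite ger0_norm// ger0_norm// (le_trans z0).
by apply: bA Ax; rewrite !ler0_norm ?lerN2 ?(ltW z0)// (le_trans xz)// ltW.
Qed.

Lemma measurable_balanced A : balanced A -> measurable A.
Proof. by move=> /balanced_interval/is_interval_measurable. Qed.

(** Whether the endpoints belong to [A] is unknown, so [A] is only caught between the open and the
    closed ball of radius [sup A]; both have measure [2 * a]. *)
Lemma balanced_half A b : balanced A -> A 0 -> (forall x, A x -> `|x| <= b) ->
  exists a : R, [/\ 0 <= a, lebesgue_measure A = (2 * a)%:E,
    forall x, `|x| < a -> A x & forall x, A x -> `|x| <= a].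
Proof.
move=> bA A0 Ab; pose a := sup A.
have supA : has_sup A.
  split; first by exists 0.
  by exists b => x /Ab; apply: le_trans; exact: ler_norm.
have a0 : 0 <= a by exact: ub_le_sup supA.2 _ A0.
have Aa x : A x -> `|x| <= a.
  move=> Ax; apply: ub_le_sup; first exact: supA.2.
  by apply: bA Ax; rewrite normr_id.
have aA x : `|x| < a -> A x.
  rewrite -subr_gt0 => /sup_adherent/(_ supA)[y Ay xy].
  apply: bA Ay; move: xy; rewrite -/a opprB addrC subrK => /ltW/le_trans; apply.
  exact: ler_norm.
exists a; split=> //; apply/eqP; rewrite eq_le; apply/andP; split.
  have -> : (2 * a)%:E = lebesgue_measure `[- a, a]%classic.
    rewrite lebesgue_measure_itv/= lte_fin.
    case: ltP => [_|aNa]; first by rewrite -EFinB opprK mulr2n mulrDl mul1r.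
    by congr (_%:E); lra.
  apply: le_measure; rewrite ?inE//; first exact: measurable_balanced.
  by move=> x /Aa; rewrite ler_norml /= in_itv.
have -> : (2 * a)%:E = lebesgue_measure `]- a, a[%classic.
  rewrite lebesgue_measure_itv/= lte_fin.
  case: ltP => [_|aNa]; first by rewrite -EFinB opprK mulr2n mulrDl mul1r.
  by congr (_%:E); lra.
apply: le_measure; rewrite ?inE//; first exact: measurable_balanced.
by move=> x; rewrite /= in_itv/= => xa; apply: aA; rewrite ltr_norml.
Qed.

(** Symmetric intervals are known up to endpoints from their half-lengths, so it suffices to combine
    a point near the right end of [A] with one near the right end of [B]. *)
Lemma brunn_minkowski1 A B C b t : 0 <= t <= 1 ->
  balanced A -> A 0 -> (forall x, A x -> `|x| <= b) ->
  balanced B -> B 0 -> (forall x, B x -> `|x| <= b) ->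
  balanced C -> (forall x y, A x -> B y -> C (t * x + (1 - t) * y)) ->
  (t%:E * lebesgue_measure A + (1 - t)%:E * lebesgue_measure B
     <= lebesgue_measure C)%E.
Proof.
move=> /andP[t0 t1] bA A0 Ab bB B0 Bb bC ABC.
have [al [al0 -> alA Aal]] := balanced_half bA A0 Ab.
have [be [be0 -> beB Bbe]] := balanced_half bB B0 Bb.
(* [C] may be unbounded. Convex combinations of points of [A] and [B] have absolute value at most
   [b], so cutting [C] there loses none of them. *)
pose D := C `&` [set x | `|x| <= b].
have D0 : D 0.
  split; first by have := ABC _ _ A0 B0; rewrite !mulr0 addr0.
  by rewrite /= normr0 (le_trans _ (Ab _ A0)).
have bD : balanced D.
  by move=> x y xy [Cy yb]; split; [exact: bC xy Cy|exact: le_trans xy yb].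
have ABD x y : A x -> B y -> D (t * x + (1 - t) * y).
  move=> Ax By; split; first exact: ABC.
  rewrite /= (le_trans (ler_normD _ _))// !normrM (ger0_norm t0) [`|1 - t|]ger0_norm ?subr_ge0//.
  have -> : b = t * b + (1 - t) * b by ring.
  by apply: lerD; rewrite ler_wpM2l ?subr_ge0//; [exact: Ab|exact: Bb].
have [ga [ga0 gaE _ Dga]] := balanced_half bD D0 (fun x => @proj2 _ _).
apply: (@le_trans _ _ (lebesgue_measure D)); last first.
  apply: le_measure; rewrite ?inE; [exact: measurable_balanced..|].
  exact: subIsetl.
rewrite gaE -!EFinM -EFinD lee_fin; apply/ler_addgt0Pr => e e0.
have hA : exists2 x, A x & al - e / 2 <= x.
  have [|] := ltP 0 (al - e / 2) => h.
    by exists (al - e / 2) => //; apply: alA; rewrite ger0_norm ?(ltW h)// ltrBlDr ltrDl divr_gt0.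
  by exists 0.
have hB : exists2 x, B x & be - e / 2 <= x.
  have [|] := ltP 0 (be - e / 2) => h.
    by exists (be - e / 2) => //; apply: beB; rewrite ger0_norm ?(ltW h)// ltrBlDr ltrDl divr_gt0.
  by exists 0.
have [x Ax xal] := hA; have [y By ybe] := hB.
have := le_trans (ler_norm _) (Dga _ (ABD _ _ Ax By)).
have : t * (al - e / 2) <= t * x by rewrite ler_wpM2l.
have : (1 - t) * (be - e / 2) <= (1 - t) * y by rewrite ler_wpM2l// subr_ge0.
move=> h1 h2 h3.
have -> : t * (2 * al) + (1 - t) * (2 * be) = 2 * (t * (al - e / 2) + (1 - t) * (be - e / 2)) + e by field.
lra.
Qed.

(** The parameter [t] may depend on [x] and [y]: the two points produced always add up to [x + y],
    and choosing [x] and [y] near the right ends compares the sums of the half-lengths. *)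
Lemma brunn_minkowski4 A B C D b :
  balanced A -> A 0 -> (forall x, A x -> `|x| <= b) ->
  balanced B -> B 0 -> (forall x, B x -> `|x| <= b) ->
  balanced C -> C 0 -> (forall x, C x -> `|x| <= b) ->
  balanced D -> D 0 -> (forall x, D x -> `|x| <= b) ->
  (forall x y, A x -> B y -> exists t : R,
     C (t * x + (1 - t) * y) /\ D ((1 - t) * x + t * y)) ->
  (lebesgue_measure A + lebesgue_measure B <=
   lebesgue_measure C + lebesgue_measure D)%E.
Proof.
move=> bA A0 Ab bB B0 Bb bC C0 Cb bD D0 Db ABCD.
have [al [al0 -> alA Aal]] := balanced_half bA A0 Ab.
have [be [be0 -> beB Bbe]] := balanced_half bB B0 Bb.
have [ga [ga0 -> _ Cga]] := balanced_half bC C0 Cb.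
have [de [de0 -> _ Dde]] := balanced_half bD D0 Db.
rewrite -!EFinD lee_fin; apply/ler_addgt0Pr => e e0.
have hA : exists2 x, A x & al - e / 4 <= x.
  have [|] := ltP 0 (al - e / 4) => h.
    by exists (al - e / 4) => //; apply: alA; rewrite ger0_norm ?(ltW h)// ltrBlDr ltrDl divr_gt0.
  by exists 0.
have hB : exists2 x, B x & be - e / 4 <= x.
  have [|] := ltP 0 (be - e / 4) => h.
    by exists (be - e / 4) => //; apply: beB; rewrite ger0_norm ?(ltW h)// ltrBlDr ltrDl divr_gt0.
  by exists 0.
have [x Ax xal] := hA; have [y By ybe] := hB.
have [t [/Cga Ct /Dde Dt]] := ABCD _ _ Ax By.
have := le_trans (ler_norm _) Ct; have := le_trans (ler_norm _) Dt.
lra.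
Qed.

End balanced.

(** * The layer-cake formula up to a given height *)

Section layer_cake.
Context {R : realType}.
Local Open Scope ereal_scope.
Let mu : {sigma_finite_measure set (measurableTypeR R) -> \bar R} := @lebesgue_measure R.

Lemma measurable_layer (k : R -> R) : measurable_fun setT k ->
  measurable_fun setT (fun u : R => lebesgue_measure [set x | (u <= k x)%R]).
Proof.
move=> mk.
have mkS r : measurable [set x | (r <= k x)%R].
  have -> : [set x | (r <= k x)%R] = setT `&` k @^-1` `[r, +oo[.
    by apply/seteqP; split => x /=; rewrite in_itv/= andbT; tauto.
  exact: mk.
apply: (measurability _ (ErealGenOInfty.measurableE R)) => _ [_ [r ->] <-].
rewrite setTI; apply: is_interval_measurable => s t/=.
rewrite !in_itv/= !andbT => _ fs u /andP[_ ut].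
rewrite in_itv/= andbT (lt_le_trans fs)//.
apply: le_measure; rewrite ?inE; [exact: mkS..|].
by move=> x /=; exact: le_trans.
Qed.

(** Tonelli on the part of the subgraph of [h] below height [b]. The cut is wanted in the
    Prekopa-Leindler argument, whose layers run only up to height 1. *)
Lemma layer_cake (h : R -> R) (b : R) : measurable_fun setT h ->
  (forall x, (0 <= h x)%R) -> (0 <= b)%R ->
  \int[mu]_(s in `]0%R, b]) mu [set x | (s <= h x)%R] =
  \int[mu]_x (Num.min (h x) b)%:E.
Proof.
move=> mh h0 b0.
pose k (z : measurableTypeR R * measurableTypeR R) : R :=
  \1_[set z | (0 < z.2 <= b)%R /\ (z.2 <= h z.1)%R] z.
have mk : measurable_fun setT k.
  apply: measurable_indic.
  have -> : [set z : measurableTypeR R * measurableTypeR R | (0 < z.2 <= b)%R /\ (z.2 <= h z.1)%R] =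
     (setT `&` snd @^-1` `]0%R, b]%classic) `&` (setT `&` (fun z => h z.1 - z.2)%R @^-1` `[0%R, +oo[%classic).
    by apply/seteqP; split => z /=; rewrite !in_itv/= andbT subr_ge0 => -[] *; tauto.
  apply: measurableI; first exact: measurable_snd.
  apply: measurable_funB => //; exact: measurableT_comp mh _.
transitivity (\int[mu]_s \int[mu]_x (k (x, s))%:E).
  rewrite integral_mkcond; apply: eq_integral => s _.
  rewrite patchE; case: ifPn => [|]; rewrite ?inE/= ?in_itv/= => sb.
    have -> : mu [set x | (s <= h x)%R] = \int[mu]_x (\1_[set x | (s <= h x)%R] x)%:E.
      rewrite integral_indic ?setIT//.
      have -> : [set x | (s <= h x)%R] = setT `&` h @^-1` `[s, +oo[%classic.
        by apply/seteqP; split => z /=; rewrite in_itv/= andbT => -[] *; tauto.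
      exact: mh.
    apply: eq_integral => x _; rewrite /k !indicE; congr ((nat_of_bool _)%:R%:E).
    by apply/idP/idP; rewrite !inE/= => *; tauto.
  rewrite integral0_eq// => x _; rewrite /k indicE memNset//= => -[].
  by move=> sb' _; move/negP: sb; apply; rewrite inE/= in_itv.
rewrite -(fubini_tonelli (fun z => (k z)%:E)); last 2 first.
- exact/measurable_EFinP.
- by move=> z; rewrite lee_fin.
apply: eq_integral => x _.
transitivity (mu `]0%R, Num.min (h x) b]%classic).
  rewrite -[X in mu X]setIT -integral_indic//; apply: eq_integral => s _.
  rewrite /k !indicE; congr ((nat_of_bool _)%:R%:E).
  apply/idP/idP; rewrite !inE/= in_itv/= le_min; first by case=> /andP[-> ->] ->.
  by move=> /andP[-> /andP[-> ->]].
rewrite [LHS]lebesgue_measure_itv/= lte_fin.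
case: ltP; rewrite ?sube0// => h1.
congr (_%:E); apply/eqP; rewrite eq_le h1 le_min h0 b0.
by [].
Qed.

End layer_cake.

(** * Gauges and log-concave weights *)

Notation lebm R := (@lebesgue_measure R : {sigma_finite_measure set (measurableTypeR R) -> \bar R}).

Section gauge.
Context {R : realType}.

(* The densities considered are W (1 - \sum_i phi_i x_i), so only the values of W
   on ]-oo, 1] matter, and phi needs to be convex only where it is at most 1.
   Log-concavity of W is expressed with exponentials because W may vanish. *)
Record gauge (phi : R -> R) : Prop := Gauge {
  gauge0 : phi 0 = 0;
  gauge_mono : forall x y, `|x| <= `|y| -> phi x <= phi y;
  gauge_convex : forall t x y, 0 <= t <= 1 -> phi x <= 1 -> phi y <= 1 ->
    phi (t * x + (1 - t) * y) <= t * phi x + (1 - t) * phi y;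
  gauge_bounded : forall v, exists b, forall x, phi x <= v -> `|x| <= b }.

Record weight (W : R -> R) : Prop := Weight {
  weight_lt0 : forall r, r < 0 -> W r = 0;
  weight_mono : {homo W : r s / r <= s};
  weight_log_concave : forall t r s c d, 0 <= t <= 1 -> r <= 1 -> s <= 1 ->
    expR c <= W r -> expR d <= W s ->
    expR (t * c + (1 - t) * d) <= W (t * r + (1 - t) * s) }.

Section gauge_theory.
Variables (phi : R -> R) (gphi : gauge phi).

Lemma gauge_ge0 x : 0 <= phi x.
Proof. by rewrite -(gauge0 gphi); apply: (gauge_mono gphi); rewrite normr0. Qed.

Lemma gauge_norm x : phi `|x| = phi x.
Proof. by apply/eqP; rewrite eq_le !(gauge_mono gphi)// normr_id. Qed.

Lemma gauge_sublevel_balanced (D : set R) :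
  (forall s t, s <= t -> D t -> D s) -> balanced [set x | D (phi x)].
Proof. by move=> Dd x y xy; apply: Dd; exact: gauge_mono gphi _ _ xy. Qed.

Lemma measurable_gauge : measurable_fun setT phi.
Proof.
apply: (measurability (@RGenInftyO.G R)) => [|_ [_ [r ->] <-]].
  exact: RGenInftyO.measurableE.
rewrite setTI; apply: measurable_balanced.
apply: (@gauge_sublevel_balanced `]-oo, r[) => s t st /=.
by rewrite !in_itv/=; exact: le_lt_trans.
Qed.

End gauge_theory.

Section weight_theory.
Variables (W : R -> R) (wW : weight W).

Lemma weight_ge0 r : 0 <= W r.
Proof.
have h : Num.min r (-1) < 0 by rewrite gt_min ltrN10 orbT.
rewrite -(weight_lt0 wW h); apply: (weight_mono wW).
by rewrite ge_min lexx.
Qed.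

Lemma measurable_weight : measurable_fun setT W.
Proof. apply: nondecreasing_measurable => //; exact: weight_mono. Qed.

Lemma weight_gt0_ge0 r : 0 < W r -> 0 <= r.
Proof. by rewrite leNgt; apply: contraTN => /(weight_lt0 wW) ->; rewrite ltxx. Qed.

(** [r] and [s - c] lie between [r - c] and [s] and have the same sum, so they are convex
    combinations of these two points with exchanged coefficients. In other words,
    [W (s - c) / W (r - c)] is nondecreasing in [c] as long as it makes sense. *)
Lemma weight_exchange r s c : r <= s -> s <= 1 -> 0 <= c ->
  W (r - c) * W s <= W r * W (s - c).
Proof.
move=> rs s1 c0.
have [->|rc0] := eqVneq (W (r - c)) 0; first by rewrite mul0r mulr_ge0 ?weight_ge0.
have [->|s0] := eqVneq (W s) 0; first by rewrite mulr0 mulr_ge0 ?weight_ge0.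
have wrc : 0 < W (r - c) by rewrite lt_def rc0 weight_ge0.
have ws : 0 < W s by rewrite lt_def s0 weight_ge0.
have [rse|rse] := eqVneq (s - r + c) 0.
  have -> : c = 0 by lra.
  have -> : r = s by lra.
  by rewrite subr0.
have dp : 0 < s - r + c by rewrite lt_def rse /=; lra.
pose t := c / (s - r + c).
have t01 : 0 <= t <= 1.
  by rewrite divr_ge0 ?(ltW dp)//= ler_pdivrMr// mul1r; lra.
have t01' : 0 <= 1 - t <= 1 by lra.
have rc1 : r - c <= 1 by lra.
have el : expR (ln (W (r - c))) <= W (r - c) by rewrite lnK.
have es : expR (ln (W s)) <= W s by rewrite lnK.
have := weight_log_concave wW t01 s1 rc1 es el.
have := weight_log_concave wW t01' s1 rc1 es el.
have -> : t * s + (1 - t) * (r - c) = r by rewrite /t; field.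
have -> : (1 - t) * s + (1 - (1 - t)) * (r - c) = s - c by rewrite /t; field.
move=> h1 h2; have := ler_pM (expR_ge0 _) (expR_ge0 _) h2 h1.
rewrite -expRD.
rewrite (_ : _ + _ = ln (W (r - c)) + ln (W s)); last by ring.
by rewrite expRD !lnK.
Qed.

End weight_theory.

Lemma expR_convex (t c d : R) : 0 <= t <= 1 ->
  expR (t * c + (1 - t) * d) <= t * expR c + (1 - t) * expR d.
Proof.
move=> /andP[t0 t1]; set z := t * c + (1 - t) * d.
have h y : expR z * (1 + (y - z)) <= expR y.
  by rewrite -[leRHS](_ : expR z * expR (y - z) = _) ?ler_wpM2l ?expR_ge0 ?expR_ge1Dx// -expRD addrC subrK.
have := ler_wpM2l t0 (h c); have h1 : 0 <= 1 - t by lra.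
have := ler_wpM2l h1 (h d).
move=> hd hc; apply: le_trans (lerD hc hd).
by rewrite le_eqVlt; apply/orP; left; apply/eqP; rewrite /z; ring.
Qed.

(** The weight left to the other coordinates when one coordinate of gauge [phi] is integrated out.
    It is real-valued so that it can serve as a weight again; [wtrE] shows that [fine] loses
    nothing. *)
Definition wtr (phi W : R -> R) (r : R) : R :=
  fine (\int[lebm R]_x (W (r - phi x))%R%:E).

Lemma integral_bounded_support (k : R -> R) (M b : R) : measurable_fun setT k ->
  (forall x, 0 <= k x <= M) -> (forall x, k x != 0 -> `|x| <= b) ->
  (\int[lebm R]_x (k x)%:E < +oo)%E.
Proof.
move=> mk kM kb.
have M0 : 0 <= M by case/andP: (kM 0) => /le_trans; exact.
apply: (@le_lt_trans _ _ (\int[lebm R]_(x in `[(- b)%R, b%R]) (cst M%:E) x)%E).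
  rewrite [leRHS]integral_mkcond; apply: ge0_le_integral => //.
  - by move=> x _; rewrite lee_fin; case/andP: (kM x).
  - exact/measurable_EFinP.
  - by apply/(measurable_restrictT _ _).1.
  - move=> x _; rewrite patchE; case: ifPn => xb; first by rewrite lee_fin; case/andP: (kM x).
    rewrite lee_fin; have [->//|/kb xb'] := eqVneq (k x) 0.
    by move: xb; rewrite notin_setE/= in_itv/= -ler_norml.
rewrite integral_cst//= lte_mul_pinfty// ?lee_fin//.
by apply: compact_finite_measure; exact: segment_compact.
Qed.

Section wtr_theory.
Variables (phi W : R -> R) (gphi : gauge phi) (wW : weight W).

Lemma measurable_wtr_fun r : measurable_fun setT (fun x => W (r - phi x)).
Proof.
apply: measurableT_comp; first exact: measurable_weight.
apply: measurable_funB => //; exact: measurable_gauge.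
Qed.

Lemma wtr_fun_bound r x : 0 <= W (r - phi x) <= W r.
Proof.
by rewrite weight_ge0//= (weight_mono wW)// lerBlDr lerDl gauge_ge0.
Qed.

Lemma wtr_fun_support r x : W (r - phi x) != 0 -> phi x <= r.
Proof.
by rewrite leNgt; apply: contra => h; rewrite (weight_lt0 wW)// subr_lt0.
Qed.

Lemma wtr_ltey r : (\int[lebm R]_x (W (r - phi x))%R%:E < +oo)%E.
Proof.
have [b hb] := gauge_bounded gphi r.
apply: (@integral_bounded_support _ (W r) b) => [|x|x /wtr_fun_support/hb//].
  exact: measurable_wtr_fun.
exact: wtr_fun_bound.
Qed.

Lemma wtrE r : (wtr phi W r)%:E = (\int[lebm R]_x (W (r - phi x))%R%:E)%E.
Proof.
rewrite /wtr fineK// ge0_fin_numE ?wtr_ltey//.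
by apply: integral_ge0 => x _; rewrite lee_fin weight_ge0.
Qed.

Lemma wtr_mono : {homo wtr phi W : r s / r <= s}.
Proof.
move=> r s rs; rewrite -lee_fin !wtrE; apply: ge0_le_integral => //.
- by move=> x _; rewrite lee_fin weight_ge0.
- by apply/measurable_EFinP; exact: measurable_wtr_fun.
- by apply/measurable_EFinP; exact: measurable_wtr_fun.
- by move=> x _; rewrite lee_fin (weight_mono wW)// lerB.
Qed.

Lemma wtr_lt0 r : r < 0 -> wtr phi W r = 0.
Proof.
move=> r0; rewrite /wtr integral0_eq// => x _.
by rewrite (weight_lt0 wW)// subr_lt0 (lt_le_trans r0)// gauge_ge0.
Qed.

Lemma wtr_gt0 r : 0 < wtr phi W r -> 0 < W r.
Proof.
rewrite [in X in _ -> X]lt_def weight_ge0// andbT; apply: contraTneq => Wr0.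
rewrite -leNgt /wtr integral0_eq// => x _; congr EFin.
by apply/eqP; rewrite eq_le weight_ge0// andbT -[leRHS]Wr0 (andP (wtr_fun_bound _ _)).2.
Qed.

Lemma layer_wtr r (m : R) : 0 < m ->
  (\int[lebm R]_(s in `]0%R, 1%R])
     lebesgue_measure [set x | (s * m <= W (r - phi x))%R] =
   \int[lebm R]_x (Num.min (W (r - phi x) / m) 1)%R%:E)%E.
Proof.
move=> m0; rewrite -(@layer_cake R (fun x => W (r - phi x) / m) 1)//.
- apply: eq_integral => s _; congr (lebesgue_measure _).
  by apply/seteqP; split => x /=; rewrite ler_pdivlMr.
- apply: measurable_funM => //; exact: measurable_wtr_fun.
- by move=> x; apply: divr_ge0; [exact: weight_ge0|exact: ltW].
Qed.

(* Prekopa-Leindler: the superlevel sets of x |-> W (r - phi x), rescaled by its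
   maximum W r, are symmetric intervals, to which the one-dimensional
   Brunn-Minkowski inequality applies. *)
Lemma wtr_log_concave t r s c d : 0 <= t <= 1 -> r <= 1 -> s <= 1 ->
  expR c <= wtr phi W r -> expR d <= wtr phi W s ->
  expR (t * c + (1 - t) * d) <= wtr phi W (t * r + (1 - t) * s).
Proof.
move=> t01 r1 s1 cr ds; set q := t * r + (1 - t) * s.
have /andP[t0 t1] := t01.
have Wr := wtr_gt0 (lt_le_trans (expR_gt0 _) cr).
have Ws := wtr_gt0 (lt_le_trans (expR_gt0 _) ds).
have eE : expR (ln (W r)) = W r by rewrite lnK.
have fE : expR (ln (W s)) = W s by rewrite lnK.
set e := ln (W r) in eE; set f := ln (W s) in fE.
(* The height to which the layers at level [q] are scaled: the geometric mean of the maxima [W r]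
   and [W s]. *)
pose M := expR (t * e + (1 - t) * f).
have M0 : 0 < M by exact: expR_gt0.
pose L (p m u : R) := lebesgue_measure [set x | u * m <= W (p - phi x)].
have bal (p m u : R) : balanced [set x | u * m <= W (p - phi x)].
  apply: (@gauge_sublevel_balanced _ gphi [set y | u * m <= W (p - y)]) => x y xy /= h.
  by rewrite (le_trans h)// (weight_mono wW)// lerB.
have fin p : (\int[lebm R]_x (W (p - phi x))%R%:E = (wtr phi W p)%:E)%E by rewrite wtrE.
have full p : 0 < W p ->
    (\int[lebm R]_(u in `]0%R, 1%R]) L p (W p) u = (wtr phi W p / W p)%R%:E)%E.
  move=> Wp; rewrite layer_wtr//.
  rewrite mulrC EFinM -fin -ge0_integralZl_EFin//; last 3 first.
  - by move=> x _; rewrite lee_fin weight_ge0.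
  - by apply/measurable_EFinP; exact: measurable_wtr_fun.
  - by rewrite invr_ge0 ltW.
  apply: eq_integral => x _; rewrite -EFinM min_l; first by rewrite mulrC.
  by rewrite ler_pdivrMr// mul1r (andP (wtr_fun_bound _ _)).2.
have mL (p m : R) : 0 < m -> measurable_fun (`]0, 1]%classic : set R) (L p m).
  move=> m0; apply: measurable_funTS.
  have -> : L p m = (fun u : R => lebesgue_measure [set x | u <= W (p - phi x) / m]).
    apply/funext => u; congr (lebesgue_measure _).
    by apply/seteqP; split => x /=; rewrite ler_pdivlMr.
  apply: (@measurable_layer _ (fun x => W (p - phi x) / m)); apply: measurable_funM => //; exact: measurable_wtr_fun.
(* Because [u <= 1], the layers at levels [r] and [s] both contain 0. This is the gain from
   rescaling by the maxima: Brunn-Minkowski fails if one of the sets is empty. *)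
have LM u : u \in `]0, 1] -> (t%:E * L r (W r) u + (1 - t)%:E * L s (W s) u <= L q M u)%E.
  rewrite in_itv/= => /andP[u0 u1].
  have [b1 hb1] := gauge_bounded gphi r; have [b2 hb2] := gauge_bounded gphi s.
  have pos v x : 0 < W v -> u * W v <= W (v - phi x) -> phi x <= v.
    move=> Wv h; apply: wtr_fun_support; rewrite gt_eqF// (lt_le_trans _ h)//.
    exact: mulr_gt0.
  apply: (@brunn_minkowski1 _ _ _ _ (Num.max b1 b2)) => //.
  - by rewrite /= gauge0 ?subr0 ?ler_piMl// ltW.
  - by move=> x /= /(pos _ _ Wr)/hb1 h; rewrite le_max h.
  - by rewrite /= gauge0 ?subr0 ?ler_piMl// ltW.
  - by move=> x /= /(pos _ _ Ws)/hb2 h; rewrite le_max h orbT.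
  move=> x y /= hx hy.
  have px := pos _ _ Wr hx; have py := pos _ _ Ws hy.
  have hx' : expR (ln u + e) <= W (r - phi x) by rewrite expRD eE lnK.
  have hy' : expR (ln u + f) <= W (s - phi y) by rewrite expRD fE lnK.
  have rx1 : r - phi x <= 1 by rewrite (le_trans _ r1)// lerBlDr lerDl gauge_ge0.
  have sy1 : s - phi y <= 1 by rewrite (le_trans _ s1)// lerBlDr lerDl gauge_ge0.
  have := weight_log_concave wW t01 rx1 sy1 hx' hy'.
  have -> : t * (ln u + e) + (1 - t) * (ln u + f) = ln u + (t * e + (1 - t) * f) by ring.
  rewrite expRD lnK// => /le_trans; apply; apply: (weight_mono wW).
  have := gauge_convex gphi t01 (le_trans px r1) (le_trans py s1).
  by rewrite /q; lra.
have key : t * (wtr phi W r / W r) + (1 - t) * (wtr phi W s / W s) <= wtr phi W q / M.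
  rewrite -lee_fin EFinD (EFinM t) (EFinM (1 - t)) -!full// [leRHS]EFinM.
  rewrite -!ge0_integralZl_EFin//; [|exact: mL|by rewrite subr_ge0|exact: mL].
  rewrite -ge0_integralD//; last 4 first.
  - by move=> x _; rewrite mule_ge0.
  - by apply: emeasurable_funM => //; exact: mL.
  - by move=> x _; rewrite mule_ge0// lee_fin subr_ge0.
  - by apply: emeasurable_funM => //; exact: mL.
  apply: (@le_trans _ _ (\int[lebm R]_(u in `]0%R, 1%R]) L q M u)%E).
    apply: ge0_le_integral => //.
    - by move=> x _; rewrite adde_ge0// mule_ge0// lee_fin subr_ge0.
    - by apply: emeasurable_funD; apply: emeasurable_funM => //; exact: mL.
    - exact: mL.
  (* [M] may be smaller than the maximum [W q], so the layers up to height 1 only produce the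
     minimum of [W (q - phi x) / M] and 1, which is enough for an upper bound. *)
  rewrite layer_wtr// muleC -fin -ge0_integralZl_EFin//; last 3 first.
  - by move=> x _; rewrite lee_fin weight_ge0.
  - by apply/measurable_EFinP; exact: measurable_wtr_fun.
  - by rewrite invr_ge0 ltW.
  apply: ge0_le_integral => //.
  - by move=> x _; rewrite lee_fin le_min ler01 andbT; apply: divr_ge0; [exact: weight_ge0|exact: ltW].
  - apply/measurable_EFinP; apply: measurable_minr => //.
    by apply: measurable_funM => //; exact: measurable_wtr_fun.
  - apply/measurable_EFinP; apply: measurable_funM => //; exact: measurable_wtr_fun.
  - by move=> x _; rewrite lee_fin ge_min mulrC lexx.
(* [key] bounds an arithmetic mean of normalized masses; convexity of [expR] turns it into the
   geometric mean required by log-concavity. *)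
have h1 : expR (c - e) <= wtr phi W r / W r.
  by rewrite expRD expRN eE ler_wpM2r// invr_ge0 ltW.
have h2 : expR (d - f) <= wtr phi W s / W s.
  by rewrite expRD expRN fE ler_wpM2r// invr_ge0 ltW.
have h3 : expR (t * (c - e) + (1 - t) * (d - f)) <= wtr phi W q / M.
  apply: le_trans (expR_convex _ _ t01) (le_trans _ key).
  by apply: lerD; apply: ler_wpM2l => //; rewrite subr_ge0.
move: h3; rewrite ler_pdivlMr// -expRD.
by congr (expR _ <= _); ring.
Qed.

Lemma weight_wtr : weight (wtr phi W).
Proof. by split; [exact: wtr_lt0|exact: wtr_mono|exact: wtr_log_concave]. Qed.

End wtr_theory.
End gauge.

Section integral_aux.
Local Open Scope ereal_scope.
Context d (T : measurableType d) {R : realType}.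

Lemma ge0_integral_mrestr (m : {measure set T -> \bar R}) (D : set T)
    (mD : measurable D) (f : T -> \bar R) :
  measurable_fun setT f -> (forall x, 0 <= f x) ->
  \int[mrestr m mD]_x f x = \int[m]_(x in D) f x.
Proof.
move=> mf f0; have mDC := measurableC mD.
rewrite -(setUv D) ge0_integral_setU//; last 2 first.
- by rewrite setUv.
- exact/disj_setPCl.
rewrite [X in _ + X = _](_ : _ = 0) ?adde0.
  apply: eq_measure_integral => A mA AD.
  by rewrite /= /mrestr setIidl.
rewrite (@eq_measure_integral _ _ _ _ mzero) ?integral_measure_zero// => A mA AD.
rewrite /= /mrestr /mzero (_ : A `&` D = set0) ?measure0//.
by apply/seteqP; split => x // -[/AD].
Qed.

End integral_aux.

(** * Quantiles of one-dimensional symmetric densities *)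

Section hypograph.
Context {R : realType}.
Local Open Scope ereal_scope.
Variables (p : R -> R).
Hypothesis mp : measurable_fun setT p.
Hypothesis p0 : forall x, (0 <= p x)%R.

Let hyp : set (measurableTypeR R * measurableTypeR R) :=
  [set z | (0 < z.2 <= p z.1)%R].

Lemma measurable_hypograph : measurable hyp.
Proof.
have -> : hyp = (setT `&` snd @^-1` `]0%R, +oo[%classic) `&`
    (setT `&` (fun z => p z.1 - z.2)%R @^-1` `[0%R, +oo[%classic).
  apply/seteqP; split => z; rewrite /hyp /= !in_itv/= !andbT subr_ge0.
    by move=> /andP[].
  by case=> -[_ ->] [_ ->].
apply: measurableI; first exact: measurable_snd.
apply: measurable_funB => //; exact: measurableT_comp mp _.
Qed.

(** The measure of density [p] is the projection of the plane Lebesgue measure restricted to the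
    region under the graph. In this form it is a pushforward, and [integral_quantile] can compare it
    with another pushforward. *)
Lemma integral_hypograph (g : R -> R) : measurable_fun setT g ->
  (forall x, 0 <= g x)%R ->
  \int[lebm R \x lebm R]_(z in hyp) (g z.1)%:E = \int[lebm R]_x (g x * p x)%:E.
Proof.
move=> mg g0; have mh := measurable_hypograph.
rewrite integral_mkcond fubini_tonelli1//; last 2 first.
- apply/(measurable_restrictT _ _).1 => //; apply/measurable_funTS/measurable_EFinP.
  exact: measurableT_comp mg _.
- by move=> z; rewrite patchE; case: ifPn => // _; rewrite lee_fin.
apply: eq_integral => x _; rewrite /fubini_F.
transitivity (\int[lebm R]_y ((g x)%:E * (\1_(`]0%R, p x]%classic : set R) y)%:E)).
  apply: eq_integral => y _; rewrite patchE indicE.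
  case: ifPn => [|/negP] h.
    rewrite mem_set ?mule1//.
    by move: h; rewrite inE /hyp/= in_itv.
  rewrite memNset ?mule0// => h'; apply: h; rewrite inE /hyp/=.
  by move: h'; rewrite /= in_itv.
rewrite ge0_integralZl_EFin//.
  rewrite integral_indic// setIT EFinM; congr (_ * _).
  rewrite [LHS]lebesgue_measure_itv/= lte_fin.
  by case: ltP (p0 x) => [|h1 h2]; rewrite ?sube0//; congr EFin; apply/eqP; rewrite eq_le h2.
by apply/measurable_EFinP/measurable_indic.
Qed.

End hypograph.

Section quantile.
Context {R : realType}.
Variables (p : R -> R) (M b : R).
Hypothesis mp : measurable_fun setT p.
Hypothesis pM : forall x, 0 <= p x <= M.
Hypothesis pb : forall x, p x != 0 -> `|x| <= b.

Let p0 x : 0 <= p x. Proof. by case/andP: (pM x). Qed.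
Let M0 : 0 <= M. Proof. by case/andP: (pM 0) => /le_trans; exact. Qed.
Let mpE : measurable_fun setT (EFin \o p).
Proof. exact/measurable_EFinP. Qed.

Lemma measurable_absball (c : R) : measurable [set x : R | `|x| <= c].
Proof. by apply: measurable_balanced => x y /= /le_trans; exact. Qed.

Definition mass : R := fine (\int[lebm R]_x (p x)%:E).

Definition ballmass (c : R) : R :=
  fine (\int[lebm R]_(x in [set x | `|x| <= c]) (p x)%:E).

(** The generalized inverse of the distribution function of [|x|]. Without [Num.min w 1] the set
    would be empty for [w > 1] when the mass is positive, the infimum would take its default value
    0, and monotonicity in [w], hence measurability, would be lost. *)
Definition quant (w : R) : R := inf [set c | 0 <= c /\ Num.min w 1 * mass <= ballmass c].

Let sub_fin (D : set R) : measurable D ->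
  (\int[lebm R]_(x in D) (p x)%:E)%E \is a fin_num.
Proof.
move=> mD; rewrite ge0_fin_numE; last by apply: integral_ge0 => x _; rewrite lee_fin.
apply: le_lt_trans (integral_bounded_support mp pM pb).
apply: ge0_subset_integral => //; first by move=> x _; rewrite lee_fin.
Qed.

Lemma massE : mass%:E = (\int[lebm R]_x (p x)%:E)%E.
Proof. by rewrite /mass fineK// sub_fin. Qed.

Lemma ballmassE c : (ballmass c)%:E = (\int[lebm R]_(x in [set x | `|x| <= c]%R) (p x)%:E)%E.
Proof. by rewrite /ballmass fineK// (sub_fin (measurable_absball c)). Qed.

Lemma ballmass_out c :
  (\int[lebm R]_(x in [set x | c < `|x|]%R) (p x)%:E)%E = (mass - ballmass c)%:E.
Proof.
have mC : measurable [set x : R | c < `|x|].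
  have -> : [set x : R | c < `|x|] = ~` [set x : R | `|x| <= c].
    by apply/seteqP; split => x /=; [move=> h /(lt_le_trans h); rewrite ltxx|move/negP; rewrite -ltNge].
  by apply: measurableC; exact: measurable_absball.
rewrite EFinB massE ballmassE.
rewrite (_ : \int[lebm R]_x _ = \int[lebm R]_(x in [set x | `|x| <= c]%R) (p x)%:E + \int[lebm R]_(x in [set x | c < `|x|]%R) (p x)%:E)%E.
  by rewrite [X in (X - _)%E]addeC addeK// (sub_fin (measurable_absball c)).
rewrite -ge0_integral_setU//.
- congr (integral _ _ _); apply/seteqP; split => x //= _.
  by case: (leP `|x| c); [left|right].
- exact: (measurable_absball c).
- exact: measurable_funTS.
- by move=> x _; rewrite lee_fin.
- by apply/disj_setPS => x /= [h' h]; move: (lt_le_trans h h'); rewrite ltxx.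
Qed.

Lemma ballmass_mono : {homo ballmass : c d / c <= d}.
Proof.
move=> c d cd; rewrite -lee_fin !ballmassE.
apply: ge0_subset_integral => //; [exact: measurable_absball..| | |].
- exact: measurable_funTS.
- by move=> x _; rewrite lee_fin.
- by move=> x /= /le_trans; exact.
Qed.

Lemma ballmass_le c : ballmass c <= mass.
Proof.
rewrite -lee_fin ballmassE massE; apply: ge0_subset_integral => //.
- exact: (measurable_absball c).
- by move=> x _; rewrite lee_fin.
Qed.

Lemma ballmass_ge0 c : 0 <= ballmass c.
Proof. by rewrite -lee_fin ballmassE; apply: integral_ge0 => x _; rewrite lee_fin. Qed.

Lemma ballmass_full c : b <= c -> ballmass c = mass.
Proof.
move=> bc; apply/eqP; rewrite -eqe ballmassE massE; apply/eqP.
rewrite integral_mkcond; apply: eq_integral => x _; rewrite patchE; case: ifPn => //.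
rewrite notin_setE/= => h; congr EFin; apply/esym/eqP; apply: contrapT => /negP/pb.
by move/le_trans => /(_ _ bc).
Qed.

Lemma ballmass_lt0 c : c < 0 -> ballmass c = 0.
Proof.
move=> c0; rewrite /ballmass (_ : [set x | _] = set0) ?integral_set0//.
apply/seteqP; split => x //= xc.
by have := lt_le_trans c0 (normr_ge0 x); rewrite ltNge xc.
Qed.

(** The shell between the radii is covered by two intervals of length [d - c]. Continuity of
    [ballmass] is what makes the infimum in [quant] attained, see [ballmass_quant]. *)
Lemma ballmass_lip c d : c <= d -> ballmass d <= ballmass c + 2 * M * (d - c).
Proof.
move=> cd.
have mD : measurable [set x : R | c < `|x| <= d].
  have -> : [set x : R | c < `|x| <= d] = [set x : R | `|x| <= d] `\` [set x : R | `|x| <= c].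
    apply/seteqP; split => x /=; first by move=> /andP[h ->]; split => // /(lt_le_trans h); rewrite ltxx.
    by move=> [-> /negP]; rewrite -ltNge => ->.
  by apply: measurableD; exact: measurable_absball.
have -> : ballmass d = ballmass c + fine (\int[lebm R]_(x in [set x | c < `|x| <= d]%R) (p x)%:E).
  apply/eqP; rewrite -eqe EFinD !ballmassE fineK ?sub_fin//; apply/eqP.
  rewrite -ge0_integral_setU//.
  - congr (integral _ _ _); apply/seteqP; split => x /=.
      by move=> h; case: (leP `|x| c) => xc; [left|right; apply/andP].
    by case=> [/le_trans|/andP[]//]; exact.
  - exact: (measurable_absball c).
  - exact: measurable_funTS.
  - by move=> x _; rewrite lee_fin.
  - by apply/disj_setPS => x /= [h' /andP[h _]]; move: (lt_le_trans h h'); rewrite ltxx.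
rewrite lerD2l -lee_fin fineK ?sub_fin//.
apply: (@le_trans _ _ (\int[lebm R]_(x in [set x | c < `|x| <= d]%R) (cst M%:E) x)%E).
  apply: ge0_le_integral => //.
  - by move=> x _; rewrite lee_fin.
  - exact: measurable_funTS.
  - by move=> x _; rewrite lee_fin; case/andP: (pM x).
rewrite integral_cst//.
have h : (lebesgue_measure [set x : R | (c < `|x| <= d)%R] <= (2 * (d - c))%:E)%E.
  apply: (@le_trans _ _ (lebesgue_measure (`[c, d] `|` `[- d, - c] : set R))).
    apply: le_measure; rewrite ?inE//; first exact: measurableU.
    move=> x /= /andP[h1 h2]; rewrite !in_itv/=.
    have [x0|x0] := leP 0 x.
      by left; move: h1 h2; rewrite ger0_norm// => /ltW -> ->.
    by right; move: h1 h2; rewrite ltr0_norm// lerNl => + ->; rewrite lerNr => /ltW ->.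
  apply: (@le_trans _ _ (lebesgue_measure (`[c, d]%classic : set R) +
    lebesgue_measure (`[(- d)%R, (- c)%R]%classic : set R))%E); first exact: measureU2.
  rewrite !lebesgue_measure_itv/= !lte_fin.
  case: ltP => _; case: ltP => _; rewrite -?EFinD ?addr0 ?add0r lee_fin; lra.
apply: le_trans (lee_wpmul2l _ h) _; first by rewrite lee_fin.
by rewrite -EFinM lee_fin mulrA [M * 2]mulrC.
Qed.

Hypothesis Z0 : 0 < mass.

Let E w := [set c | 0 <= c /\ Num.min w 1 * mass <= ballmass c].

Let E_ne w : E w !=set0.
Proof.
exists (Num.max b 0); split; first by rewrite le_max lexx orbT.
rewrite ballmass_full ?le_max ?lexx// ler_piMl ?(ltW Z0)//.
by rewrite ge_min lexx orbT.
Qed.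

Let E_inf w : has_inf (E w).
Proof. by split; [exact: E_ne|exists 0 => c []]. Qed.

Lemma quant_ge0 w : 0 <= quant w.
Proof. by apply: lb_le_inf; [exact: E_ne|move=> c []]. Qed.

Lemma quant_le w c : 0 <= c -> Num.min w 1 * mass <= ballmass c -> quant w <= c.
Proof. by move=> c0 wc; apply: ge_inf; [exact: (E_inf w).2|split]. Qed.

Lemma ballmass_quant w : Num.min w 1 * mass <= ballmass (quant w).
Proof.
apply/ler_addgt0Pr => e e0.
have d0 : 0 < e / (2 * M + 1) by rewrite divr_gt0// ltr_wpDl// mulr_ge0.
have [c [c0 wc] cq] := inf_adherent d0 (E_inf w).
apply: (le_trans wc).
have qc : quant w <= c by exact: quant_le.
apply: le_trans (ballmass_lip qc) _; rewrite lerD2l.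
have : c - quant w <= e / (2 * M + 1) by rewrite lerBlDl ltW.
move=> h; apply: le_trans (ler_wpM2l _ h) _; first by rewrite mulr_ge0.
have h1 : 0 < 2 * M + 1 by rewrite ltr_wpDl// mulr_ge0.
by rewrite mulrA ler_pdivrMr// mulrC ler_wpM2l ?(ltW e0)// lerDl.
Qed.

Lemma quant_le_ballmass w c : 0 <= c -> (quant w <= c) = (Num.min w 1 * mass <= ballmass c).
Proof.
move=> c0; apply/idP/idP => [h|]; last exact: quant_le.
exact: le_trans (ballmass_quant w) (ballmass_mono h).
Qed.

Lemma lt_quant w c : 0 < w < 1 -> (c < quant w) = (ballmass c < w * mass).
Proof.
move=> /andP[w0 w1]; have [c0|c0] := leP 0 c.
  by rewrite ltNge quant_le_ballmass// -ltNge min_l// ltW.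
by rewrite ballmass_lt0// mulr_gt0// (lt_le_trans c0)// quant_ge0.
Qed.

Lemma quant_mono : {homo quant : v w / v <= w}.
Proof.
move=> v w vw; rewrite quant_le_ballmass ?quant_ge0//.
apply: le_trans (ballmass_quant w); rewrite ler_pM2r//.
by rewrite le_min !ge_min vw lexx orbT.
Qed.

Lemma measurable_quant : measurable_fun setT quant.
Proof. exact: nondecreasing_measurable quant_mono. Qed.

(** Inverse transform: up to the factor [mass], the law of [|x|] under the density [p] is the image
    under [quant] of the uniform law on the unit interval. Evenness of [k] lets the integral depend
    on [|x|] only. *)
Lemma integral_quantile (k : R -> R) : measurable_fun setT k ->
  (forall x, 0 <= k x) -> (forall x, k `|x| = k x) ->
  (\int[lebm R]_x (k x * p x)%:E =
   mass%:E * \int[lebm R]_(w in `]0%R, 1%R[) (k (quant w))%:E)%E.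
Proof.
move=> mk k0 ke.
have mh := measurable_hypograph mp.
pose f1 (z : measurableTypeR R * measurableTypeR R) : measurableTypeR R := `|z.1|.
have mf1 : measurable_fun setT f1.
  by apply: measurableT_comp => //.
pose I : set (measurableTypeR R) := `]0, 1[%classic.
have mI : measurable I by exact: measurable_itv.
have mq : measurable_fun setT (quant : measurableTypeR R -> measurableTypeR R).
  exact: measurable_quant.
pose m1 : {measure set (measurableTypeR R) -> \bar R} :=
  measure_function_pushforward__canonical__measure_function_Measure
    (mrestr (lebm R \x lebm R)%E mh) mf1.
pose m2 : {measure set (measurableTypeR R) -> \bar R} :=
  measure_function_pushforward__canonical__measure_function_Measure
    (mscale (NngNum (ltW Z0)) (mrestr (lebm R) mI)) mq.
have m1E A : measurable A -> m1 A = (\int[lebm R]_(x in [set x : R | A `|x|%R]) (p x)%:E)%E.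
  move=> mA.
  have mA' : measurable [set x : R | A `|x|].
    have -> : [set x : R | A `|x|] = setT `&` (Num.norm : R -> R) @^-1` A by rewrite setTI.
    exact: measurable_realfun.normr_measurable.
  transitivity (\int[lebm R \x lebm R]_(z in [set z | (0 < z.2 <= p z.1)%R]) (\1_[set x : R | A `|x|%R] z.1)%:E)%E.
    rewrite (_ : (fun z => _) = (fun z => (\1_[set z : measurableTypeR R * measurableTypeR R | A `|z.1|%R] z)%:E)); last first.
      by apply/funext => z; rewrite !indicE; congr ((nat_of_bool _)%:R%:E); apply/idP/idP; rewrite !inE.
    rewrite integral_indic//.
    by have := mf1 measurableT _ mA; rewrite setTI.
  have mi : measurable_fun setT (\1_[set x : R | A `|x|%R] : R -> R) by exact: measurable_indic.
  rewrite (integral_hypograph mp p0 mi)//.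
  rewrite [RHS]integral_mkcond; apply: eq_integral => x _.
  rewrite patchE indicE; case: ifPn => h; rewrite ?mul1r ?mul0r//.
(* Open half-lines unbounded to the right are stable under intersection and generate the Borel sets;
   on them the two measures are computed by [ballmass_out] and [lt_quant]. *)
have m12 A : measurable A -> m1 A = m2 A.
  move=> mA.
  refine (@measure_unique _ R (measurableTypeR R) (@RGenOInfty.G R) (fun n => `]-n%:R, +oo[%classic) _ _ _ _ m1 m2 _ _ A mA).
  - exact: RGenOInfty.measurableE.
  - move=> _ _ [x ->] [y ->]; exists (Num.max x y).
    by apply/seteqP; split => z /=; rewrite !in_itv/= !andbT gt_max; [move=> [-> ->]|move/andP].
  - by move=> n; exists (- n%:R).
  - apply/seteqP; split => // x _; exists (Num.bound `|x|) => //=.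
    rewrite in_itv/= andbT ltrNl (le_lt_trans (ler_norm _))// normrN.
    exact: archi_boundP.
  - move=> _ [c ->]; rewrite m1E; last exact: measurable_itv.
    rewrite (_ : [set x | _] = [set x : R | c < `|x|]); last first.
      by apply/seteqP; split => x /=; rewrite in_itv/= andbT.
    rewrite ballmass_out /= /pushforward /mscale /= /mrestr.
    rewrite (_ : _ `&` _ = `](ballmass c / mass), 1[%classic); last first.
      apply/seteqP; split => w; rewrite /I/= !in_itv/= andbT.
        move=> [h /andP[w0 w1]]; rewrite w1 andbT ltr_pdivrMr//.
        by rewrite -lt_quant// w0.
      move=> /andP[h w1]; have w0 : 0 < w.
        by rewrite (le_lt_trans _ h)// divr_ge0 ?ballmass_ge0// ltW.
      by rewrite w0 w1 lt_quant ?w0// -ltr_pdivrMr.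
    rewrite lebesgue_measure_itv/= lte_fin.
    case: ltP => h; first by rewrite -EFinD -EFinM mulrBr mulr1 mulrCA divff ?mulr1// gt_eqF.
    rewrite mule0; congr EFin; apply/eqP; rewrite subr_eq0 eq_le ballmass_le andbT.
    by move: h; rewrite ler_pdivlMr// mul1r.
  - move=> n; rewrite m1E; last exact: measurable_itv.
    apply: le_lt_trans (integral_bounded_support mp pM pb).
    apply: ge0_subset_integral => //; last by move=> x _; rewrite lee_fin.
    have -> : [set x : R | `]-n%:R, +oo[%classic `|x|] = setT `&` (Num.norm : R -> R) @^-1` `]-n%:R, +oo[%classic by rewrite setTI.
    by apply: measurable_realfun.normr_measurable => //; exact: measurable_itv.
transitivity (\int[m1]_x (k x)%:E)%E.
  rewrite ge0_integral_pushforward//; last 2 first.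
  - exact/measurable_EFinP.
  - by move=> y _; rewrite lee_fin.
  rewrite preimage_setT ge0_integral_mrestr//; last 2 first.
  - apply/measurable_EFinP; apply: measurableT_comp => //.
  - by move=> z; rewrite lee_fin.
  rewrite -(@integral_hypograph _ p)//.
  by apply: eq_integral => z _; rewrite /f1 /= ke.
rewrite (@eq_measure_integral _ _ _ _ m2); last by move=> A mA _; exact: m12.
rewrite ge0_integral_pushforward//; last 2 first.
- exact/measurable_EFinP.
- by move=> y _; rewrite lee_fin.
rewrite preimage_setT ge0_integral_mscale//; last 2 first.
- apply/measurable_EFinP; apply: measurableT_comp => //.
- by move=> z _; rewrite lee_fin.
rewrite ge0_integral_mrestr//.
- apply/measurable_EFinP; apply: measurableT_comp => //.
- by move=> z; rewrite lee_fin.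
Qed.

End quantile.

(** * Stochastic monotonicity in the level *)

Section level_comparison.
Context {R : realType}.
Variables (phi V : R -> R) (gphi : gauge phi) (wV : weight V).
Variables (r s : R).
Hypothesis rs : r <= s.
Hypothesis s1 : s <= 1.

Let p x := V (r - phi x).
Let p' x := V (s - phi x).

Let mp : measurable_fun setT p. Proof. exact: (measurable_wtr_fun gphi wV _). Qed.
Let mp' : measurable_fun setT p'. Proof. exact: (measurable_wtr_fun gphi wV _). Qed.
Let pM x : 0 <= p x <= V r. Proof. exact: (wtr_fun_bound gphi wV). Qed.
Let pM' x : 0 <= p' x <= V s. Proof. exact: (wtr_fun_bound gphi wV). Qed.

Let b : R := xget 0 [set b | forall x, phi x <= s -> `|x| <= b].
Let hb x : phi x <= s -> `|x| <= b.
Proof. by rewrite /b; case: xgetP => [y _ h|] ; [exact: h|have [y hy] := gauge_bounded gphi s => /(_ y hy)]. Qed.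

Let pb x : p x != 0 -> `|x| <= b.
Proof. by move=> /(wtr_fun_support wV)/le_trans => /(_ _ rs)/hb. Qed.
Let pb' x : p' x != 0 -> `|x| <= b.
Proof. by move=> /(wtr_fun_support wV)/hb. Qed.

Let F := ballmass p.
Let F' := ballmass p'.
Let Z := mass p.
Let Z' := mass p'.

Let le_set (D : set R) (f g : R -> R) : measurable D ->
  measurable_fun setT f -> measurable_fun setT g -> (forall x, 0 <= f x) ->
  (forall x, D x -> f x <= g x) ->
  (\int[lebm R]_(x in D) (f x)%:E <= \int[lebm R]_(x in D) (g x)%:E)%E.
Proof.
move=> mD mf mg f0 fg; apply: ge0_le_integral => //.
- by move=> x _; rewrite lee_fin.
- exact/measurable_funTS/measurable_EFinP.
- exact/measurable_funTS/measurable_EFinP.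
Qed.

(* By log-concavity of V the ratio p' / p is nondecreasing in |x|. *)
Lemma ballmass_ratio c : F' c * Z <= F c * Z'.
Proof.
have [c0|c0] := ltP c 0; first by rewrite /F /F' !ballmass_lt0// !mul0r.
have mO : measurable [set x : R | c < `|x|].
  have -> : [set x : R | c < `|x|] = ~` [set x : R | `|x| <= c].
    by apply/seteqP; split => x /=; [move=> h /(lt_le_trans h); rewrite ltxx|move/negP; rewrite -ltNge].
  by apply: measurableC; exact: measurable_absball.
have F0 := ballmass_ge0 mp pM pb c; have F0' := ballmass_ge0 mp' pM' pb' c.
have Fle := ballmass_le mp pM pb c; have Fle' := ballmass_le mp' pM' pb' c.
have nc : `|c| = c by rewrite ger0_norm.
(* If [p c = 0], then [p] vanishes beyond radius [c] and the ball carries the whole mass. *)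
have [pc0|pc0] := eqVneq (p c) 0.
  suff -> : Z = F c by rewrite mulrC; apply: ler_wpM2l.
  apply/esym/eqP; rewrite -subr_eq0 -oppr_eq0 opprB -eqe; apply/eqP.
  rewrite -(ballmass_out mp pM pb) integral0_eq// => x /= cx; congr EFin.
  apply/eqP; rewrite eq_le (andP (pM x)).1 andbT -pc0 /p (weight_mono wV)// lerB//.
  by apply: (gauge_mono gphi); rewrite nc ltW.
have pcp : 0 < p c by rewrite lt_def pc0 (andP (pM c)).1.
(* By [weight_exchange], the ratio at radius [c] bounds [p' / p] from above inside the ball and from
   below outside it. *)
pose kap := p' c / p c.
have kap0 : 0 <= kap by rewrite divr_ge0// ?(ltW pcp)// (andP (pM' c)).1.
have mk : measurable_fun setT (fun x => kap * p x) by exact: measurable_funM.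
have h1 : F' c <= kap * F c.
  rewrite -lee_fin EFinM (ballmassE mp pM pb) (ballmassE mp' pM' pb').
  rewrite -ge0_integralZl_EFin//; last 3 first.
  - exact: measurable_absball.
  - by move=> x _; rewrite lee_fin (andP (pM x)).1.
  - exact/measurable_funTS/measurable_EFinP.
  under [leRHS]eq_integral do rewrite -EFinM.
  apply: le_set => //; first exact: measurable_absball.
    by move=> x; rewrite (andP (pM' x)).1.
  move=> x /= xc; rewrite /kap mulrAC ler_pdivlMr//.
  have hx : phi x <= phi c by apply: (gauge_mono gphi); rewrite nc.
  have := @weight_exchange _ V wV (r - phi x) (s - phi x) (phi c - phi x).
  rewrite /p /p'.
  have -> : r - phi x - (phi c - phi x) = r - phi c by ring.
  have -> : s - phi x - (phi c - phi x) = s - phi c by ring.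
  move=> h; rewrite mulrC [leRHS]mulrC; apply: h; first by rewrite lerD2r.
  - by rewrite lerBlDr (le_trans s1)// lerDl gauge_ge0.
  - by rewrite subr_ge0.
have h2 : kap * (Z - F c) <= Z' - F' c.
  rewrite -lee_fin EFinM -(ballmass_out mp pM pb) -(ballmass_out mp' pM' pb').
  rewrite -ge0_integralZl_EFin//; last 2 first.
  - by move=> x _; rewrite lee_fin (andP (pM x)).1.
  - exact/measurable_funTS/measurable_EFinP.
  under [leLHS]eq_integral do rewrite -EFinM.
  apply: le_set => //.
    by move=> x; rewrite mulr_ge0// (andP (pM x)).1.
  move=> x /= xc; rewrite /kap mulrAC ler_pdivrMr//.
  have hx : phi c <= phi x by apply: (gauge_mono gphi); rewrite nc ltW.
  have := @weight_exchange _ V wV (r - phi c) (s - phi c) (phi x - phi c).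
  rewrite /p /p'.
  have -> : r - phi c - (phi x - phi c) = r - phi x by ring.
  have -> : s - phi c - (phi x - phi c) = s - phi x by ring.
  move=> h; rewrite mulrC [leRHS]mulrC; apply: h; first by rewrite lerD2r.
  - by rewrite lerBlDr (le_trans s1)// lerDl gauge_ge0.
  - by rewrite subr_ge0.
have h3 : F' c * (Z - F c) <= F c * (Z' - F' c).
  apply: (@le_trans _ _ (kap * F c * (Z - F c))).
    by rewrite ler_wpM2r// subr_ge0.
  by rewrite mulrC mulrCA mulrA mulrC; apply: ler_wpM2l => //; rewrite mulrC.
by move: h3; lra.
Qed.

(** In the nontrivial case [B] is contained in [C] and [D] in [A], and the claim, the measure of [A]
    minus [D] being at most that of [C] minus [B], is a rearrangement of [brunn_minkowski4]. *)
Lemma layer_shift (v a : R) : 0 <= v -> 0 < a ->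
  (lebesgue_measure [set x | (v + (s - r) < phi x)%R /\ (a <= p' x)%R] <=
   lebesgue_measure [set x | (v < phi x)%R /\ (a <= p x)%R])%E.
Proof.
move=> v0 a0; have d0 : 0 <= s - r by rewrite subr_ge0.
(* If [a] exceeds [V (r - v)], the left set is empty: [phi x > v + (s - r)] forces
   [s - phi x < r - v]. *)
have [av|av] := leP a (V (r - v)); last first.
  rewrite (_ : [set x | _ /\ _] = set0) ?measure0//.
  apply/seteqP; split => x //= -[h1 h2].
  have : p' x <= V (r - v) by apply: (weight_mono wV); lra.
  by move=> /(le_trans h2); rewrite leNgt av.
have vr : v <= r by rewrite -subr_ge0; apply: (weight_gt0_ge0 wV); exact: lt_le_trans av.
pose A := [set x | a <= p' x]; pose B := [set x | phi x <= v].
pose C := [set x | a <= p x]; pose D := [set x | phi x <= v + (s - r)].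
have bA : balanced A.
  apply: (@gauge_sublevel_balanced _ phi gphi [set y | a <= V (s - y)]) => x y xy /= h.
  by rewrite (le_trans h)// (weight_mono wV)// lerB.
have bC : balanced C.
  apply: (@gauge_sublevel_balanced _ phi gphi [set y | a <= V (r - y)]) => x y xy /= h.
  by rewrite (le_trans h)// (weight_mono wV)// lerB.
have bB : balanced B.
  by apply: (@gauge_sublevel_balanced _ phi gphi [set y | y <= v]) => x y /= /le_trans; exact.
have bD : balanced D.
  by apply: (@gauge_sublevel_balanced _ phi gphi [set y | y <= v + (s - r)]) => x y /= /le_trans; exact.
have BC : B `<=` C.
  by rewrite /B /C => x /= xv; rewrite (le_trans av)// (weight_mono wV)// lerB.
have DA : D `<=` A.
  by rewrite /D /A => x /= xv; rewrite (le_trans av)// (weight_mono wV)//; lra.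
have A0 : A 0 by apply: DA; rewrite /D /= (gauge0 gphi) addr_ge0.
have C0 : C 0 by apply: BC; rewrite /B /= (gauge0 gphi).
have pos x : A x -> phi x <= s.
  by move=> h; apply: (wtr_fun_support wV); rewrite gt_eqF// (lt_le_trans a0).
have Ab x : A x -> `|x| <= b by move=> /pos/hb.
have Cb x : C x -> `|x| <= b by move=> h; apply: pb; rewrite gt_eqF// (lt_le_trans a0).
have fin X : balanced X -> (forall x, X x -> `|x| <= b) -> lebesgue_measure X \is a fin_num.
  move=> bX Xb; rewrite ge0_fin_numE//.
  apply: (@le_lt_trans _ _ (lebesgue_measure `[-b, b]%classic)).
    apply: le_measure; rewrite ?inE//; first exact: measurable_balanced.
    by move=> x /Xb; rewrite /= in_itv/= -ler_norml.
  by apply: compact_finite_measure; exact: segment_compact.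
have bm : (lebesgue_measure A + lebesgue_measure B <= lebesgue_measure C + lebesgue_measure D)%E.
  apply: (@brunn_minkowski4 _ _ _ _ _ b) => //.
  - by rewrite /B /= (gauge0 gphi).
  - by move=> x /BC/Cb.
  - by rewrite /D /= (gauge0 gphi) addr_ge0.
  - by move=> x /DA/Ab.
  move=> x y Ax By.
  have [xd|xd] := leP (phi x) (v + (s - r)).
    by exists 0; rewrite !subr0 !mul0r !mul1r add0r addr0; split => //; exact: BC.
  have e0 : 0 < phi x - v by lra.
  (* With this [t], the values [phi x] and [v] combine to [phi x - (s - r)] in one order, which is
     the condition for [C], and to [v + (s - r)] in the other, which is the condition for [D]. *)
  pose t := (phi x - (s - r) - v) / (phi x - v).
  have t01 : 0 <= t <= 1.
    rewrite divr_ge0 ?(ltW e0)//=; last by lra.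
    by rewrite ler_pdivrMr// mul1r; lra.
  have t01' : 0 <= 1 - t <= 1 by lra.
  have x1 : phi x <= 1 by rewrite (le_trans (pos _ Ax)).
  have y1 : phi y <= 1 by rewrite (le_trans By)// (le_trans vr)// (le_trans rs).
  have te : t * (phi x - v) = phi x - (s - r) - v by rewrite /t divfK// gt_eqF.
  have /andP[t0 t1] := t01.
  have hy : (1 - t) * phi y <= (1 - t) * v by rewrite ler_wpM2l// subr_ge0.
  have hy' : t * phi y <= t * v by rewrite ler_wpM2l.
  exists t; split.
    rewrite /C /= (le_trans Ax)// (weight_mono wV)//.
    have := gauge_convex gphi t01 x1 y1.
    have : t * phi x + (1 - t) * v = v + t * (phi x - v) by ring.
    rewrite te; lra.
  rewrite /D /=.
  have := gauge_convex gphi t01' x1 y1.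
  have : (1 - t) * phi x + t * v = phi x - t * (phi x - v) by ring.
  rewrite te (_ : 1 - (1 - t) = t); last by ring.
  lra.
rewrite (_ : [set x | _ /\ _] = A `\` D); last first.
  by apply/seteqP; split => x /=; rewrite /A /D /= => -[h1 h2]; split => //;
     [move/(lt_le_trans h1); rewrite ltxx|rewrite ltNge; apply/negP].
rewrite (_ : [set x | v < _ /\ _] = C `\` B); last first.
  by apply/seteqP; split => x /=; rewrite /C /B /= => -[h1 h2]; split => //;
     [move/(lt_le_trans h1); rewrite ltxx|rewrite ltNge; apply/negP].
have mA := measurable_balanced bA; have mB := measurable_balanced bB.
have mC := measurable_balanced bC; have mD := measurable_balanced bD.
have fA := fin _ bA Ab; have fC := fin _ bC Cb.
have fB : lebesgue_measure B \is a fin_num by apply: fin => // x /BC/Cb.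
have fD : lebesgue_measure D \is a fin_num by apply: fin => // x /DA/Ab.
rewrite !measureD//; [|by rewrite ltey_eq fC|by rewrite ltey_eq fA].
rewrite !setIidr//.
rewrite leeBlDr// addeAC leeBrDr//.
Qed.

(** The residual level is stochastically larger at level [s]. Monotonicity of [V] increases the mass
    of the sublevel set, and [layer_shift], integrated over the heights, decreases the mass of its
    complement; for two masses split in this way, [e * c' <= e' * c] is the comparison of the
    fractions. *)
Lemma level_ratio (v : R) : 0 <= v ->
  (\int[lebm R]_(x in [set x | (phi x <= v)%R]) (p x)%:E * Z'%:E <=
   \int[lebm R]_(x in [set x | (phi x <= v + (s - r))%R]) (p' x)%:E * Z%:E)%E.
Proof.
move=> v0.
have mS (c : R) : measurable [set x | phi x <= c].
  by apply: measurable_balanced; apply: (@gauge_sublevel_balanced _ phi gphi [set y | y <= c]) => x y /= /le_trans; exact.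
have mSC (c : R) : measurable [set x | c < phi x].
  have -> : [set x : R | c < phi x] = ~` [set x : R | phi x <= c].
    by apply/seteqP; split => x /=; [move=> h /(lt_le_trans h); rewrite ltxx|move/negP; rewrite -ltNge].
  exact: measurableC.
have split_ (f : R -> R) (c : R) : measurable_fun setT f -> (forall x, 0 <= f x) ->
   (\int[lebm R]_x (f x)%:E = \int[lebm R]_(x in [set x | (phi x <= c)%R]) (f x)%:E +
     \int[lebm R]_(x in [set x | (c < phi x)%R]) (f x)%:E)%E.
  move=> mf f0; rewrite -ge0_integral_setU; [|exact: mS|exact: mSC| | |].
  - congr (integral _ _ _); apply/seteqP; split => x //= _.
    by case: (leP (phi x) c); [left|right].
  - exact/measurable_funTS/measurable_EFinP.
  - by move=> x _; rewrite lee_fin.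
  - by apply/disj_setPS => x /= [h' h]; move: (lt_le_trans h h'); rewrite ltxx.
have fin (f : R -> R) (D : set R) : measurable D -> measurable_fun setT f -> (forall x, 0 <= f x) ->
    (\int[lebm R]_x (f x)%:E < +oo)%E -> (\int[lebm R]_(x in D) (f x)%:E)%E \is a fin_num.
  move=> mD mf f0 foo; rewrite ge0_fin_numE; last by apply: integral_ge0 => x _; rewrite lee_fin.
  apply: le_lt_trans foo; apply: ge0_subset_integral => //; first exact/measurable_EFinP.
  by move=> x _; rewrite lee_fin.
have p0 x : 0 <= p x by case/andP: (pM x).
have p0' x : 0 <= p' x by case/andP: (pM' x).
have poo := integral_bounded_support mp pM pb.
have poo' := integral_bounded_support mp' pM' pb'.
have EE : (\int[lebm R]_(x in [set x | (phi x <= v)%R]) (p x)%:E <=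
   \int[lebm R]_(x in [set x | (phi x <= v + (s - r))%R]) (p' x)%:E)%E.
  apply: (@le_trans _ _ (\int[lebm R]_(x in [set x | (phi x <= v)%R]) (p' x)%:E)%E).
    by apply: le_set => // x _; rewrite /p /p' (weight_mono wV)// lerD2r.
  apply: ge0_subset_integral; [exact: mS|exact: mS| | |].
  - exact/measurable_funTS/measurable_EFinP.
  - by move=> x _; rewrite lee_fin.
  - by move=> x /= /le_trans; apply; rewrite lerDl subr_ge0.
have CC : (\int[lebm R]_(x in [set x | (v + (s - r) < phi x)%R]) (p' x)%:E <=
   \int[lebm R]_(x in [set x | (v < phi x)%R]) (p x)%:E)%E.
  have conv (f : R -> R) (c M : R) : measurable_fun setT f -> (forall x, 0 <= f x <= M) ->
      (\int[lebm R]_(x in [set x | (c < phi x)%R]) (f x)%:E =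
       \int[lebm R]_(u in `]0%R, M]) lebesgue_measure [set x | (c < phi x)%R /\ (u <= f x)%R])%E.
    move=> mf fM; pose h := f \_ [set x | c < phi x].
    have mh : measurable_fun setT h by apply/(measurable_restrictT _ _).1 => //; exact: measurable_funTS.
    have h0 x : 0 <= h x by rewrite /h patchE; case: ifPn => // _; case/andP: (fM x).
    have M0 : 0 <= M by case/andP: (fM 0) => /le_trans; exact.
    transitivity (\int[lebm R]_x (Num.min (h x) M)%:E)%E.
      rewrite integral_mkcond; apply: eq_integral => x _; rewrite /h !patchE.
      by case: ifPn => _; rewrite min_l//; case/andP: (fM x).
    rewrite -layer_cake//; apply: eq_integral => u; rewrite inE/= in_itv/= => /andP[u0 _].
    congr (lebesgue_measure _); apply/seteqP; split => x /=; rewrite /h patchE.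
      by case: ifPn => [|_]; [rewrite inE|rewrite leNgt u0].
    by move=> [h1 h2]; rewrite mem_set.
  have pM2 x : 0 <= p x <= V s.
    by have /andP[-> h] := pM x; rewrite (le_trans h)// (weight_mono wV).
  rewrite (conv _ _ _ mp' pM') (conv _ _ _ mp pM2).
  have ml (f : R -> R) (c : R) : measurable_fun setT f -> (forall x, 0 <= f x) ->
     measurable_fun (`]0, V s]%classic : set R) (fun u : R => lebesgue_measure [set x | (c < phi x)%R /\ (u <= f x)%R]).
    move=> mf f0; pose h := f \_ [set x | c < phi x].
    have mh : measurable_fun setT h by apply/(measurable_restrictT _ _).1 => //; exact: measurable_funTS.
    apply: (@eq_measurable_fun _ _ _ _ _ (fun u : R => lebesgue_measure [set x | (u <= h x)%R])).
      move=> u; rewrite inE/= in_itv/= => /andP[u0 _].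
      congr (lebesgue_measure _); apply/seteqP; split => x /=; rewrite /h patchE.
        by case: ifPn => [|_]; [rewrite inE|rewrite leNgt u0].
      by move=> [h1 h2]; rewrite mem_set.
    by apply: measurable_funTS; exact: measurable_layer.
  apply: ge0_le_integral => //; [exact: ml|exact: ml|].
  by move=> u /=; rewrite in_itv/= => /andP[u0 _]; exact: layer_shift.
rewrite /Z /Z' (massE mp pM pb) (massE mp' pM' pb').
rewrite (split_ p v)// (split_ p' (v + (s - r)))//.
move: EE CC.
rewrite -(fineK (fin p _ (mS v) mp p0 poo)) -(fineK (fin p _ (mSC v) mp p0 poo)).
rewrite -(fineK (fin p' _ (mS (v + (s - r))) mp' p0' poo')) -(fineK (fin p' _ (mSC (v + (s - r))) mp' p0' poo')).
set e := fine _; set e' := fine _; set c' := fine _; set c := fine _.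
rewrite -!EFinD -!EFinM !lee_fin => ee cc.
have e0 : 0 <= e by apply: fine_ge0; apply: integral_ge0 => x _; rewrite lee_fin.
have c0 : 0 <= c' by apply: fine_ge0; apply: integral_ge0 => x _; rewrite lee_fin.
have : e * c' <= e' * c by apply: ler_pM.
lra.
Qed.

Hypothesis Z0 : 0 < Z.

Let Z0' : 0 < Z'.
Proof.
apply: (lt_le_trans Z0); rewrite -lee_fin (massE mp pM pb) (massE mp' pM' pb').
apply: le_set => //; first by move=> x; case/andP: (pM x).
by move=> x _; rewrite (weight_mono wV)// lerD2r.
Qed.

(** By [ballmass_ratio] every ball has a smaller share of the mass under [p'] than under [p], so the
    same share is reached at a larger radius. *)
Lemma quant_le_quant (w : R) : 0 < w < 1 -> quant p w <= quant p' w.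
Proof.
move=> /andP[w0 w1].
have q'0 := quant_ge0 mp' pM' pb' Z0' w.
rewrite (quant_le_ballmass mp pM pb Z0 _ q'0).
have := ballmass_quant mp' pM' pb' Z0' w; rewrite !min_l ?(ltW w1)// => h.
have := ballmass_ratio (quant p' w); rewrite -/F -/F' => h1.
rewrite -/Z -(ler_pM2r Z0') mulrAC.
by apply: le_trans h1; rewrite -/Z' ler_pM2r.
Qed.

(* If phi jumped over the level in question at the quantile, the jump would be at
   the end of the domain of phi, where the whole mass is already attained. *)
Lemma phi_quant_le (w : R) : 0 < w < 1 -> phi (quant p w) <= r ->
  phi (quant p' w) <= phi (quant p w) + (s - r).
Proof.
move=> w01 qr; have /andP[w0 w1] := w01.
set v := phi (quant p w); set q' := quant p' w.
have vr : v <= r by [].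
have d0 : 0 <= s - r by rewrite subr_ge0.
have v0 : 0 <= v by exact: gauge_ge0.
have q0 := quant_ge0 mp pM pb Z0 w.
have q'0 : 0 <= q' := quant_ge0 mp' pM' pb' Z0' w.
have mS (c : R) : measurable [set x | phi x <= c].
  by apply: measurable_balanced; apply: (@gauge_sublevel_balanced _ phi gphi [set y | y <= c]) => x y /= /le_trans; exact.
have wE : ((w * Z)%:E <= \int[lebm R]_(x in [set x | (phi x <= v)%R]) (p x)%:E)%E.
  have := ballmass_quant mp pM pb Z0 w; rewrite min_l ?(ltW w1)// -lee_fin.
  move=> /le_trans; apply; rewrite (ballmassE mp pM pb).
  apply: ge0_subset_integral; [exact: measurable_absball|exact: mS| | |].
  - exact/measurable_funTS/measurable_EFinP.
  - by move=> x _; rewrite lee_fin; case/andP: (pM x).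
  - move=> x /= xq; apply: (gauge_mono gphi).
    by rewrite [leRHS]ger0_norm.
have wE' : ((w * Z')%:E <= \int[lebm R]_(x in [set x | (phi x <= v + (s - r))%R]) (p' x)%:E)%E.
  rewrite -(@lee_pmul2r _ Z%:E) ?lte_fin//.
  apply: le_trans (level_ratio v0).
  by rewrite -EFinM mulrAC EFinM lee_wpmul2r// lee_fin ltW.
rewrite leNgt; apply/negP => vq.
have le_q c : 0 <= c -> (forall x, phi x <= v + (s - r) -> `|x| <= c) -> q' <= c.
  move=> c0 hc; rewrite /q' (quant_le_ballmass mp' pM' pb' Z0')// min_l ?(ltW w1)//.
  rewrite -lee_fin (le_trans wE')// (ballmassE mp' pM' pb').
  apply: ge0_subset_integral; [exact: mS|exact: measurable_absball| | |].
  - exact/measurable_funTS/measurable_EFinP.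
  - by move=> x _; rewrite lee_fin; case/andP: (pM' x).
  - by move=> x /= /hc.
have below c : 0 <= c -> c < q' -> phi c <= v + (s - r).
  move=> c0 cq; rewrite leNgt; apply/negP => hc.
  have : q' <= c.
    apply: le_q => // x hx; rewrite leNgt; apply/negP => cx.
    have : phi c <= phi x by apply: (gauge_mono gphi); rewrite ger0_norm// ltW.
    by move=> /(lt_le_trans hc)/lt_le_trans => /(_ _ hx); rewrite ltxx.
  by rewrite leNgt cq.
have q'p : 0 < q'.
  rewrite lt_def q'0 andbT; apply/eqP => q'E; move: vq; rewrite q'E (gauge0 gphi).
  by rewrite ltNge addr_ge0.
have beyond z : q' < `|z| -> 1 < phi z.
  move=> qz; rewrite ltNge -(gauge_norm gphi z); apply/negP => z1.
  move: qz z1; move: `|z| => y qy y1 {z}.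
  pose e := phi q' - (v + (s - r)).
  have e0 : 0 < e by rewrite subr_gt0.
  have yq0 : 0 < y - q' by rewrite subr_gt0.
  (* In [q' = t c + (1 - t) y] this choice makes the coefficient of [y] at most [e / 2]. Convexity
     then bounds [phi q'] by [v + (s - r) + e / 2], although [e] is the excess of [phi q'] over
     [v + (s - r)]. *)
  pose c := Num.max 0 (q' - e * (y - q') / 2).
  have c0 : 0 <= c by rewrite le_max lexx.
  have cq : c < q'.
    by rewrite gt_max q'p ltrBlDr ltrDl divr_gt0// mulr_gt0.
  have qc : q' - c <= e * (y - q') / 2.
    by rewrite lerBlDr -lerBlDl le_max lexx orbT.
  have yc0 : 0 < y - c by lra.
  pose t := (y - q') / (y - c).
  have t01 : 0 <= t <= 1.
    by rewrite divr_ge0 ?(ltW yq0) ?(ltW yc0)//= ler_pdivrMr// mul1r; lra.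
  have bc := below _ c0 cq.
  have vs : v + (s - r) <= 1 by rewrite (le_trans _ s1)// addrCA gerDl subr_le0.
  have := gauge_convex gphi t01 (le_trans bc vs) y1.
  have -> : t * c + (1 - t) * y = q' by rewrite /t; field; lra.
  have /andP[t0 t1] := t01.
  have h1 : t * phi c <= t * (v + (s - r)) by rewrite ler_wpM2l.
  have h2 : (1 - t) * phi y <= (1 - t) * 1 by rewrite ler_wpM2l// subr_ge0.
  have h3 : (1 - t) * 1 <= e / 2.
    rewrite mulr1 (_ : 1 - t = (q' - c) / (y - c)); last by rewrite /t; field; lra.
    rewrite ler_pdivrMr// (le_trans qc)// mulrAC ler_pM2l ?divr_gt0//; lra.
  have h4 : 0 <= (1 - t) * (v + (s - r)) by apply: mulr_ge0; [rewrite subr_ge0|rewrite addr_ge0].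
  have h5 : (1 - t) * (v + (s - r)) + t * (v + (s - r)) = v + (s - r) by ring.
  by rewrite /e in e0 h3; lra.
have full : F' q' = Z'.
  apply/eqP; rewrite eq_le (ballmass_le mp' pM' pb')/= -subr_le0 -lee_fin.
  rewrite -(ballmass_out mp' pM' pb') integral0_eq// => x /= /beyond x1; congr EFin.
  apply/eqP; apply: contraTT x1 => /(wtr_fun_support wV) h.
  by rewrite -leNgt (le_trans h).
(* The full mass at [q'] contradicts [w < 1]: every smaller radius carries less than [w * Z'], and
   [ballmass] is continuous. *)
suff : F' q' <= w * Z' by rewrite full -ler_pdivrMr// divff ?gt_eqF// leNgt w1.
apply/ler_addgt0Pr => e e0.
have Vs0 : 0 <= V s by exact: weight_ge0.
have k0 : 0 < 2 * V s + 1 by rewrite ltr_wpDl// mulr_ge0.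
pose c := Num.max 0 (q' - e / (2 * V s + 1)).
have c0 : 0 <= c by rewrite le_max lexx.
have cq : c < q' by rewrite gt_max q'p ltrBlDr ltrDl divr_gt0.
have qc : q' - c <= e / (2 * V s + 1).
  by rewrite lerBlDr -lerBlDl le_max lexx orbT.
apply: (le_trans (ballmass_lip mp' pM' pb' (ltW cq))).
apply: lerD.
  rewrite leNgt; apply/negP => h; move: cq; rewrite ltNge; apply/negP; rewrite negbK.
  by rewrite (quant_le_ballmass mp' pM' pb' Z0')// min_l ?(ltW w1)// ltW.
apply: le_trans (ler_wpM2l _ qc) _; first by rewrite mulr_ge0.
by rewrite mulrA ler_pdivrMr// mulrC ler_wpM2l ?(ltW e0)// lerDl.
Qed.

End level_comparison.

(* The quantile coupling moves both |x| and the residual r - phi x upwards. *)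
Lemma stochastic_mono1 {R : realType} (phi V : R -> R) (r s : R) (H : R -> R -> R) (B : R) :
  gauge phi -> weight V -> r <= s -> s <= 1 ->
  (forall c, measurable_fun setT (fun x => H x (c - phi x))) ->
  (forall x y, 0 <= H x y <= B) ->
  (forall x y, y < 0 -> H x y = 0) ->
  (forall x x' y y', `|x| <= `|x'| -> y <= y' -> y' <= 1 -> H x y <= H x' y') ->
  ((\int[lebm R]_x (H x (r - phi x) * V (r - phi x))%:E) * (wtr phi V s)%:E <=
   (\int[lebm R]_x (H x (s - phi x) * V (s - phi x))%:E) * (wtr phi V r)%:E)%E.
Proof.
move=> gphi wV rs s1 mH HB Hlt0 Hmono.
(* If the mass at level [r] is 0, the bound of [H] by [B] makes the left integral vanish. *)
have [Zr0|Zr] := eqVneq (wtr phi V r) 0.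
  rewrite Zr0 mule0 (_ : \int[lebm R]_x (H x (r - phi x) * V (r - phi x))%:E = 0)%E ?mul0e//.
  apply/eqP; rewrite eq_le; apply/andP; split; last first.
    apply: integral_ge0 => x _; rewrite lee_fin mulr_ge0//; last exact: weight_ge0.
    by case/andP: (HB x (r - phi x)).
  have -> : (0 = B%:E * \int[lebm R]_x (V (r - phi x))%:E)%E by rewrite -wtrE// Zr0 mule0.
  rewrite -ge0_integralZl_EFin//; last 3 first.
  - by move=> x _; rewrite lee_fin weight_ge0.
  - by apply/measurable_EFinP; exact: (measurable_wtr_fun gphi wV _).
  - by case/andP: (HB 0 0) => /le_trans; exact.
  under [leRHS]eq_integral do rewrite -EFinM.
  apply: ge0_le_integral => //.
  - move=> x _; rewrite lee_fin mulr_ge0//; last exact: weight_ge0.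
    by case/andP: (HB x (r - phi x)).
  - by apply/measurable_EFinP; apply: measurable_funM; [exact: mH|exact: (measurable_wtr_fun gphi wV _)].
  - by apply/measurable_EFinP; apply: measurable_funM; [exact: measurable_cst|exact: (measurable_wtr_fun gphi wV _)].
  - move=> x _; rewrite lee_fin ler_wpM2r//; first exact: weight_ge0.
    by case/andP: (HB x (r - phi x)).
have Zr0 : 0 < wtr phi V r.
  by rewrite lt_def Zr (weight_ge0 (weight_wtr gphi wV)).
have Zs0 : 0 < wtr phi V s by rewrite (lt_le_trans Zr0)// wtr_mono.
have [b hb] := gauge_bounded gphi s.
have q c : c <= s -> 0 < wtr phi V c ->
   (\int[lebm R]_x (H x (c - phi x) * V (c - phi x))%:E =
    (wtr phi V c)%:E * \int[lebm R]_(w in `]0%R, 1%R[) (H (quant (fun x => V (c - phi x)) w) (c - phi (quant (fun x => V (c - phi x)) w)))%:E)%E.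
  move=> cs Zc0.
  rewrite (@integral_quantile _ _ (V c) b _ _ _ _ (fun x => H x (c - phi x)))//.
  - exact: (measurable_wtr_fun gphi wV _).
  - exact: (wtr_fun_bound gphi wV).
  - by move=> x /(wtr_fun_support wV)/le_trans => /(_ _ cs)/hb.
  - by move=> x; case/andP: (HB x (c - phi x)).
  - move=> x; rewrite gauge_norm//; apply/eqP; rewrite eq_le.
    by rewrite !Hmono ?normr_id// lerBlDr (le_trans cs)// (le_trans s1)// lerDl gauge_ge0.
rewrite (q r rs Zr0) (q s (lexx s) Zs0).
have comb (u v : R) (x y : \bar R) : 0 < u -> 0 < v -> (x <= y)%E ->
    (u%:E * x * v%:E <= v%:E * y * u%:E)%E.
  move=> u0 v0 xy; rewrite muleAC [leRHS]muleAC [X in (_ <= X * _)%E]muleC.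
  by apply: lee_wpmul2l => //; rewrite -EFinM lee_fin mulr_ge0// ltW.
refine (comb _ _ _ _ Zr0 Zs0 _).
have mk c : c <= s -> 0 < wtr phi V c -> measurable_fun (`]0, 1[%classic : set R) (fun w => (H (quant (fun x => V (c - phi x)) w) (c - phi (quant (fun x => V (c - phi x)) w)))%:E).
  move=> cs Zc0; apply/measurable_funTS/measurable_EFinP.
  apply: (@measurableT_comp _ _ _ _ _ _ (fun x => H x (c - phi x))) => //.
  apply: (@measurable_quant _ _ (V c) b) => //.
  - exact: (measurable_wtr_fun gphi wV _).
  - exact: (wtr_fun_bound gphi wV).
  - by move=> x /(wtr_fun_support wV)/le_trans => /(_ _ cs)/hb.
apply: ge0_le_integral => //; [|exact: mk|exact: mk|].
  by move=> w _; rewrite lee_fin; case/andP: (HB (quant (fun x => V (r - phi x)) w) (r - phi (quant (fun x => V (r - phi x)) w))).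
move=> w /=; rewrite in_itv/= => w01; rewrite lee_fin.
set x := quant _ w; set x' := quant _ w.
(* [phi_quant_le] concerns quantiles inside the sublevel set of [r]; outside it the left value is 0
   by [Hlt0]. *)
have [xr|xr] := leP (phi x) r; last first.
  rewrite Hlt0; last by rewrite subr_lt0.
  by case/andP: (HB x' (s - phi x')).
have h1 : x <= x' by exact: (quant_le_quant gphi wV rs s1 Zr0 w01).
have h2 : phi x' <= phi x + (s - r) by exact: (phi_quant_le gphi wV rs s1 Zr0 w01 xr).
apply: Hmono; [|by lra|by rewrite lerBlDr (le_trans s1)// lerDl gauge_ge0].
have qp c : c <= s -> 0 < wtr phi V c -> 0 <= quant (fun x => V (c - phi x)) w.
  move=> cs Zc0; apply: (@quant_ge0 _ _ (V c) b) => //.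
  - exact: (measurable_wtr_fun gphi wV _).
  - exact: (wtr_fun_bound gphi wV).
  - by move=> y /(wtr_fun_support wV)/le_trans => /(_ _ cs)/hb.
by rewrite !ger0_norm//; exact: qp.
Qed.

(** * Integrals against densities built from gauges and a weight *)

Section tuples.
Context {R : realType}.
Local Open Scope ereal_scope.

Definition tcons n (x : R) (u : euclid R n) : euclid R n.+1 := cons_tuple x u.

Lemma measurable_tcons n :
  measurable_fun setT (fun z : measurableTypeR R * euclid R n => tcons z.1 z.2).
Proof. exact: measurable_cons_pair. Qed.

Lemma measurable_tcons2 n x : measurable_fun setT (@tcons n x).
Proof. by apply: measurable_cons. Qed.

Lemma tnth_tcons0 n (x : R) (u : euclid R n) : tnth (tcons x u) ord0 = x.
Proof. by []. Qed.

Lemma tnth_tconsS n (x : R) (u : euclid R n) (i : 'I_n) :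
  tnth (tcons x u) (lift ord0 i) = tnth u i.
Proof. by rewrite /tcons tnthS. Qed.

Lemma integral_lebesgue_tupleS n (F : euclid R n.+1 -> \bar R) :
  measurable_fun setT F -> (forall u, 0 <= F u) ->
  \int[lebesgue_tuple n.+1]_v F v =
  \int[lebm R]_x \int[lebesgue_tuple n]_u F (tcons x u).
Proof.
move=> mF F0 /=.
rewrite -(@fubini_tonelli1 _ _ _ _ _ (lebm R) (lebesgue_tuple n) (fun z => F (tcons z.1 z.2)))//.
  by rewrite ge0_integral_pushforward//; exact: measurable_cons_pair.
exact: measurableT_comp mF (@measurable_tcons n).
Qed.

Lemma integral_lebesgue_tuple0 (F : euclid R 0 -> \bar R) :
  measurable_fun setT F ->
  \int[lebesgue_tuple 0]_v F v = F [tuple].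
Proof. by move=> mF /=; rewrite integral_dirac// diracT mul1e. Qed.

End tuples.

Section weighted_integral.
Context {R : realType}.
Implicit Types (W V : R -> R).

Definition gsum n (phis : 'I_n -> R -> R) (u : euclid R n) : R :=
  \sum_(i < n) phis i (tnth u i).

(** The integral of [G] against the unnormalized density. Level and weight are both parameters since
    a coordinate is removed in two ways: [wintS] fixes it and lowers [r], [wint_behead] integrates
    it out and changes [W]. *)
Definition wint n (phis : 'I_n -> R -> R) W (G : euclid R n -> R) (r : R) : \bar R :=
  (\int[lebesgue_tuple n]_u (G u * W (r - gsum phis u))%:E)%E.

Definition tailf n (phis : 'I_n.+1 -> R -> R) (i : 'I_n) : R -> R := phis (lift ord0 i).

(** The total mass of the density, as [wvolE] shows. The iterated form makes it a real-valued weight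
    by repeated use of [weight_wtr]. *)
Fixpoint wvol n : ('I_n -> R -> R) -> (R -> R) -> R -> R :=
  match n with
  | 0 => fun _ W => W
  | m.+1 => fun phis W => wtr (phis ord0) (wvol (tailf phis) W)
  end.

Lemma gsum_tcons n (phis : 'I_n.+1 -> R -> R) x (u : euclid R n) :
  gsum phis (tcons x u) = phis ord0 x + gsum (tailf phis) u.
Proof.
rewrite /gsum big_ord_recl tnth_tcons0; congr (_ + _).
by apply: eq_bigr => i _; rewrite tnth_tconsS.
Qed.

Lemma measurable_gsum n (phis : 'I_n -> R -> R) (gp : forall i, gauge (phis i)) :
  measurable_fun setT (gsum phis).
Proof.
apply: measurable_sum => i; apply: measurableT_comp.
  exact: (measurable_gauge (gp i)).
exact: measurable_tnth.
Qed.

Lemma weight_wvol n (phis : 'I_n -> R -> R) W : (forall i, gauge (phis i)) ->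
  weight W -> weight (wvol phis W).
Proof.
elim: n phis => //= n ih phis gp wW; apply: weight_wtr => //.
by apply: ih => // i; exact: gp.
Qed.

Lemma measurable_wint_integrand n (phis : 'I_n -> R -> R) W (G : euclid R n -> R) (r : R) :
  (forall i, gauge (phis i)) -> weight W -> measurable_fun setT G ->
  measurable_fun setT (fun u : euclid R n => G u * W (r - gsum phis u)).
Proof.
move=> gp wW mG; apply: measurable_funM => //.
apply: measurableT_comp; first exact: measurable_weight.
apply: measurable_funB => //; exact: measurable_gsum.
Qed.

Lemma wint_ge0 n (phis : 'I_n -> R -> R) W (G : euclid R n -> R) (r : R) : weight W -> (forall u, 0 <= G u) ->
  (0 <= wint phis W G r)%E.
Proof.
by move=> wW G0; apply: integral_ge0 => u _; rewrite lee_fin mulr_ge0// weight_ge0.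
Qed.

Lemma le_wint n (phis : 'I_n -> R -> R) W (G G' : euclid R n -> R) (r : R) :
  (forall i, gauge (phis i)) -> weight W ->
  measurable_fun setT G -> measurable_fun setT G' -> (forall u, 0 <= G u) ->
  (forall u, G u <= G' u) -> (wint phis W G r <= wint phis W G' r)%E.
Proof.
move=> gp wW mG mG' G0 GG'; apply: ge0_le_integral => //.
- by move=> u _; rewrite lee_fin mulr_ge0// weight_ge0.
- by apply/measurable_EFinP; apply: measurable_wint_integrand.
- by apply/measurable_EFinP; apply: measurable_wint_integrand.
- by move=> u _; rewrite lee_fin ler_wpM2r// weight_ge0.
Qed.

Lemma wintZ n (phis : 'I_n -> R -> R) W (G : euclid R n -> R) (r : R) (c : R) :
  (forall i, gauge (phis i)) -> weight W ->
  measurable_fun setT G -> (forall u, 0 <= G u) -> 0 <= c ->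
  wint phis W (fun u => c * G u) r = (c%:E * wint phis W G r)%E.
Proof.
move=> gp wW mG G0 c0; rewrite /wint -ge0_integralZl_EFin//.
- by apply: eq_integral => u _; rewrite -EFinM mulrA.
- by move=> u _; rewrite lee_fin mulr_ge0// weight_ge0.
- by apply/measurable_EFinP; apply: measurable_wint_integrand.
Qed.

Lemma wintD n (phis : 'I_n -> R -> R) W (G G' : euclid R n -> R) (r : R) :
  (forall i, gauge (phis i)) -> weight W ->
  measurable_fun setT G -> (forall u, 0 <= G u) ->
  measurable_fun setT G' -> (forall u, 0 <= G' u) ->
  wint phis W (fun u => G u + G' u) r = (wint phis W G r + wint phis W G' r)%E.
Proof.
move=> gp wW mG G0 mG' G0'; rewrite /wint -ge0_integralD//.
- by apply: eq_integral => u _; rewrite -EFinD mulrDl.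
- by move=> u _; rewrite lee_fin mulr_ge0// weight_ge0.
- by apply/measurable_EFinP; apply: measurable_wint_integrand.
- by move=> u _; rewrite lee_fin mulr_ge0// weight_ge0.
- by apply/measurable_EFinP; apply: measurable_wint_integrand.
Qed.

Lemma wint0 (phis : 'I_0 -> R -> R) W (G : euclid R 0 -> R) (r : R) : weight W -> measurable_fun setT G ->
  wint phis W G r = (G [tuple] * W r)%:E.
Proof.
move=> wW mG; rewrite /wint integral_lebesgue_tuple0 ?/gsum ?big_ord0 ?subr0//.
by apply/measurable_EFinP; apply: (@measurable_wint_integrand 0 phis W G r) => // -[].
Qed.

Lemma wintS n (phis : 'I_n.+1 -> R -> R) W (G : euclid R n.+1 -> R) (r : R) : (forall i, gauge (phis i)) ->
  weight W -> measurable_fun setT G -> (forall u, 0 <= G u) ->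
  wint phis W G r =
  (\int[lebm R]_x wint (tailf phis) W (fun u => G (tcons x u)) (r - phis ord0 x)%R)%E.
Proof.
move=> gp wW mG G0; rewrite /wint integral_lebesgue_tupleS; last 2 first.
- by apply/measurable_EFinP; apply: measurable_wint_integrand.
- by move=> u; rewrite lee_fin mulr_ge0// weight_ge0.
- apply: eq_integral => x _; apply: eq_integral => u _.
  by rewrite gsum_tcons opprD addrA.
Qed.

Lemma measurable_wint_joint n (phi : R -> R) (phis : 'I_n -> R -> R) W
    (K : R -> euclid R n -> R) (r : R) : gauge phi ->
  (forall i, gauge (phis i)) -> weight W ->
  measurable_fun setT (fun z : measurableTypeR R * euclid R n => K z.1 z.2) ->
  measurable_fun setT (fun z : measurableTypeR R * euclid R n =>
    (K z.1 z.2 * W (r - phi z.1 - gsum phis z.2))%R%:E).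
Proof.
move=> gphi gp wW mK; apply/measurable_EFinP; apply: measurable_funM => //.
apply: measurableT_comp; first exact: measurable_weight.
apply: measurable_funB.
  apply: measurable_funB => //; apply: measurableT_comp; last exact: measurable_fst.
  exact: measurable_gauge.
apply: measurableT_comp; last exact: measurable_snd.
exact: measurable_gsum.
Qed.

Lemma measurable_wint n (phi : R -> R) (phis : 'I_n -> R -> R) W
    (K : R -> euclid R n -> R) (r : R) : gauge phi ->
  (forall i, gauge (phis i)) -> weight W ->
  measurable_fun setT (fun z : measurableTypeR R * euclid R n => K z.1 z.2) ->
  (forall x u, 0 <= K x u) ->
  measurable_fun setT (fun x : measurableTypeR R => wint phis W (K x) (r - phi x)).
Proof.
move=> gphi gp wW mK K0.
have := @measurable_fun_fubini_tonelli_F _ _ _ _ _ (lebesgue_tuple n)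
  (fun z : measurableTypeR R * euclid R n => (K z.1 z.2 * W (r - phi z.1 - gsum phis z.2))%:E).
apply; first exact: (measurable_wint_joint r gphi gp wW mK).
by move=> z; rewrite lee_fin mulr_ge0// weight_ge0.
Qed.

(* Integrating the first coordinate out replaces the weight W by wtr phi W. *)
Lemma wint_wtr n (phi : R -> R) (phis : 'I_n -> R -> R) W (G : euclid R n -> R) (r : R) : gauge phi ->
  (forall i, gauge (phis i)) -> weight W ->
  measurable_fun setT G -> (forall u, 0 <= G u) ->
  (\int[lebm R]_x wint phis W G (r - phi x)%R)%E = wint phis (wtr phi W) G r.
Proof.
move=> gphi gp wW mG G0; rewrite /wint.
rewrite (fubini_tonelli (fun z : measurableTypeR R * euclid R n =>
   (G z.2 * W (r - phi z.1 - gsum phis z.2))%R%:E)); last 2 first.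
- have mK : measurable_fun setT (fun z : measurableTypeR R * euclid R n => G z.2).
    exact: measurableT_comp mG measurable_snd.
  exact: (@measurable_wint_joint n phi phis W (fun _ => G) r gphi gp wW mK).
- by move=> z; rewrite lee_fin mulr_ge0// weight_ge0.
apply: eq_integral => u _ /=.
rewrite EFinM wtrE// -ge0_integralZl_EFin//.
- by apply: eq_integral => x _; rewrite -EFinM addrAC.
- by move=> x _; rewrite lee_fin weight_ge0.
- by apply/measurable_EFinP; exact: (measurable_wtr_fun gphi wW _).
Qed.

Lemma wvolE n (phis : 'I_n -> R -> R) W (r : R) : (forall i, gauge (phis i)) ->
  weight W -> wint phis W (cst 1) r = (wvol phis W r)%:E.
Proof.
elim: n phis r => [|n ih] phis r gp wW; first by rewrite wint0// mul1r.
have gt i : gauge (tailf phis i) by exact: gp.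
rewrite wintS//= wtrE//; last exact: weight_wvol.
by apply: eq_integral => x _; rewrite -ih.
Qed.

Lemma wint_behead n (phis : 'I_n.+1 -> R -> R) W (G : euclid R n.+1 -> R)
    (G' : euclid R n -> R) (r : R) : (forall i, gauge (phis i)) ->
  weight W -> measurable_fun setT G -> (forall u, 0 <= G u) ->
  measurable_fun setT G' -> (forall x u, G (tcons x u) = G' u) ->
  wint phis W G r = wint (tailf phis) (wtr (phis ord0) W) G' r.
Proof.
move=> gp wW mG G0 mG' GE.
have G0' u : 0 <= G' u by rewrite -(GE 0).
rewrite (wintS r gp wW mG G0).
rewrite -(wint_wtr r (gp ord0) (fun i => gp (lift ord0 i)) wW mG' G0').
by apply: eq_integral => x _; congr (wint _ _ _ _); apply/funext => u; exact: GE.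
Qed.

(** Exchange of the order of integration: on the left the head coordinate is integrated outermost,
    on the right it is absorbed into the weight first. *)
Lemma wvol_wtr n (phis : 'I_n.+1 -> R -> R) W (r : R) : (forall i, gauge (phis i)) ->
  weight W -> wvol phis W r = wvol (tailf phis) (wtr (phis ord0) W) r.
Proof.
move=> gp wW; apply/eqP; rewrite -eqe; apply/eqP.
rewrite -wvolE// -wvolE//; first exact: wint_behead.
- by move=> i; exact: gp.
- exact: weight_wtr.
Qed.

Lemma le_wint_bound n (phis : 'I_n -> R -> R) W (G : euclid R n -> R) (B r : R) : (forall i, gauge (phis i)) ->
  weight W -> measurable_fun setT G -> (forall u, 0 <= G u <= B) ->
  (wint phis W G r <= (B * wvol phis W r)%:E)%E.
Proof.
move=> gp wW mG GB; have B0 : 0 <= B by case/andP: (GB (nseq_tuple n 0)) => /le_trans; exact.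
rewrite EFinM -wvolE// -wintZ//; apply: le_wint => //.
- by apply: measurable_funM.
- by move=> u; case/andP: (GB u).
- by move=> u; rewrite mulr1; case/andP: (GB u).
Qed.

Lemma wint_fin_num n (phis : 'I_n -> R -> R) W (G : euclid R n -> R) (B r : R) : (forall i, gauge (phis i)) ->
  weight W -> measurable_fun setT G -> (forall u, 0 <= G u <= B) ->
  wint phis W G r \is a fin_num.
Proof.
move=> gp wW mG GB; rewrite ge0_fin_numE; last first.
  by apply: wint_ge0 => // u; case/andP: (GB u).
exact: le_lt_trans (le_wint_bound _ gp wW mG GB) (ltry _).
Qed.

Definition dominates n (u v : euclid R n) := forall i, `|tnth u i : R| <= `|tnth v i : R|.

(** Induction on the dimension: the conditional expectation [H x y] of [G], given the first
    coordinate [x] and the level [y] left to the others, is nondecreasing in [y] by the induction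
    hypothesis and in [|x|] by monotonicity of [G], so [stochastic_mono1] applies to it. *)
Lemma stochastic_mono n (phis : 'I_n -> R -> R) W (G : euclid R n -> R) (B r s : R) :
  (forall i, gauge (phis i)) -> weight W -> measurable_fun setT G ->
  (forall u, 0 <= G u <= B) -> (forall u v, dominates u v -> G u <= G v) ->
  r <= s -> s <= 1 ->
  (wint phis W G r * (wvol phis W s)%:E <= wint phis W G s * (wvol phis W r)%:E)%E.
Proof.
elim: n phis G r s => [|n ih] phis G r s gp wW mG GB Gm rs s1.
  by rewrite !wint0//= -!EFinM lee_fin mulrAC.
have gt i : gauge (tailf phis i) by exact: gp.
have g0 : gauge (phis ord0) by exact: gp.
have G0 u : 0 <= G u by case/andP: (GB u).
have B0 : 0 <= B by case/andP: (GB (nseq_tuple n.+1 0)) => /le_trans; exact.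
pose V := wvol (tailf phis) W.
have wV : weight V by exact: weight_wvol.
pose A x y := fine (wint (tailf phis) W (fun u => G (tcons x u)) y).
have mGx x : measurable_fun setT (fun u => G (tcons x u)).
  by apply: measurableT_comp mG _; exact: measurable_tcons2.
have GBx x u : 0 <= G (tcons x u) <= B by [].
have AE x y : ((A x y)%:E = wint (tailf phis) W (fun u => G (tcons x u)) y)%E.
  by rewrite /A fineK//; exact: (wint_fin_num y gt wW (mGx x) (GBx x)).
have A0 x y : 0 <= A x y by rewrite -lee_fin AE wint_ge0.
have AB x y : A x y <= B * V y.
  by rewrite -lee_fin AE; exact: (le_wint_bound y gt wW (mGx x) (GBx x)).
(* The quotient is 0 where [V] vanishes; there [A <= B * V] forces [A] to vanish too, so [H * V = A]
   holds everywhere. *)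
pose H x y := A x y / V y.
have HV x y : H x y * V y = A x y.
  rewrite /H; have [Vy|Vy] := eqVneq (V y) 0; last by rewrite divfK.
  by apply/eqP; rewrite Vy mulr0 eq_le A0/= -[leRHS](mulr0 B) -Vy AB.
have mK : measurable_fun setT (fun z : measurableTypeR R * euclid R n => G (tcons z.1 z.2)).
  by apply: measurableT_comp mG _; exact: measurable_tcons.
have := @stochastic_mono1 R (phis ord0) V r s H B g0 wV rs s1.
rewrite !wintS//.
under eq_integral do rewrite HV AE.
under [X in (_ -> _ -> _ -> _ -> (_ <= X * _)%E) -> _]eq_integral do rewrite HV AE.
apply.
- move=> c; apply: measurable_funM.
    have := @measurable_wint n (phis ord0) (tailf phis) W (fun x u => G (tcons x u)) c g0 gt wW mK (fun x u => G0 _).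
    by move=> /(measurableT_comp (@fine_measurable R setT measurableT)).
  apply: (@eq_measurable_fun _ _ _ _ _ (fun x => V (c - phis ord0 x) `^ (-1))).
    by move=> x _; rewrite powR_inv1// (weight_ge0 wV).
  apply: (@measurableT_comp _ _ _ _ _ _ (fun z : R => z `^ (-1))).
    exact: measurable_powR.
  exact: (measurable_wtr_fun g0 wV _).
- move=> x y; rewrite divr_ge0 ?A0 ?(weight_ge0 wV)//=.
  have [Vy|Vy] := eqVneq (V y) 0; first by rewrite /H Vy invr0 mulr0.
  by rewrite ler_pdivrMr ?AB// lt_def Vy (weight_ge0 wV).
- by move=> x y y0; rewrite /H (weight_lt0 wV y0) invr0 mulr0.
- move=> x x' y y' xx' yy' y'1.
  have [Vy|Vy] := eqVneq (V y) 0.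
    by rewrite {1}/H Vy invr0 mulr0 divr_ge0 ?A0 ?(weight_ge0 wV).
  have Vyp : 0 < V y by rewrite lt_def Vy (weight_ge0 wV).
  have Vyp' : 0 < V y' by rewrite (lt_le_trans Vyp)// (weight_mono wV).
  rewrite /H ler_pdivrMr// mulrAC ler_pdivlMr//.
  apply: (@le_trans _ _ (A x y' * V y)).
    rewrite -lee_fin !EFinM !AE; apply: ih => //.
    move=> u v uv; apply: Gm => i; case: (unliftP ord0 i) => [j ->|->].
      by rewrite !tnth_tconsS.
    by rewrite !tnth_tcons0.
  rewrite ler_wpM2r ?(weight_ge0 wV)// -lee_fin !AE; apply: le_wint => // u.
  apply: Gm => i; case: (unliftP ord0 i) => [j ->|->].
    by rewrite !tnth_tconsS.
  by rewrite !tnth_tcons0.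
Qed.

End weighted_integral.

(** * Decoupling and the maximal inequality *)

Section symmetrization.
Context {R : realType}.
Local Open Scope ereal_scope.

(** Exchanging the variables does not change either double integral, so comparing the symmetrized
    integrands pointwise suffices even where [S] exceeds [T]. *)
Lemma le_integral_sym (S T : R -> R -> R) :
  measurable_fun setT (fun z : measurableTypeR R * measurableTypeR R => S z.1 z.2) ->
  measurable_fun setT (fun z : measurableTypeR R * measurableTypeR R => T z.1 z.2) ->
  (forall x y, (0 <= S x y)%R) -> (forall x y, (0 <= T x y)%R) ->
  (forall x y, (S x y + S y x <= T x y + T y x)%R) ->
  \int[lebm R]_x \int[lebm R]_y (S x y)%:E <= \int[lebm R]_x \int[lebm R]_y (T x y)%:E.
Proof.
move=> mS mT S0 T0 ST.
have msw (U : R -> R -> R) :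
    measurable_fun setT (fun z : measurableTypeR R * measurableTypeR R => U z.1 z.2) ->
    measurable_fun setT (fun z : measurableTypeR R * measurableTypeR R => U z.2 z.1).
  move=> mU.
  have h := measurableT_comp mU (@measurable_swap _ _ (measurableTypeR R) (measurableTypeR R)).
  exact h.
have dbl (U : R -> R -> R) :
    measurable_fun setT (fun z : measurableTypeR R * measurableTypeR R => U z.1 z.2) ->
    (forall x y, (0 <= U x y)%R) ->
    \int[lebm R \x lebm R]_z (U z.1 z.2 + U z.2 z.1)%:E =
    2%:E * \int[lebm R]_x \int[lebm R]_y (U x y)%:E.
  move=> mU U0.
  have mE : measurable_fun setT (fun z : measurableTypeR R * measurableTypeR R => (U z.1 z.2)%:E) by exact/measurable_EFinP.
  have mE' : measurable_fun setT (fun z : measurableTypeR R * measurableTypeR R => (U z.2 z.1)%:E) by apply/measurable_EFinP; exact: msw.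
  under eq_integral do rewrite EFinD.
  rewrite ge0_integralD//; last 2 first.
  - by move=> z _; rewrite lee_fin.
  - by move=> z _; rewrite lee_fin.
  rewrite (fubini_tonelli1 _ mE); last by move=> z; rewrite lee_fin.
  rewrite (fubini_tonelli2 _ mE'); last by move=> z; rewrite lee_fin.
  by rewrite /fubini_F /fubini_G /= -mule2n mule_natl.
rewrite -(@lee_pmul2l _ 2%:E) ?lte_fin// -!dbl//.
apply: ge0_le_integral => //.
- by move=> z _; rewrite lee_fin addr_ge0.
- by apply/measurable_EFinP; apply: measurable_funD => //; exact: msw.
- by apply/measurable_EFinP; apply: measurable_funD => //; exact: msw.
- by move=> z _; rewrite lee_fin ST.
Qed.

End symmetrization.

Section peeling.
Context {R : realType}.
Variables (n : nat) (phis : 'I_n.+1 -> R -> R) (W : R -> R).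
Hypothesis gp : forall i, gauge (phis i).
Hypothesis wW : weight W.
Variables (K : R -> euclid R n -> R) (B : R).
Hypothesis mK : measurable_fun setT (fun z : measurableTypeR R * euclid R n => K z.1 z.2).
Hypothesis KB : forall x u, 0 <= K x u <= B.
Hypothesis Kinc : forall x x' u u', `|x'| <= `|x| -> dominates u u' ->
  K x u - K x' u <= K x u' - K x' u'.

Let phi := phis ord0.
Let tl := tailf phis.
Let V := wvol tl W.
Let gphi : gauge phi. Proof. exact: gp. Qed.
Let gt i : gauge (tl i). Proof. exact: gp. Qed.
Let wV : weight V. Proof. exact: weight_wvol. Qed.
Let K0 x u : 0 <= K x u. Proof. by case/andP: (KB x u). Qed.
Let B0 : 0 <= B. Proof. by case/andP: (KB 0 (nseq_tuple n 0)) => /le_trans; exact. Qed.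

Let mKx x : measurable_fun setT (K x).
Proof. have h := measurableT_comp mK (pair1_measurable x); exact h. Qed.

Let A (x y : R) : R := fine (wint tl W (K x) y).

Let AE x y : ((A x y)%:E = wint tl W (K x) y)%E.
Proof. by rewrite /A fineK//; exact: (wint_fin_num y gt wW (mKx x) (KB x)). Qed.

Let A0 x y : 0 <= A x y. Proof. by rewrite -lee_fin AE wint_ge0. Qed.

(** This is [stochastic_mono] for the increment of [K] between [x'] and [x], nondecreasing in the
    other coordinates by [Kinc]. Adding [B] makes the increment nonnegative and contributes the same
    term to both sides. *)
Lemma exchange_wint (x x' y y' : R) : `|x'| <= `|x| -> y <= y' -> y' <= 1 ->
  V y' * A x y + V y * A x' y' <= V y * A x y' + V y' * A x' y.
Proof.
move=> xx yy y1.
pose D u := K x u - K x' u + B.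
have D0 u : 0 <= D u <= 2 * B.
  by have /andP[] := KB x u; have /andP[] := KB x' u; rewrite /D; lra.
have mD : measurable_fun setT D.
  by apply: measurable_funD => //; apply: measurable_funB.
have := @stochastic_mono R n tl W D (2 * B) y y' gt wW mD D0 _ yy y1.
have dE z : (wint tl W D z = (A x z - A x' z + B * V z)%:E)%E.
  have fD := wint_fin_num z gt wW mD D0.
  have : wint tl W (fun u => K x u + B * 1) z = wint tl W (fun u => K x' u + D u) z.
    by congr (wint _ _ _ _); apply/funext => u; rewrite /D; ring.
  rewrite wintD//; last by move=> u; rewrite mulr1.
  rewrite (@wintZ _ _ _ _ (cst 1))// wvolE// -AE wintD//; last first.
    by move=> u; case/andP: (D0 u).
  rewrite -AE -(fineK fD) -EFinM -!EFinD => -[] h; congr EFin.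
  by rewrite -/V in h; lra.
rewrite !dE -!EFinM lee_fin => h.
have {}h : (A x y - A x' y + B * V y) * V y' <= (A x y' - A x' y' + B * V y') * V y.
  by apply: h => u v uv; rewrite lerD2r; exact: Kinc.
lra.
Qed.

(* V (1 - phi x) is the marginal density of the first coordinate and wtr phi W
   carries the marginal law of the others: up to the normalization by the volume,
   the first coordinate is made independent of the others. *)
Lemma peel_le :
  ((wvol phis W 1)%:E * \int[lebm R]_x wint tl W (K x) (1 - phi x)%R <=
   \int[lebm R]_x ((V (1 - phi x))%:E * wint tl (wtr phi W) (K x) 1))%E.
Proof.
have mV : measurable_fun setT (fun x => V (1 - phi x)) by exact: (measurable_wtr_fun gphi wV _).
have mA : measurable_fun setT (fun z : measurableTypeR R * measurableTypeR R => A z.1 (1 - phi z.2)).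
  have := @measurable_fun_fubini_tonelli_F _ _ _ _ _ (lebesgue_tuple n)
    (fun z : (measurableTypeR R * measurableTypeR R) * euclid R n =>
      (K z.1.1 z.2 * W (1 - phi z.1.2 - gsum tl z.2))%:E).
  have h : measurable_fun setT (fun z : (measurableTypeR R * measurableTypeR R) * euclid R n =>
      (K z.1.1 z.2 * W (1 - phi z.1.2 - gsum tl z.2))%:E).
    apply/measurable_EFinP; apply: measurable_funM.
      have hp : measurable_fun setT (fun z : (measurableTypeR R * measurableTypeR R) * euclid R n => (z.1.1, z.2)).
        apply/measurable_fun_pairP; split; last exact: measurable_snd.
        have h := measurableT_comp (@measurable_fst _ _ (measurableTypeR R) (measurableTypeR R)) (@measurable_fst _ _ _ (euclid R n)).
        exact h.
      have h := measurableT_comp mK hp; exact h.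
    apply: measurableT_comp; first exact: measurable_weight.
    apply: measurable_funB.
      apply: measurable_funB => //; apply: measurableT_comp; first exact: measurable_gauge.
      have h := measurableT_comp (@measurable_snd _ _ (measurableTypeR R) (measurableTypeR R)) (@measurable_fst _ _ _ (euclid R n)).
      exact h.
    apply: measurableT_comp; last exact: measurable_snd.
    exact: measurable_gsum.
  move=> /(_ h) mF.
  have {}mF : measurable_fun setT (fun z : measurableTypeR R * measurableTypeR R => (A z.1 (1 - phi z.2))%:E).
    apply: (eq_measurable_fun _ _ (mF _)).
      by move=> z _; rewrite AE.
    by move=> z; rewrite lee_fin mulr_ge0// weight_ge0.
  exact/measurable_EFinP.
have mV1 : measurable_fun setT (fun z : measurableTypeR R * measurableTypeR R => V (1 - phi z.1)).
  have h := measurableT_comp mV (@measurable_fst _ _ (measurableTypeR R) (measurableTypeR R)); exact h.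
have mV2 : measurable_fun setT (fun z : measurableTypeR R * measurableTypeR R => V (1 - phi z.2)).
  have h := measurableT_comp mV (@measurable_snd _ _ (measurableTypeR R) (measurableTypeR R)); exact h.
have mA1 : measurable_fun setT (fun z : measurableTypeR R * measurableTypeR R => A z.1 (1 - phi z.1)).
  have hp : measurable_fun setT (fun z : measurableTypeR R * measurableTypeR R => (z.1, z.1)).
    by apply/measurable_fun_pairP; split; exact: measurable_fst.
  have h := measurableT_comp mA hp; exact h.
have le1 x : 1 - phi x <= 1 by rewrite lerBlDr lerDl gauge_ge0.
(* On the left the other coordinates live at the level left by [x] itself, on the right at the level
   left by an independent copy [y]. The larger of [|x|] and [|y|] takes the role of the first
   argument in [exchange_wint]. *)
have := @le_integral_sym R (fun x y => V (1 - phi y) * A x (1 - phi x))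
  (fun x y => V (1 - phi x) * A x (1 - phi y)).
move=> /(_ (measurable_funM mV2 mA1) (measurable_funM mV1 mA)).
have V0 z := weight_ge0 wV z.
move=> /(_ (fun x y => mulr_ge0 (V0 _) (A0 _ _)) (fun x y => mulr_ge0 (V0 _) (A0 _ _))).
have sym x y : V (1 - phi y) * A x (1 - phi x) + V (1 - phi x) * A y (1 - phi y) <=
    V (1 - phi x) * A x (1 - phi y) + V (1 - phi y) * A y (1 - phi x).
  have [yx|xy] := leP `|y| `|x|.
    apply: exchange_wint => //.
    by apply: lerB => //; exact: (gauge_mono gphi).
  rewrite addrC [leRHS]addrC; apply: exchange_wint => //; first exact: ltW.
  by apply: lerB => //; apply: (gauge_mono gphi); exact: ltW.
move=> /(_ sym).
have -> : (\int[lebm R]_x \int[lebm R]_y (V (1 - phi y) * A x (1 - phi x))%:E =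
    (wvol phis W 1)%:E * \int[lebm R]_x wint tl W (K x) (1 - phi x)%R)%E.
  rewrite [wvol phis W 1]/= wtrE// -ge0_integralZl//; last first.
  - by apply: integral_ge0 => y _; rewrite lee_fin.
  - by move=> x _; exact: wint_ge0.
  - by apply: (@measurable_wint _ _ phi tl W K 1).
  apply: eq_integral => x _; rewrite -AE muleC -ge0_integralZl_EFin//.
  - by apply: eq_integral => y _; rewrite -EFinM mulrC.
  - by move=> y _; rewrite lee_fin.
  - exact/measurable_EFinP.
move=> /le_trans; apply; rewrite le_eqVlt; apply/orP; left; apply/eqP.
apply: eq_integral => x _.
rewrite -(wint_wtr _ gphi gt wW (mKx x) (K0 x)) -ge0_integralZl//.
- by apply: eq_integral => y _; rewrite -AE -EFinM.
- by apply: (@measurable_wint _ _ phi tl W (fun _ => K x) 1) => //;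
    have h := measurableT_comp (mKx x) (@measurable_snd _ _ (measurableTypeR R) (euclid R n)); exact h.
- by move=> y _; exact: wint_ge0.
- by rewrite lee_fin.
Qed.

End peeling.

Section maximal_inequality.
Context {R : realType}.
Variables (y g : R -> R) (a : R).

(* Lindley's recursion for the maximum of 0 and all the prefix sums of y. *)
Definition excess (s : seq R) : R := foldr (fun x m => Num.max 0 (y x + m)) 0 s.

Lemma excess_ge0 s : 0 <= excess s.
Proof. by case: s => //= x s; rewrite le_max lexx. Qed.

Lemma excess_ge_prefix (s : seq R) k : \sum_(x <- take k s) y x <= excess s.
Proof.
elim: s k => [|x s ih] k /=; first by rewrite big_nil.
case: k => [|k]; first by rewrite big_nil le_max lexx.
by rewrite big_cons le_max lerD2l ih orbT.
Qed.

Hypothesis my : measurable_fun setT y.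
Hypothesis ya : forall x, y x <= a.
Hypothesis a0 : 0 <= a.

Lemma excess_le (s : seq R) : excess s <= a *+ size s.
Proof.
elim: s => //= x s ih; rewrite ge_max mulrS; apply/andP; split; last exact: lerD.
by rewrite addr_ge0// mulrn_wge0.
Qed.

Lemma measurable_excess n : measurable_fun setT (fun u : euclid R n => excess u).
Proof.
elim: n => [|n ih].
  by apply: (@eq_measurable_fun _ _ _ _ _ (cst (0 : R) : euclid R 0 -> R)) => // u _; rewrite (tuple0 u).
apply: (@eq_measurable_fun _ _ _ _ _ (fun u : euclid R n.+1 => Num.max 0 (y (thead u) + excess (behead_tuple u)))).
  by move=> u _; rewrite [in RHS](tuple_eta u).
apply: measurable_maxr => //; apply: measurable_funD.
  by apply: measurableT_comp => //; exact: measurable_tnth.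
have h := measurableT_comp ih (@measurable_behead _ (measurableTypeR R) n); exact h.
Qed.

Hypothesis g0 : forall z, 0 <= g z.
Hypothesis g_mono : forall z z', 0 <= z -> z <= z' -> g z <= g z'.
Hypothesis mg : measurable_fun setT g.
Hypothesis g_conv : forall z z' d, 0 <= d -> z <= z' ->
  g (Num.max 0 (z + d)) - g (Num.max 0 z) <= g (Num.max 0 (z' + d)) - g (Num.max 0 z').
Hypothesis y_mono : (forall x x', `|x'| <= `|x| -> y x' <= y x) \/
  (forall x x', `|x'| <= `|x| -> y x <= y x').

Let h (x m : R) := g (Num.max 0 (y x + m)).

Lemma tnth_lift0 n (w : euclid R n.+1) i : tnth w (lift ord0 i) = tnth (behead_tuple w) i.
Proof. by rewrite [in LHS](tuple_eta w) tnthS. Qed.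

Lemma excess_dominates n (u v : euclid R n) : dominates u v ->
  (forall x x', `|x'| <= `|x| -> y x' <= y x) -> excess u <= excess v.
Proof.
move=> uv inc; elim: n u v uv => [|n ih] u v uv; first by rewrite (tuple0 u) (tuple0 v).
rewrite (tuple_eta u) (tuple_eta v) /= le_max2//.
apply: lerD; first by apply: inc; exact: uv.
apply: (ih (behead_tuple u) (behead_tuple v)) => i; have := uv (lift ord0 i).
by rewrite !tnth_lift0.
Qed.

Lemma excess_dominatesN n (u v : euclid R n) : dominates u v ->
  (forall x x', `|x'| <= `|x| -> y x <= y x') -> excess v <= excess u.
Proof.
move=> uv dec; elim: n u v uv => [|n ih] u v uv; first by rewrite (tuple0 u) (tuple0 v).
rewrite (tuple_eta u) (tuple_eta v) /= le_max2//.
apply: lerD; first by apply: dec; exact: uv.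
apply: (ih (behead_tuple u) (behead_tuple v)) => i; have := uv (lift ord0 i).
by rewrite !tnth_lift0.
Qed.

Lemma step_increment_le (x x' m m' : R) : y x' <= y x -> m <= m' ->
  h x m - h x' m <= h x m' - h x' m'.
Proof.
move=> yx mm; have d0 : 0 <= y x - y x' by rewrite subr_ge0.
have zz : y x' + m <= y x' + m' by rewrite lerD2l.
have e k : y x' + k + (y x - y x') = y x + k by ring.
by have := g_conv d0 zz; rewrite !e /h; lra.
Qed.

(** If [y] decreases in [|x|], both the step and the excess reverse their order and the two
    reversals cancel. Hence both signs of the summand can be treated alike. *)
Lemma step_excess_increment_le n (x x' : R) (u u' : euclid R n) : `|x'| <= `|x| -> dominates u u' ->
  h x (excess u) - h x' (excess u) <= h x (excess u') - h x' (excess u').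
Proof.
move=> xx uu; case: y_mono => mon.
  by apply: step_increment_le; [exact: mon|exact: excess_dominates].
have := @step_increment_le x' x (excess u') (excess u) (mon _ _ xx) (excess_dominatesN uu mon).
lra.
Qed.

(** Induction on the number of coordinates, with [W] arbitrary since the weight changes at each
    step. [peel_le] makes the head independent; for a fixed excess [m] of the others, the
    one-coordinate hypothesis turns its integral into [c * g m], and the tail is again of the same
    form. *)
Lemma excess_moment n (phis : 'I_n -> R -> R) (W : R -> R) (c : R) :
  (forall i, gauge (phis i)) -> weight W -> 0 <= c ->
  (forall i m, 0 <= m ->
     (wint phis W (fun u => h (tnth u i) m) 1 <= (c * g m * wvol phis W 1)%:E)%E) ->
  (wint phis W (fun u => g (excess u)) 1 <= (c ^+ n * g 0 * wvol phis W 1)%:E)%E.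
Proof.
move=> gp wW c0; elim: n phis W gp wW => [|n ih] phis W gp wW hyp.
  rewrite wint0//; last by apply: measurableT_comp => //; exact: measurable_excess.
  by rewrite expr0 mul1r.
set Z := wvol phis W 1.
have Z0 : 0 <= Z by exact: (weight_ge0 (weight_wvol gp wW)).
have gt i : gauge (tailf phis i) by exact: gp.
have gphi := gp ord0.
have mgn k : measurable_fun setT (fun u : euclid R k => g (excess u)).
  by apply: measurableT_comp => //; exact: measurable_excess.
pose B := g (a *+ n.+1).
have hB k (u : euclid R k) : (k <= n.+1)%N -> 0 <= g (excess u) <= B.
  move=> kn; rewrite g0/=; apply: g_mono; first exact: excess_ge0.
  apply: le_trans (excess_le _) _; rewrite size_tuple.
  exact: ler_wpMn2l.
have [Ze|Zn] := eqVneq Z 0.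
  rewrite Ze mulr0 -(mulr0 B) -Ze.
  by apply: le_wint_bound => // u; exact: hB.
have Zp : 0 < Z by rewrite lt_def Zn.
have mh x : measurable_fun setT (h x).
  apply: measurableT_comp => //; apply: measurable_maxr => //.
  by apply: measurable_funD.
have wW1 : weight (wtr (phis ord0) W) by exact: weight_wtr.
pose K x (u : euclid R n) := h x (excess u).
have mK : measurable_fun setT (fun z : measurableTypeR R * euclid R n => K z.1 z.2).
  have hh := measurableT_comp (mgn n.+1) (@measurable_tcons R n); exact hh.
have KB x u : 0 <= K x u <= B by exact: (hB n.+1 (tcons x u)).
have Kinc (x x' : R) (u u' : euclid R n) : `|x'| <= `|x| -> dominates u u' ->
    K x u - K x' u <= K x u' - K x' u' by exact: step_excess_increment_le.
have := peel_le gp wW mK KB Kinc.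
have E1 : (\int[lebm R]_x wint (tailf phis) W (K x) (1 - phis ord0 x)%R =
    wint phis W (fun u => g (excess u)) 1)%E.
  by rewrite (wintS 1 gp wW (mgn n.+1) (fun u => g0 _)).
rewrite E1 -/Z => peel {E1}.
set V := wvol (tailf phis) W in peel.
have wV : weight V by exact: weight_wvol.
(* [V (1 - phi x)] is the marginal density of the head, so this is the hypothesis for [ord0] with
   [m] equal to the excess of the tail. *)
have marg u : (\int[lebm R]_x (K x u * V (1 - phis ord0 x))%:E <= (c * g (excess u) * Z)%:E)%E.
  have m0 : 0 <= excess u by exact: excess_ge0.
  apply: le_trans (hyp ord0 (excess u) m0).
  have mhu : measurable_fun setT (fun v : euclid R n.+1 => h (tnth v ord0) (excess u)).
    have hm : measurable_fun setT (fun x : R => h x (excess u)).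
      apply: measurableT_comp => //; apply: measurable_maxr => //.
      by apply: measurable_funD.
    have hh := measurableT_comp hm (@measurable_tnth _ (measurableTypeR R) n.+1 ord0); exact hh.
  rewrite (wintS 1 gp wW mhu (fun v => g0 _)) le_eqVlt; apply/orP; left; apply/eqP.
  apply: eq_integral => x _.
  rewrite EFinM /V -wvolE// -wintZ//; last exact: g0.
  by congr (wint _ _ _ _); apply/funext => v; rewrite mulr1 tnth_tcons0.
have bound : (\int[lebm R]_x ((V (1 - phis ord0 x))%:E * wint (tailf phis) (wtr (phis ord0) W) (K x) 1) <=
    (c * Z)%:E * wint (tailf phis) (wtr (phis ord0) W) (fun u => g (excess u)) 1)%E.
  pose W1 := wtr (phis ord0) W.
  have mV : measurable_fun setT (fun x => V (1 - phis ord0 x)) by exact: (measurable_wtr_fun gphi wV _).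
  have mW1 : measurable_fun setT (fun u : euclid R n => W1 (1 - gsum (tailf phis) u)).
    apply: measurableT_comp; first exact: measurable_weight.
    by apply: measurable_funB => //; exact: measurable_gsum.
  have mJ : measurable_fun setT (fun z : measurableTypeR R * euclid R n =>
      (K z.1 z.2 * V (1 - phis ord0 z.1) * W1 (1 - gsum (tailf phis) z.2))%:E).
    apply/measurable_EFinP; apply: measurable_funM; first apply: measurable_funM => //.
      have hh := measurableT_comp mV (@measurable_fst _ _ (measurableTypeR R) (euclid R n)); exact hh.
    have hh := measurableT_comp mW1 (@measurable_snd _ _ (measurableTypeR R) (euclid R n)); exact hh.
  have V0 z : 0 <= V z by exact: weight_ge0.
  have W10 z : 0 <= W1 z by exact: weight_ge0.
  have K0 x u : 0 <= K x u by case/andP: (KB x u).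
  have mKx x : measurable_fun setT (K x).
    have hh := measurableT_comp mK (pair1_measurable (x : measurableTypeR R)); exact hh.
  have mKu u : measurable_fun setT (fun x => K x u).
    apply: measurableT_comp => //; apply: measurable_maxr => //.
    by apply: measurable_funD.
  have -> : (\int[lebm R]_x ((V (1 - phis ord0 x))%:E * wint (tailf phis) W1 (K x) 1) =
     \int[lebm R]_x \int[lebesgue_tuple n]_u (K x u * V (1 - phis ord0 x) * W1 (1 - gsum (tailf phis) u))%:E)%E.
    apply: eq_integral => x _; rewrite /wint -ge0_integralZl_EFin//.
    - by apply: eq_integral => u _; rewrite -EFinM mulrCA mulrA.
    - by move=> u _; rewrite lee_fin mulr_ge0.
    - by apply/measurable_EFinP; apply: measurable_funM.
  rewrite (fubini_tonelli (fun z : measurableTypeR R * euclid R n =>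
      (K z.1 z.2 * V (1 - phis ord0 z.1) * W1 (1 - gsum (tailf phis) z.2))%:E) mJ); last first.
    by move=> z; rewrite lee_fin !mulr_ge0.
  rewrite -(wintZ _ gt wW1 (mgn n) (fun u => g0 _)); last by rewrite mulr_ge0.
  apply: ge0_le_integral => //.
  - by move=> u _; apply: integral_ge0 => x _; rewrite lee_fin !mulr_ge0.
  - apply: (measurable_fun_fubini_tonelli_G _ mJ).
    by move=> z; rewrite lee_fin !mulr_ge0.
  - apply/measurable_EFinP; apply: measurable_funM => //.
    by apply: measurable_funM; [exact: measurable_cst|exact: mgn].
  move=> u _ /=.
  have -> : (\int[lebm R]_x (K x u * V (1 - phis ord0 x) * W1 (1 - gsum (tailf phis) u))%:E =
     (W1 (1 - gsum (tailf phis) u))%:E * \int[lebm R]_x (K x u * V (1 - phis ord0 x))%:E)%E.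
    rewrite -ge0_integralZl_EFin//.
    - by apply: eq_integral => x _; rewrite -EFinM mulrC.
    - by move=> x _; rewrite lee_fin mulr_ge0.
    - by apply/measurable_EFinP; apply: measurable_funM; [exact: mKu|exact: mV].
  rewrite [leRHS]EFinM muleC; apply: lee_wpmul2r; first by rewrite lee_fin.
  by rewrite mulrAC; exact: marg.
have hyp1 i m : 0 <= m ->
   (wint (tailf phis) (wtr (phis ord0) W) (fun u => h (tnth u i) m) 1 <=
    (c * g m * wvol (tailf phis) (wtr (phis ord0) W) 1)%:E)%E.
  move=> m0; rewrite -wvol_wtr//.
  have hm : measurable_fun setT (fun x : R => h x m).
    apply: measurableT_comp => //; apply: measurable_maxr => //.
    by apply: measurable_funD.
  rewrite -(@wint_behead _ _ phis W (fun u => h (tnth u (lift ord0 i)) m))//.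
  - exact: hyp.
  - have hh := measurableT_comp hm (@measurable_tnth _ (measurableTypeR R) n.+1 (lift ord0 i)); exact hh.
  - by move=> u; exact: g0.
  - have hh := measurableT_comp hm (@measurable_tnth _ (measurableTypeR R) n i); exact hh.
  - by move=> x u; rewrite tnth_tconsS.
have IH := ih _ _ gt wW1 hyp1.
rewrite -wvol_wtr// -/Z in IH.
rewrite -(@lee_pmul2l _ Z%:E) ?lte_fin//.
apply: (le_trans peel); apply: (le_trans bound).
apply: (le_trans (lee_wpmul2l _ IH)); first by rewrite lee_fin mulr_ge0.
by rewrite -!EFinM lee_fin exprS le_eqVlt; apply/orP; left; apply/eqP; ring.
Qed.

End maximal_inequality.

(** * Fourth moments and numerical inequalities *)

Section exponential_moments.
Context {R : realType}.
Variable kap : R.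
Hypothesis kap0 : 0 < kap.

(** The antiderivative of [x ^+ k * expR (- kap * x)] that vanishes at infinity; the recursion is
    integration by parts. *)
Fixpoint expR_primitive (k : nat) (x : R) : R :=
  match k with
  | 0 => - (expR (- kap * x) / kap)
  | j.+1 => j.+1%:R / kap * expR_primitive j x - x ^+ j.+1 * expR (- kap * x) / kap
  end.

Lemma is_derive_expR_primitive k (x : R) :
  is_derive x (1 : R) (expR_primitive k) (x ^+ k * expR (- kap * x)).
Proof.
have kn : kap != 0 by rewrite gt_eqF.
have de : is_derive x (1 : R) (fun x : R => expR (- kap * x)) (- kap * expR (- kap * x)).
  have d1 : is_derive x (1 : R) (fun x : R => - kap * x) (- kap).
    by apply: is_derive_eq; rewrite /GRing.scale/= mulr1.
  have d2 : is_derive (- kap * x) (1 : R) (expR : R -> R) (expR (- kap * x)).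
    by apply: is_derive_eq.
  have := is_derive1_comp d2 d1.
  by rewrite mulrC.
elim: k => [|k ih].
  have -> : (expR_primitive 0) = (fun x => (- kap^-1) *: expR (- kap * x)).
    by apply/funext => y /=; rewrite /GRing.scale/=; ring.
  by apply: is_derive_eq; rewrite /GRing.scale/= expr0; field.
have -> : (expR_primitive k.+1) = (fun x => (k.+1%:R / kap) *: expR_primitive k x - kap^-1 *: (x ^+ k.+1 * expR (- kap * x))).
  by apply/funext => y /=; rewrite /GRing.scale/=; ring.
have dx : is_derive x (1 : R) (fun x : R => x ^+ k.+1) (k.+1%:R * x ^+ k).
  have := @is_deriveX R R id k.+1 x 1 1 (is_derive_id x 1).
  by rewrite exprfctE /GRing.scale/= mulr1.
by apply: is_derive_eq; rewrite /GRing.scale/= exprS; field.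
Qed.

Lemma expR_primitive0 k : expR_primitive k 0 = - (k`!%:R / kap ^+ k.+1).
Proof.
elim: k => [|k ih] /=; first by rewrite mulr0 expR0 expr1.
rewrite ih expr0n /= !mul0r subr0 mulrN factS natrM [in RHS]exprS.
by congr (- _); field; rewrite expf_neq0 gt_eqF.
Qed.

Lemma cvg_Xn_expRN k : x ^+ k * expR (- kap * x) @[x --> +oo] --> 0.
Proof.
apply/cvgrPdist_le => e e0; near=> x.
have x0 : 0 < x by near: x; exact: nbhs_pinfty_gt.
rewrite sub0r normrN ger0_norm; last by rewrite mulr_ge0 ?expR_ge0// exprn_ge0// ltW.
pose C := k.+1`!%:R / kap ^+ k.+1.
have C0 : 0 < C by rewrite divr_gt0 ?exprn_gt0// ltr0n fact_gt0.
have xC : C / e <= x by near: x; apply: nbhs_pinfty_ge; exact: num_real.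
have h := expR_ge1Dxn k (ltW (mulr_gt0 kap0 x0)).
have h1 : (kap * x) ^+ k.+1 / k.+1`!%:R <= expR (kap * x) by rewrite (le_trans _ h)// lerDr.
rewrite mulNr expRN ler_pdivrMr ?expR_gt0//.
apply: (@le_trans _ _ (e * ((kap * x) ^+ k.+1 / k.+1`!%:R))); last by rewrite ler_wpM2l// ltW.
have -> : e * ((kap * x) ^+ k.+1 / k.+1`!%:R) = (e * x / C) * x ^+ k.
  rewrite /C exprMn (exprSr x); field.
  by rewrite expf_neq0 ?gt_eqF//= pnatr_eq0 -lt0n fact_gt0.
rewrite ler_peMl ?exprn_ge0 ?(ltW x0)// ler_pdivlMr// mul1r.
by rewrite mulrC -ler_pdivrMr.
Unshelve. all: by end_near. Qed.

Lemma cvg_expR_primitive k : expR_primitive k x @[x --> +oo] --> 0.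
Proof.
elim: k => [|k ih] /=.
  have h0 : expR (- kap * x) @[x --> +oo] --> 0.
    by have := cvg_Xn_expRN 0; under eq_fun do rewrite expr0 mul1r.
  by rewrite -oppr0; apply: cvgN; rewrite -(mul0r kap^-1); exact: cvgMr_tmp.
have -> : 0 = k.+1%:R / kap * 0 - 0 * kap^-1 :> R by rewrite mulr0 mul0r subr0.
apply: cvgB; first exact: cvgMl_tmp.
apply: cvgMr_tmp; exact: (cvg_Xn_expRN k.+1).
Qed.

Lemma expR_moment k : ~~ odd k ->
  (\int[lebm R]_x (x ^+ k * expR (- kap * `|x|))%:E = (2 * (k`!%:R / kap ^+ k.+1))%:E)%E.
Proof.
move=> ok.
have ek (x : R) : `|x| ^+ k = x ^+ k by rewrite -normrX ger0_norm// exprn_even_ge0.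
rewrite ge0_symfun_integralT.
- rewrite EFinM; congr (_ * _)%E.
  transitivity (\int[lebm R]_(x in `[0%R, +oo[) (x ^+ k * expR (- kap * x))%:E)%E.
    rewrite set_itvcy; apply: eq_integral => x; rewrite inE/= => x0.
    by rewrite ger0_norm.
  rewrite (@ge0_continuous_FTC2y _ _ (expR_primitive k) _ 0).
  - by rewrite expR_primitive0 EFinN oppeK add0e.
  - by move=> x x0; rewrite mulr_ge0 ?exprn_ge0 ?expR_ge0.
  - apply: continuous_subspaceT => x.
    apply: cvgM; first exact: exprn_continuous.
    apply: continuous_comp; last exact: continuous_expR.
    by apply: cvgMl_tmp; exact: cvg_id.
  - exact: cvg_expR_primitive.
  - by move=> x _; have [] := is_derive_expR_primitive k x.
  - apply/cvg_at_right_filter; apply: differentiable_continuous.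
    by apply/derivable1_diffP; have [] := is_derive_expR_primitive k 0.
  - by move=> x _; rewrite derive1E; have [] := is_derive_expR_primitive k x.
- by move=> x; rewrite mulr_ge0 ?expR_ge0// exprn_even_ge0.
- move=> x; apply: cvgM; first exact: exprn_continuous.
  apply: continuous_comp; last exact: continuous_expR.
  by apply: cvgMl_tmp; exact: norm_continuous.
- by move=> x /=; rewrite normrN -(ek (- x)) normrN ek.
Qed.

End exponential_moments.

Section fourth_moment.
Context {R : realType}.
Variables (z : R -> R) (b m0 m2 : R).
Hypothesis mz : measurable_fun setT z.
Hypothesis z0 : forall x, 0 <= z x.
Hypothesis zb : forall x, z x != 0 -> `|x| <= b.
Hypothesis ze : forall x, z `|x| = z x.
Hypothesis zlc : forall t x y c d : R, 0 <= t <= 1 -> expR c <= z x -> expR d <= z y ->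
  expR (t * c + (1 - t) * d) <= z (t * x + (1 - t) * y).
Hypothesis m00 : 0 < m0.
Hypothesis m20 : 0 < m2.
Hypothesis z_m0 : (\int[lebm R]_x (z x)%:E = m0%:E)%E.
Hypothesis z_m2 : (\int[lebm R]_x (x ^+ 2 * z x)%:E = m2%:E)%E.

(* z is compared with the two-sided exponential density E having the same moments
   of orders 0 and 2: by log-concavity, z - E is nonnegative exactly on an
   interval p <= |x| <= q, so (x^2 - p^2)(x^2 - q^2)(z - E) has negative integral. *)
Lemma fourth_moment_log_concave :
  (\int[lebm R]_x (x ^+ 4 * z x)%:E <= (6 * m2 ^+ 2 / m0)%:E)%E.
Proof.
(* The two-sided exponential density of rate [kap] has second moment [2 / kap ^+ 2] per unit mass,
   which fixes [kap]; [A] below then adjusts the mass to [m0]. Its fourth moment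
   [24 * m0 / kap ^+ 4] is the claimed bound. *)
pose kap := Num.sqrt (2 * m0 / m2).
have k2 : kap ^+ 2 = 2 * m0 / m2 by rewrite sqr_sqrtr// divr_ge0// ltW// mulr_gt0.
have k0 : 0 < kap by rewrite sqrtr_gt0 divr_gt0// mulr_gt0.
have kn : kap != 0 by rewrite gt_eqF.
have m0n : m0 != 0 by rewrite gt_eqF.
have m2n : m2 != 0 by rewrite gt_eqF.
pose A := m0 * kap / 2.
have A0 : 0 < A by rewrite divr_gt0// mulr_gt0.
pose E (x : R) := A * expR (- kap * `|x|).
have E0 x : 0 < E x by rewrite mulr_gt0// expR_gt0.
have mEk k : measurable_fun setT (fun x : R => x ^+ k * expR (- kap * `|x|)).
  apply: measurable_funM; first exact: exprn_measurable.
  apply: measurableT_comp; first exact: measurable_expR.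
  apply: measurable_funM => //; exact: measurable_realfun.normr_measurable.
have mE : measurable_fun setT E.
  by have := mEk 0; under eq_fun do rewrite expr0 mul1r; move=> h; apply: measurable_funM.
have IE k : ~~ odd k -> (\int[lebm R]_x (x ^+ k * E x)%:E = (A * (2 * (k`!%:R / kap ^+ k.+1)))%:E)%E.
  move=> ok; rewrite EFinM -(expR_moment k0 ok) -ge0_integralZl_EFin//.
  - by apply: eq_integral => x _; rewrite -EFinM /E mulrCA.
  - by move=> x _; rewrite lee_fin mulr_ge0 ?expR_ge0// exprn_even_ge0.
  - by apply/measurable_EFinP; exact: mEk.
  - exact: ltW.
have IE0 : (\int[lebm R]_x (E x)%:E = m0%:E)%E.
  have := IE 0 isT; under eq_integral do rewrite expr0 mul1r.
  by move=> ->; congr EFin; rewrite /A fact0 expr1; field.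
have IE2 : (\int[lebm R]_x (x ^+ 2 * E x)%:E = m2%:E)%E.
  rewrite IE//; congr EFin; rewrite /A (_ : 2`!%:R = 2 :> R)// exprS k2.
  by field; rewrite ?kn ?m2n ?m0n.
have IE4 : (\int[lebm R]_x (x ^+ 4 * E x)%:E = (6 * m2 ^+ 2 / m0)%:E)%E.
  rewrite IE//; congr EFin; rewrite /A (_ : 4`!%:R = 24 :> R)//.
  rewrite exprS (_ : kap ^+ 4 = (kap ^+ 2) ^+ 2); last by rewrite -exprM.
  by rewrite k2; field; rewrite ?kn ?m2n ?m0n.
pose J := [set x | 0 <= x /\ E x <= z x].
(* On the nonnegative half-line [ln E] is affine, so log-concavity of [z] preserves [E <= z] between
   two points where it holds. *)
have Jconv x y w : J x -> J y -> x <= w <= y -> J w.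
  move=> [x0 xE] [y0 yE] /andP[xw wy].
  have w0 : 0 <= w by exact: le_trans xw.
  split => //; have [xy|xy] := eqVneq x y.
    by rewrite (_ : w = x)//; apply/eqP; rewrite eq_le xw andbT xy.
  have yx : 0 < y - x by rewrite subr_gt0 lt_neqAle xy (le_trans xw).
  have EE v : E v = expR (ln A - kap * `|v|) by rewrite /E expRD lnK// mulNr.
  pose t := (y - w) / (y - x).
  have t01 : 0 <= t <= 1.
    rewrite divr_ge0 ?(ltW yx) ?subr_ge0//=.
    by rewrite ler_pdivrMr// mul1r lerB.
  move: xE yE; rewrite !EE !ger0_norm// => xE yE.
  have := zlc t01 xE yE.
  have -> : t * x + (1 - t) * y = w by rewrite /t; field; rewrite gt_eqF.
  rewrite (_ : t * _ + _ = ln A - kap * (t * x + (1 - t) * y)); last by ring.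
  by rewrite (_ : t * x + (1 - t) * y = w)// /t; field; rewrite gt_eqF.
have Jb x : J x -> x <= b.
  move=> [x0 xE]; rewrite -(ger0_norm x0); apply: zb.
  by rewrite gt_eqF// (lt_le_trans _ xE).
have [p [q [p0 q0 sgn]]] : exists p q : R, [/\ 0 <= p, 0 <= q &
    forall x, 0 <= x -> (x ^+ 2 - p ^+ 2) * (x ^+ 2 - q ^+ 2) * (z x - E x) <= 0].
  have [[x1 Jx1]|Jempty] := pselect (exists x, J x); last first.
    (* If [z] lies below [E] everywhere on the half-line, the degenerate interval at 0 gives the
       factor [x ^+ 4], of the right sign. *)
    exists 0, 0; split => // x x0; rewrite -expr2.
    apply: mulr_ge0_le0; first exact: sqr_ge0.
    rewrite subr_le0 leNgt; apply/negP => h; apply: Jempty; exists x.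
    by split => //; exact: ltW.
  have supJ : has_sup J by split; [exists x1|exists b => x /Jb].
  have infJ : has_inf J by split; [exists x1|exists 0 => x []].
  have p0 : 0 <= inf J by apply: lb_le_inf; [exists x1|move=> x []].
  have pq : inf J <= sup J.
    apply: (@le_trans _ _ x1); first by apply: ge_inf => //; exact: infJ.2.
    by apply: ub_le_sup => //; exact: supJ.2.
  exists (inf J), (sup J); split => //; first exact: le_trans pq.
  move=> x x0.
  have outJ : ~ J x -> z x - E x <= 0.
    by move=> nJ; rewrite subr_le0 leNgt; apply/negP => h; apply: nJ; split => //; exact: ltW.
  have sq (u v : R) : 0 <= u -> 0 <= v -> (0 <= u ^+ 2 - v ^+ 2) = (v <= u).
    by move=> u0 v0; rewrite subr_ge0 ler_pXn2r ?nnegrE.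
  have sq' (u v : R) : 0 <= u -> 0 <= v -> (u ^+ 2 - v ^+ 2 <= 0) = (u <= v).
    by move=> u0 v0; rewrite subr_le0 ler_pXn2r ?nnegrE.
  have qq0 : 0 <= sup J by exact: le_trans pq.
  have [xp|px] := ltP x (inf J).
    apply: mulr_ge0_le0.
      by apply: mulr_le0; rewrite sq'// ltW// (lt_le_trans xp).
    apply: outJ => Jx; move: xp; rewrite ltNge; apply/negP; rewrite negbK.
    by apply: ge_inf => //; exact: infJ.2.
  have [qx|xq] := ltP (sup J) x.
    apply: mulr_ge0_le0.
      by apply: mulr_ge0; rewrite sq// ltW// (le_lt_trans pq).
    apply: outJ => Jx; move: qx; rewrite ltNge; apply/negP; rewrite negbK.
    by apply: ub_le_sup => //; exact: supJ.2.
  (* At an endpoint the product vanishes, so it does not matter whether [J] contains it. *)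
  have [->|xp] := eqVneq x (inf J); first by rewrite subrr !mul0r.
  have [->|xq'] := eqVneq x (sup J); first by rewrite subrr mulr0 mul0r.
  apply: mulr_le0_ge0; first by apply: mulr_ge0_le0; [rewrite sq|rewrite sq'].
  have d1 : 0 < x - inf J by rewrite subr_gt0 lt_neqAle eq_sym xp.
  have d2 : 0 < sup J - x by rewrite subr_gt0 lt_neqAle xq'.
  have [u Ju ux] := inf_adherent d1 infJ.
  have [v Jv vx] := sup_adherent d2 supJ.
  have [_] : J x; last by rewrite subr_ge0.
  apply: (Jconv u v) => //; rewrite addrC subrK in ux.
  by rewrite opprB addrC subrK in vx; rewrite !ltW.
have mX (k : nat) : measurable_fun setT (fun x : R => x ^+ k * z x).
  by apply: measurable_funM => //; exact: exprn_measurable.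
have mXE (k : nat) : measurable_fun setT (fun x : R => x ^+ k * E x).
  by apply: measurable_funM => //; exact: exprn_measurable.
pose s := p ^+ 2 + q ^+ 2; pose w := p ^+ 2 * q ^+ 2.
have s0 : 0 <= s by rewrite addr_ge0// sqr_ge0.
have w0 : 0 <= w by rewrite mulr_ge0// sqr_ge0.
have x2 (x : R) : 0 <= x ^+ 2 by exact: sqr_ge0.
have x4 (x : R) : 0 <= x ^+ 4 by exact: exprn_even_ge0.
have scale (f : R -> R) (k : R) : measurable_fun setT f -> (forall x, 0 <= f x) -> 0 <= k ->
    (k%:E * \int[lebm R]_x (f x)%:E = \int[lebm R]_x (k * f x)%:E)%E.
  move=> mf f0 k0'; rewrite -ge0_integralZl_EFin//.
  - by move=> x _; rewrite lee_fin.
  - exact/measurable_EFinP.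
have add (f g : R -> R) : measurable_fun setT f -> measurable_fun setT g ->
    (forall x, 0 <= f x) -> (forall x, 0 <= g x) ->
    (\int[lebm R]_x (f x)%:E + \int[lebm R]_x (g x)%:E = \int[lebm R]_x (f x + g x)%:E)%E.
  move=> mf mg f0 g0; rewrite -ge0_integralD//.
  - by move=> x _; rewrite lee_fin.
  - exact/measurable_EFinP.
  - by move=> x _; rewrite lee_fin.
  - exact/measurable_EFinP.
(* Expanding the product gives [x ^+ 4 - s * x ^+ 2 + w]. Terms of negative sign change sides, which
   leads to this combination for [(z, E)] and for [(E, z)]; the contributions of orders 0 and 2
   agree and cancel. *)
have lin (f g : R -> R) : measurable_fun setT f -> measurable_fun setT g ->
   (forall x, 0 <= f x) -> (forall x, 0 <= g x) ->
   (\int[lebm R]_x (x ^+ 4 * f x + (s * (x ^+ 2 * g x) + w * f x))%:E =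
    \int[lebm R]_x (x ^+ 4 * f x)%:E + (s%:E * \int[lebm R]_x (x ^+ 2 * g x)%:E + w%:E * \int[lebm R]_x (f x)%:E))%E.
  move=> mf mg f0 g0.
  have mf4 : measurable_fun setT (fun x : R => x ^+ 4 * f x).
    by apply: measurable_funM => //; exact: exprn_measurable.
  have mg2 : measurable_fun setT (fun x : R => x ^+ 2 * g x).
    by apply: measurable_funM => //; exact: exprn_measurable.
  rewrite (scale (fun x => x ^+ 2 * g x))//; last by move=> x; exact: mulr_ge0.
  rewrite (scale f)// (add _ _ (measurable_funM (measurable_cst s) mg2) (measurable_funM (measurable_cst w) mf)).
  - rewrite (add _ _ mf4 (measurable_funD (measurable_funM (measurable_cst s) mg2) (measurable_funM (measurable_cst w) mf)))//.
    + by move=> x; exact: mulr_ge0.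
    + by move=> x /=; apply: addr_ge0; apply: mulr_ge0 => //; apply: mulr_ge0.
  - by move=> x /=; apply: mulr_ge0 => //; apply: mulr_ge0.
  - by move=> x /=; apply: mulr_ge0.
have E0' x : 0 <= E x by exact: ltW.
have := lin z E mz mE z0 E0'; have := lin E z mE mz E0' z0.
rewrite z_m0 z_m2 IE0 IE2 IE4 => h1 h2.
rewrite -(@leeD2rE _ (s%:E * m2%:E + w%:E * m0%:E)%E); last by [].
rewrite -h1 -h2; apply: ge0_le_integral => //.
- move=> x _; rewrite lee_fin; apply: addr_ge0; first exact: mulr_ge0.
  by apply: addr_ge0; apply: mulr_ge0 => //; apply: mulr_ge0.
- apply/measurable_EFinP.
  exact (measurable_funD (mX 4) (measurable_funD (measurable_funM (measurable_cst s) (mXE 2)) (measurable_funM (measurable_cst w) mz))).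
- apply/measurable_EFinP.
  exact (measurable_funD (mXE 4) (measurable_funD (measurable_funM (measurable_cst s) (mX 2)) (measurable_funM (measurable_cst w) mE))).
move=> x _; rewrite lee_fin.
have := sgn _ (normr_ge0 x).
have -> : `|x| ^+ 2 = x ^+ 2 by rewrite real_normK// num_real.
rewrite ze (_ : E `|x| = E x); last by rewrite /E normr_id.
rewrite (_ : x ^+ 4 = x ^+ 2 * x ^+ 2); last by rewrite -exprD.
move: (x ^+ 2) (z x) (E x) => X Z0 Y; rewrite /s /w.
by move: (p ^+ 2) (q ^+ 2) => P Q; lra.
Qed.

End fourth_moment.

Section numerics.
Context {R : realType}.

(* This is bennett_lower solved for ln w, where w = 1 + v. *)
Lemma ln_ge_rational (w : R) : 1 <= w ->
  (9 * w ^+ 2 - 12 * w + 3) / (4 * w ^+ 2 + 4 * w - 2) <= ln w.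
Proof.
rewrite le_eqVlt => /predU1P[<-|w1].
  by rewrite ln1 expr1n (_ : _ / _ = 0)//; field.
pose den (x : R) := 4 * x ^+ 2 + 4 * x - 2.
pose num (x : R) := 9 * x ^+ 2 - 12 * x + 3.
pose D x := ln x - num x / den x.
have den0 x : 1 <= x -> 0 < den x.
  move=> x1; have : 1 <= x ^+ 2 by rewrite exprn_ege1.
  by rewrite /den; lra.
have dD (x : R) : 1 <= x -> is_derive x (1 : R) D ((x - 1) ^+ 3 * (4 * x - 1) / (x * (2 * x ^+ 2 + 2 * x - 1) ^+ 2)).
  move=> x1; have x0 : 0 < x by lra.
  have dx := den0 _ x1.
  have d1 : is_derive x (1 : R) (@ln R) x^-1 := is_derive1_ln x0.
  have X2 : is_derive x (1 : R) (fun x : R => x ^+ 2) (2 * x).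
    have := @is_deriveX R R id 2 x 1 1 (is_derive_id x 1).
    by rewrite exprfctE /GRing.scale/= mulr1.
  have dd : is_derive x (1 : R) den (8 * x + 4).
    have -> : den = (fun x : R => 4 *: x ^+ 2 + 4 *: x - 2) by [].
    by apply: is_derive_eq; rewrite /GRing.scale/=; ring.
  have dn : is_derive x (1 : R) num (18 * x - 12).
    have -> : num = (fun x : R => 9 *: x ^+ 2 - 12 *: x + 3) by [].
    by apply: is_derive_eq; rewrite /GRing.scale/=; ring.
  have dv : is_derive x (1 : R) (fun x => (den x)^-1) (- (den x) ^- 2 *: (8 * x + 4)).
    have [de1 de2] := dd; have dn0 : den x != 0 by rewrite gt_eqF.
    by apply: DeriveDef; [exact: derivableV|rewrite deriveV// de2].
  have -> : D = (fun x => ln x - num x * (den x)^-1) by [].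
  apply: is_derive_eq; rewrite /GRing.scale/= /num /den.
  rewrite /den in dx; field.
  by apply/and3P; split; rewrite gt_eqF//; lra.
have : D 1 <= D w.
  have [||c] := @MVT R D (fun x : R => (x - 1) ^+ 3 * (4 * x - 1) / (x * (2 * x ^+ 2 + 2 * x - 1) ^+ 2)) 1 w w1.
  - by move=> x; rewrite in_itv/= => /andP[x1 _]; exact: dD (ltW x1).
  - apply: derivable_within_continuous => x; rewrite in_itv/= => /andP[x1 _].
    by have [] := dD _ x1.
  rewrite in_itv/= => /andP[c1 _] e.
  rewrite -subr_ge0 e mulr_ge0//; last by rewrite subr_ge0 ltW.
  apply: divr_ge0; last by apply: mulr_ge0; [lra|exact: sqr_ge0].
  by apply: mulr_ge0; [apply: exprn_ge0; lra|lra].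
rewrite {1}/D ln1 {1}/num expr1n (_ : 9 * 1 - 12 * 1 + 3 = 0); last by ring.
by rewrite mul0r subrr /D subr_ge0.
Qed.

Lemma bennett_lower (v : R) : 0 <= v ->
  v ^+ 2 / (2 * (1 + v)) * (1 + 2 / 3 * ln (1 + v)) <= (1 + v) * ln (1 + v) - v.
Proof.
move=> v0; set w := 1 + v; have w1 : 1 <= w by rewrite /w; lra.
have := ln_ge_rational w1.
have w2 : 1 <= w ^+ 2 by rewrite exprn_ege1.
rewrite ler_pdivrMr; last by lra.
move: (ln w) => l hl.
have -> : v = w - 1 by rewrite /w; ring.
rewrite mulrAC ler_pdivrMr; last by lra.
nra.
Qed.

(** The doubled variance makes Bennett's function appear at [v], half of the ratio in the theorem,
    whose exponent is in terms of [2 * v]. The logarithms are related by [ln (1 + 2 * v) <= ln (1 +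
    v) + v / (1 + v)]. *)
Lemma bennett_exponent (v : R) : 0 <= v ->
  (2 * v) ^+ 2 / (4 * (1 + 2 * v)) * (1 + 2 / 3 * ln (1 + 2 * v)) <=
  2 * ((1 + v) * ln (1 + v) - v).
Proof.
move=> v0; have h := bennett_lower v0.
have l0 : 0 <= ln (1 + v) by apply: ln_ge0; lra.
have hl : ln (1 + 2 * v) <= ln (1 + v) + v / (1 + v).
  have -> : 1 + 2 * v = (1 + v) * (1 + v / (1 + v)) by field; lra.
  rewrite lnM ?posrE; [|lra|]; last by rewrite ltr_wpDr// divr_ge0; lra.
  rewrite lerD2l le_ln1Dx// (lt_le_trans (ltrN10 _))// divr_ge0; lra.
apply: le_trans (ler_wpM2l _ h) => //.
move: hl l0 {h}; set l := ln (1 + v); set l2 := ln (1 + 2 * v) => hl l0.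
have e1 : (2 * v) ^+ 2 / (4 * (1 + 2 * v)) = v ^+ 2 / (1 + 2 * v) by field; lra.
have e2 : 2 * (v ^+ 2 / (2 * (1 + v)) * (1 + 2 / 3 * l)) = v ^+ 2 * ((1 + 2 / 3 * l) / (1 + v)).
  by field; lra.
rewrite e1 e2 -mulrA ler_wpM2l ?sqr_ge0// mulrC ler_pdivrMr; last by lra.
rewrite [leRHS]mulrAC ler_pdivlMr; last by lra.
have : (1 + 2 / 3 * l2) * (1 + v) <= (1 + 2 / 3 * (l + v / (1 + v))) * (1 + v).
  by rewrite ler_wpM2r//; lra.
have -> : (1 + 2 / 3 * (l + v / (1 + v))) * (1 + v) = (1 + 2 / 3 * l) * (1 + v) + 2 / 3 * v.
  by field; lra.
have : 0 <= l * v by rewrite mulr_ge0.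
lra.
Qed.

(* e^z - 1 - z, divided by z^2, is nondecreasing. *)
Lemma expR_quadratic_bound (s y : R) : 0 < s -> y <= s ->
  expR y <= 1 + y + y ^+ 2 * ((expR s - 1 - s) / s ^+ 2).
Proof.
move=> s0 ys; have sn : s != 0 by rewrite gt_eqF.
pose th := y / s; have yE : y = th * s by rewrite /th divfK.
have th1 : th <= 1 by rewrite ler_pdivrMr// mul1r.
(* With [y = th * s] the claim is [0 <= P s], and [P 0 = 0]. The derivative of [P] is [th] times
   [th * (expR x - 1) - (expR (th * x) - 1)]: for [0 <= th <= 1] the second factor is nonnegative by
   convexity, for [th < 0] both factors are nonpositive. *)
pose P (x : R) := th ^+ 2 *: (expR x - 1 - x) - (expR (th * x) - 1 - th * x).
have dP (x : R) : is_derive x (1 : R) P (th ^+ 2 * (expR x - 1) - (th * expR (th * x) - th)).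
  have d1 : is_derive x (1 : R) (fun x : R => th * x) th.
    by apply: is_derive_eq; rewrite /GRing.scale/= mulr1.
  have d2 : is_derive (th * x) (1 : R) (@expR R) (expR (th * x)) by apply: is_derive_eq.
  have d3 : is_derive x (1 : R) (fun x => expR (th * x)) (th * expR (th * x)).
    by have := is_derive1_comp d2 d1; rewrite mulrC.
  by apply: is_derive_eq; rewrite /GRing.scale/=; ring.
have : P 0 <= P s.
  have [|c] := @MVT R P (fun x => th ^+ 2 * (expR x - 1) - (th * expR (th * x) - th)) 0 s s0.
  - by apply: derivable_within_continuous => x _; have [] := dP x.
  rewrite in_itv/= => /andP[c0 _] e.
  rewrite -subr_ge0 e mulr_ge0//; last by rewrite subr0 ltW.
  have -> : th ^+ 2 * (expR c - 1) - (th * expR (th * c) - th) =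
      th * (th * (expR c - 1) - (expR (th * c) - 1)) by ring.
  have [th0|th0] := leP 0 th.
    apply: mulr_ge0 => //; rewrite subr_ge0.
    have t01 : 0 <= th <= 1 by rewrite th0.
    have := expR_convex c 0 t01; rewrite mulr0 addr0 expR0; lra.
  apply: mulr_le0; first exact: ltW.
  have h1 := expR_ge1Dx (th * c); have h2 := expR_ge1Dx c.
  have : th * (expR c - 1) <= th * c by rewrite ler_wnM2l ?(ltW th0)//; lra.
  lra.
rewrite /P mulr0 expR0 /GRing.scale/= -yE.
have -> : y ^+ 2 * ((expR s - 1 - s) / s ^+ 2) = th ^+ 2 * (expR s - 1 - s).
  by rewrite /th expr_div_n; ring.
lra.
Qed.

End numerics.

Section coordinate_moments.
Context {R : realType}.

Lemma measurable_tnthX n (i : 'I_n) k :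
  measurable_fun setT (fun u : euclid R n => (tnth u i : R) ^+ k).
Proof.
have h := measurableT_comp (@exprn_measurable R setT k)
  (@measurable_tnth _ (measurableTypeR R) n i); exact h.
Qed.

(** The head coordinate has marginal density [V (1 - phi x)], which is even and log-concave. Any
    other coordinate becomes the head once those before it are absorbed into the weight. *)
Lemma coordinate_fourth_moment n (phis : 'I_n -> R -> R) (W : R -> R) (i : 'I_n) (m2 : R) :
  (forall j, gauge (phis j)) -> weight W -> 0 < wvol phis W 1 -> 0 < m2 ->
  wint phis W (fun u => (tnth u i : R) ^+ 2) 1 = m2%:E ->
  (wint phis W (fun u => (tnth u i : R) ^+ 4)%R 1 <= (6 * m2 ^+ 2 / wvol phis W 1)%:E)%E.
Proof.
move=> + + + m20; elim: n phis W i => [|n ih] phis W i; first by case: i.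
move=> gp wW m00.
have gt j : gauge (tailf phis j) by exact: gp.
have gphi := gp ord0.
have even0 (x : R) k : ~~ odd k -> 0 <= x ^+ k by move=> ok; exact: exprn_even_ge0.
case: (unliftP ord0 i) => [j ->|->] hm2.
  have := ih (tailf phis) (wtr (phis ord0) W) j gt (weight_wtr gphi wW).
  rewrite -wvol_wtr// => /(_ m00) h.
  have beh k : ~~ odd k -> wint phis W (fun u => (tnth u (lift ord0 j) : R) ^+ k) 1 =
      wint (tailf phis) (wtr (phis ord0) W) (fun u => (tnth u j : R) ^+ k) 1.
    move=> ok; apply: wint_behead => //.
    - exact: measurable_tnthX.
    - by move=> u; exact: even0.
    - exact: measurable_tnthX.
    - by move=> x u; rewrite tnth_tconsS.
  rewrite (beh 4)//; apply: h; rewrite -(beh 2)//.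
pose V := wvol (tailf phis) W.
have wV : weight V by exact: weight_wvol.
pose z x := V (1 - phis ord0 x).
have mom k : ~~ odd k -> wint phis W (fun u => (tnth u ord0 : R) ^+ k) 1 =
    (\int[lebm R]_x (x ^+ k * z x)%:E)%E.
  move=> ok; rewrite wintS//.
  - apply: eq_integral => x _; rewrite EFinM /z /V -wvolE// -wintZ//; last exact: even0.
    by congr (wint _ _ _ _); apply/funext => u; rewrite mulr1 tnth_tcons0.
  - exact: measurable_tnthX.
  - by move=> u; exact: even0.
rewrite (mom 4)//; rewrite (mom 2)// in hm2.
have [b hb] := gauge_bounded gphi 1.
apply: (@fourth_moment_log_concave _ z b) => //.
- exact: (measurable_wtr_fun gphi wV _).
- by move=> x; exact: (weight_ge0 wV _).
- by move=> x /(wtr_fun_support wV)/hb.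
- by move=> x; rewrite /z gauge_norm.
- move=> t x y c d t01 hc hd.
  have px w e : expR e <= z w -> phis ord0 w <= 1.
    move=> h; apply: (wtr_fun_support wV); rewrite gt_eqF//.
    exact: lt_le_trans (expR_gt0 _) h.
  have le1 w : 1 - phis ord0 w <= 1 by rewrite lerBlDr lerDl gauge_ge0.
  apply: (le_trans (weight_log_concave wV t01 (le1 x) (le1 y) hc hd)).
  apply: (weight_mono wV).
  have := gauge_convex gphi t01 (px _ _ hc) (px _ _ hd).
  lra.
- by rewrite -wtrE.
Qed.

(* Negative coefficients are moved to the left so that all integrands are
   nonnegative. *)
Lemma wint_quartic_bound n (phis : 'I_n -> R -> R) (W : R -> R) (i : 'I_n)
    (F : euclid R n -> R) (m2 m4 a1 a2 b0 b1 b2 : R) :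
  (forall j, gauge (phis j)) -> weight W -> wvol phis W 1 = 1 ->
  wint phis W (fun u => (tnth u i : R) ^+ 2) 1 = m2%:E ->
  (wint phis W (fun u => (tnth u i : R) ^+ 4)%R 1 <= m4%:E)%E ->
  measurable_fun setT F -> (forall u, 0 <= F u) ->
  0 <= a1 -> 0 <= a2 -> 0 <= b0 -> 0 <= b1 -> 0 <= b2 ->
  (forall u, F u + (a1 + a2 * (tnth u i : R) ^+ 2) <=
     b0 + (b1 * (tnth u i : R) ^+ 2 + b2 * (tnth u i : R) ^+ 4)) ->
  (wint phis W F 1 <= (b0 + (b1 * m2 + b2 * m4) - (a1 + a2 * m2))%:E)%E.
Proof.
move=> gp wW V1 hm2 hm4 mF F0 a10 a20 b00 b10 b20 hF.
have m2' : measurable_fun setT (fun u : euclid R n => (tnth u i : R) ^+ 2) by exact: measurable_tnthX.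
have m4' : measurable_fun setT (fun u : euclid R n => (tnth u i : R) ^+ 4) by exact: measurable_tnthX.
have p2 (u : euclid R n) : 0 <= (tnth u i : R) ^+ 2 by exact: sqr_ge0.
have p4 (u : euclid R n) : 0 <= (tnth u i : R) ^+ 4 by exact: exprn_even_ge0.
have mZ (c : R) (f : euclid R n -> R) : measurable_fun setT f -> measurable_fun setT (fun u => c * f u).
  by move=> mf; apply: measurable_funM => //.
have cstE (c : R) : 0 <= c -> wint phis W (fun=> c) 1 = c%:E.
  move=> c0; have -> : (fun=> c) = (fun u : euclid R n => c * (cst 1 : euclid R n -> R) u).
    by apply/funext => u; rewrite mulr1.
  by rewrite wintZ// wvolE// V1 mule1.
have ma : measurable_fun setT (fun u : euclid R n => a1 + a2 * (tnth u i : R) ^+ 2).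
  by apply: measurable_funD => //; exact: mZ.
have mb : measurable_fun setT (fun u : euclid R n => b1 * (tnth u i : R) ^+ 2 + b2 * (tnth u i : R) ^+ 4).
  by apply: measurable_funD; exact: mZ.
have pa u : 0 <= a1 + a2 * (tnth u i : R) ^+ 2 by rewrite addr_ge0// mulr_ge0.
have pb u : 0 <= b1 * (tnth u i : R) ^+ 2 + b2 * (tnth u i : R) ^+ 4 by rewrite addr_ge0// mulr_ge0.
have ia : wint phis W (fun u => a1 + a2 * (tnth u i : R) ^+ 2) 1 = (a1 + a2 * m2)%:E.
  rewrite wintD//; [|exact: mZ|by move=> u; rewrite mulr_ge0].
  by rewrite cstE// wintZ// hm2.
have ib : (wint phis W (fun u => b0 + (b1 * (tnth u i : R) ^+ 2 + b2 * (tnth u i : R) ^+ 4))%R 1 <=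
    (b0 + (b1 * m2 + b2 * m4))%:E)%E.
  rewrite wintD// cstE//.
  rewrite wintD//; [|exact: mZ|by move=> u; rewrite mulr_ge0|exact: mZ|by move=> u; rewrite mulr_ge0].
  rewrite !wintZ// hm2 EFinD leeD2l// EFinD leeD2l//.
  by rewrite EFinM lee_wpmul2l.
rewrite EFinB leeBrDr// -ia -wintD//.
apply: le_trans ib; apply: le_wint => //.
- exact: measurable_funD.
- by apply: measurable_funD.
- by move=> u; rewrite addr_ge0.
Qed.

End coordinate_moments.

(** * The one-sided tail bound *)

Section exponential_test_function.
Context {R : realType}.
Variable l : R.
Hypothesis l0 : 0 < l.

(* The linear correction puts the minimum at 0, so that cutting the argument off
   at 0 does not increase the value; the factor 2 lost in expR_le_test is the one
   of the theorem. *)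
Definition expR_test (z : R) : R := expR (l * z) - l * z.

Lemma expR_test_ge1 z : 1 <= expR_test z.
Proof. by rewrite lerBrDr expR_ge1Dx. Qed.

Lemma expR_test_ge0 z : 0 <= expR_test z.
Proof. exact: le_trans ler01 (expR_test_ge1 z). Qed.

Lemma expR_test0 : expR_test 0 = 1.
Proof. by rewrite /expR_test mulr0 expR0 subr0. Qed.

Lemma expR_test_incr (z z' d : R) : 0 <= d -> z <= z' ->
  expR_test (z + d) - expR_test z <= expR_test (z' + d) - expR_test z'.
Proof.
move=> d0 zz.
have inc x : expR_test (x + d) - expR_test x = expR (l * x) * (expR (l * d) - 1) - l * d.
  by rewrite /expR_test !mulrDr expRD; ring.
rewrite !inc lerD2r ler_wpM2r//.
  by rewrite subr_ge0 -[leLHS]expR0 ler_expR mulr_ge0// ltW.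
by rewrite ler_expR ler_pM2l.
Qed.

Lemma expR_test_mono (z z' : R) : 0 <= z -> z <= z' -> expR_test z <= expR_test z'.
Proof.
move=> z0 zz; have d0 : 0 <= z' - z by rewrite subr_ge0.
have := expR_test_incr d0 z0; rewrite add0r (_ : z + (z' - z) = z'); last by ring.
move=> h.
by rewrite -subr_ge0 (le_trans _ h)// subr_ge0 expR_test0 expR_test_ge1.
Qed.

Lemma expR_test_max (z : R) : expR_test (Num.max 0 z) <= expR_test z.
Proof.
have [z0|z0] := leP 0 z => //.
by rewrite expR_test0 expR_test_ge1.
Qed.

(** Convexity of the test function after cutting its argument off at 0: it is constant up to its
    minimum at 0 and convex increasing from there. *)
Lemma expR_test_max_incr (z z' d : R) : 0 <= d -> z <= z' ->
  expR_test (Num.max 0 (z + d)) - expR_test (Num.max 0 z) <=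
  expR_test (Num.max 0 (z' + d)) - expR_test (Num.max 0 z').
Proof.
move=> d0 zz; have [z0|z0] := leP 0 z.
  have z'0 : 0 <= z' by exact: le_trans zz.
  by rewrite !max_r ?addr_ge0//; exact: expR_test_incr.
have [z'0|z'0] := leP 0 z'; last first.
  rewrite lerD2r; apply: expR_test_mono; first by rewrite le_max lexx.
  by rewrite le_max2// lerD2r.
rewrite (@max_r _ _ 0 (z' + d)) ?addr_ge0//.
have := expR_test_incr d0 z'0; rewrite add0r; apply: le_trans.
rewrite lerD2r; apply: expR_test_mono; first by rewrite le_max lexx.
by rewrite ge_max d0/= gerDr ltW.
Qed.

Lemma measurable_expR_test : measurable_fun setT expR_test.
Proof.
apply: measurable_funB; last by apply: measurable_funM.
by apply: measurableT_comp; [exact: measurable_expR|apply: measurable_funM].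
Qed.

(** With [w = l z] the claim is [2 w <= e^w], which follows from [e^w >= (1 + w / 2)^2] and
    [(1 + w / 2)^2 - 2 w = (w / 2 - 1)^2]. *)
Lemma expR_le_test (z : R) : 0 <= z -> expR (l * z) <= 2 * expR_test z.
Proof.
move=> z0; rewrite /expR_test.
suff : 2 * (l * z) <= expR (l * z) by lra.
have -> : expR (l * z) = expR (l * z / 2) ^+ 2.
  by rewrite -expRM_natl; congr expR; field.
have x0 : 0 <= l * z by rewrite mulr_ge0// ltW.
have h := expR_ge1Dx (l * z / 2).
apply: (@le_trans _ _ ((1 + l * z / 2) ^+ 2)).
  by rewrite -subr_ge0 (_ : _ - _ = (l * z / 2 - 1) ^+ 2) ?sqr_ge0//; field.
rewrite ler_pXn2r// nnegrE; [|exact: expR_ge0].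
by rewrite addr_ge0// divr_ge0.
Qed.

End exponential_test_function.

Section one_sided.
Context {R : realType}.
Variables (n : nat) (phis : 'I_n -> R -> R) (W : R -> R).
Hypothesis gp : forall i, gauge (phis i).
Hypothesis wW : weight W.
Hypothesis V1 : wvol phis W 1 = 1.
Variables (L a t sg : R).
Hypotheses (L0 : 0 < L) (a0 : 0 < a) (t0 : 0 < t).
Hypothesis sgP : sg = 1 \/ sg = -1.
Hypothesis m2 : forall i, wint phis W (fun u => (tnth u i : R) ^+ 2) 1 = (L ^+ 2)%:E.

(** Only large positive values are cut: Bennett's argument needs an upper bound on the summands, and
    the one-sided cut keeps them monotone in [|x|]. *)
Definition truncated (x : R) : R := Num.min (sg * (x ^+ 2 - L ^+ 2)) a.

Let b : R := 5 * L ^+ 4.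
Let b0 : 0 < b. Proof. by rewrite mulr_gt0// exprn_gt0. Qed.
Let v : R := a * t / b / 2.
Let v0 : 0 < v. Proof. by rewrite !divr_gt0// mulr_gt0. Qed.
(* The minimizer of the exponent 2 n b (e^(l a) - 1 - l a) / a^2 - l n t. *)
Let l : R := ln (1 + v) / a.
Let l0 : 0 < l. Proof. by rewrite divr_gt0// ln_gt0// ltrDl. Qed.
Let kap : R := (expR (l * a) - 1 - l * a) / a ^+ 2.

Let kap0 : 0 <= kap.
Proof. by rewrite divr_ge0 ?sqr_ge0//; have := expR_ge1Dx (l * a); lra. Qed.

Let sg2 : sg ^+ 2 = 1. Proof. by case: sgP => ->; rewrite ?sqrrN expr1n. Qed.

Lemma measurable_truncated : measurable_fun setT truncated.
Proof.
apply: measurable_minr => //; apply: measurable_funM => //.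
by apply: measurable_funB => //; exact: exprn_measurable.
Qed.

Lemma truncated_mono : (forall x x', `|x'| <= `|x| -> truncated x' <= truncated x) \/
  (forall x x', `|x'| <= `|x| -> truncated x <= truncated x').
Proof.
have sq (x x' : R) : `|x'| <= `|x| -> x' ^+ 2 <= x ^+ 2.
  move=> h; rewrite -(@real_normK _ x') ?num_real// -(@real_normK _ x) ?num_real//.
  by rewrite ler_pXn2r ?nnegrE.
case: sgP => s1; [left|right] => x x' /sq h; rewrite /truncated s1 le_min2//; lra.
Qed.

Lemma truncated_le x : truncated x <= a.
Proof. by rewrite ge_min lexx orbT. Qed.

Lemma truncated_sqr x : truncated x ^+ 2 <= (x ^+ 2 - L ^+ 2) ^+ 2.
Proof.
have -> : (x ^+ 2 - L ^+ 2) ^+ 2 = (sg * (x ^+ 2 - L ^+ 2)) ^+ 2 by rewrite exprMn sg2 mul1r.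
rewrite /truncated; set q := sg * _.
have [qa|aq] := leP q a => //.
rewrite ler_pXn2r ?nnegrE ?ltW//.
exact: lt_trans aq.
Qed.

(** [expR_quadratic_bound] at [s = l * a] controls [e^(l y)]. Since [m >= 0], the resulting
    coefficient of [y] is nonnegative, so [y] may be replaced by the larger untruncated variable,
    which has mean 0. *)
Lemma truncated_test_le (x m : R) : 0 <= m ->
  expR_test l (Num.max 0 (truncated x + m)) <=
  expR_test l m + l * (expR (l * m) - 1) * (sg * (x ^+ 2 - L ^+ 2)) +
  kap * expR (l * m) * (x ^+ 2 - L ^+ 2) ^+ 2.
Proof.
move=> m0; apply: le_trans (expR_test_max l _) _.
set y := truncated x; rewrite /expR_test mulrDr expRD.
have la0 : 0 < l * a by rewrite mulr_gt0.
have lya : l * y <= l * a by rewrite ler_pM2l// truncated_le.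
have := expR_quadratic_bound la0 lya.
have -> : (l * y) ^+ 2 * ((expR (l * a) - 1 - l * a) / (l * a) ^+ 2) = y ^+ 2 * kap.
  by rewrite /kap; field; rewrite !gt_eqF.
move=> h1; have lm0 : 0 <= l * m by rewrite mulr_ge0// ltW.
have e1 : 1 <= expR (l * m) by rewrite -[leLHS]expR0 ler_expR.
have yq : y <= sg * (x ^+ 2 - L ^+ 2) by rewrite ge_min lexx.
have y2 := truncated_sqr x; rewrite -/y in y2.
have h2 : expR (l * y) * expR (l * m) <= (1 + l * y + y ^+ 2 * kap) * expR (l * m).
  by rewrite ler_wpM2r// expR_ge0.
have h3 : l * (expR (l * m) - 1) * y <= l * (expR (l * m) - 1) * (sg * (x ^+ 2 - L ^+ 2)).
  by apply: ler_wpM2l => //; rewrite mulr_ge0 ?(ltW l0)// subr_ge0.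
have h4 : kap * expR (l * m) * y ^+ 2 <= kap * expR (l * m) * (x ^+ 2 - L ^+ 2) ^+ 2.
  by apply: ler_wpM2l => //; rewrite mulr_ge0 ?expR_ge0.
lra.
Qed.

(** After integration the linear term of [truncated_test_le] disappears and the quadratic one is at
    most [kap * b * e^(l m)]; [expR_le_test] bounds this by [2 * kap * b] times the test function at
    [m], as [excess_moment] requires. *)
Lemma truncated_moment i (m : R) : 0 <= m ->
  (wint phis W (fun u => expR_test l (Num.max 0 (truncated (tnth u i) + m)))%R 1 <=
   ((1 + 2 * kap * b) * expR_test l m)%:E)%E.
Proof.
move=> m0; have L2 : 0 < L ^+ 2 by rewrite exprn_gt0.
have hm4 : (wint phis W (fun u => (tnth u i : R) ^+ 4)%R 1 <= (6 * L ^+ 4)%:E)%E.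
  have := @coordinate_fourth_moment R n phis W i (L ^+ 2) gp wW.
  rewrite V1 => /(_ ltr01 L2 (m2 i)) /le_trans; apply.
  by rewrite divr1 -exprM lee_fin.
have mF : measurable_fun setT (fun u : euclid R n => expR_test l (Num.max 0 (truncated (tnth u i) + m))).
  have h0 : measurable_fun setT (fun x => expR_test l (Num.max 0 (truncated x + m))).
    apply: measurableT_comp; first exact: measurable_expR_test.
    apply: measurable_maxr => //; apply: measurable_funD => //.
    exact: measurable_truncated.
  have h := measurableT_comp h0 (@measurable_tnth _ (measurableTypeR R) n i); exact h.
have lm0 : 0 <= l * m by rewrite mulr_ge0// ltW.
have e1 : 1 <= expR (l * m) by rewrite -[leLHS]expR0 ler_expR.
pose be := l * (expR (l * m) - 1).
have be0 : 0 <= be by rewrite mulr_ge0 ?(ltW l0)// subr_ge0.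
pose ka := kap * expR (l * m).
have ka0 : 0 <= ka by rewrite mulr_ge0// expR_ge0.
have g0 := expR_test_ge0 l m.
have fin : expR_test l m + 5 * ka * L ^+ 4 <= (1 + 2 * kap * b) * expR_test l m.
  have := expR_le_test l0 m0; rewrite /ka /b => h.
  have := ler_wpM2l (mulr_ge0 kap0 (ltW b0)) h; rewrite /b; lra.
have L40 : 0 <= L ^+ 4 by rewrite exprn_ge0// ltW.
have F0 u : 0 <= expR_test l (Num.max 0 (truncated (tnth u i : R) + m)) by exact: expR_test_ge0.
have bnd (u : euclid R n) := truncated_test_le (tnth u i) m0.
have L4E : L ^+ 4 = L ^+ 2 * L ^+ 2 by rewrite -exprD.
have x4E (x : R) : x ^+ 4 = x ^+ 2 * x ^+ 2 by rewrite -exprD.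
(* The sign decides on which side of [wint_quartic_bound] the terms with coefficient [be] have to
   stand. *)
case: sgP => s1.
  have := @wint_quartic_bound R n phis W i _ (L ^+ 2) (6 * L ^+ 4) (be * L ^+ 2) (2 * ka * L ^+ 2)
    (expR_test l m + ka * L ^+ 4) be ka gp wW V1 (m2 i) hm4 mF F0.
  have c1 : 0 <= be * L ^+ 2 by rewrite mulr_ge0// ltW.
  have c2 : 0 <= 2 * ka * L ^+ 2 by apply: mulr_ge0; [rewrite mulr_ge0|exact: ltW].
  have c3 : 0 <= expR_test l m + ka * L ^+ 4 by rewrite addr_ge0// mulr_ge0.
  move=> /(_ c1 c2 c3 be0 ka0) h; apply: le_trans (h _) _.
    move=> u; have := bnd u; rewrite s1 -/be -/ka !x4E.
    by move: (tnth u i : R) => x; lra.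
  rewrite lee_fin (le_trans _ fin)// L4E; lra.
have := @wint_quartic_bound R n phis W i _ (L ^+ 2) (6 * L ^+ 4) 0 (be + 2 * ka * L ^+ 2)
  (expR_test l m + be * L ^+ 2 + ka * L ^+ 4) 0 ka gp wW V1 (m2 i) hm4 mF F0.
have c2 : 0 <= be + 2 * ka * L ^+ 2.
  by apply: addr_ge0 => //; apply: mulr_ge0; [rewrite mulr_ge0|exact: ltW].
have c3 : 0 <= expR_test l m + be * L ^+ 2 + ka * L ^+ 4.
  by apply: addr_ge0; [apply: addr_ge0 => //; apply: mulr_ge0 => //; exact: ltW|exact: mulr_ge0].
move=> /(_ (lexx 0) c2 c3 (lexx 0) ka0) h; apply: le_trans (h _) _.
  move=> u; have := bnd u; rewrite s1 -/be -/ka !x4E.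
  by move: (tnth u i : R) => x; lra.
rewrite lee_fin (le_trans _ fin)// L4E; lra.
Qed.

(** Markov's inequality for the test function at [n t], combined with
    [1 + 2 * kap * b <= expR (2 * kap * b)]. The factor 2 comes from [expR_le_test] at [n t]. *)
Lemma one_sided_tail_bound :
  (wint phis W (\1_[set u : euclid R n | (n%:R * t < excess truncated u)%R]) 1 <=
   (2 * expR (- (n%:R * t ^+ 2 / (4 * (a * t + 5 * L ^+ 4))
                      * (1 + 2 / 3 * ln (1 + a * t / (5 * L ^+ 4))))))%:E)%E.
Proof.
have c0 : 0 <= 1 + 2 * kap * b.
  by apply: addr_ge0 => //; apply: mulr_ge0; [rewrite mulr_ge0|exact: ltW].
have nt0 : 0 <= n%:R * t by rewrite mulr_ge0// ltW.
have := @excess_moment R truncated (expR_test l) a measurable_truncated truncated_le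
  (ltW a0) (expR_test_ge0 l) (expR_test_mono l0) (measurable_expR_test l)
  (expR_test_max_incr l0) truncated_mono n phis W (1 + 2 * kap * b) gp wW c0.
rewrite V1 expR_test0 !mulr1.
have hyp i m : 0 <= m -> (wint phis W (fun u => expR_test l (Num.max 0 (truncated (tnth u i) + m)))%R 1 <=
    ((1 + 2 * kap * b) * expR_test l m * 1)%:E)%E.
  by move=> m0; rewrite mulr1; exact: truncated_moment.
move=> /(_ hyp) mom.
have mex : measurable_fun setT (fun u : euclid R n => expR_test l (excess truncated u)).
  apply: measurableT_comp; first exact: measurable_expR_test.
  exact: measurable_excess measurable_truncated n.
have mI : measurable [set u : euclid R n | (n%:R * t < excess truncated u)%R].
  have -> : [set u : euclid R n | (n%:R * t < excess truncated u)%R] =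
     setT `&` (fun u : euclid R n => excess truncated u) @^-1` `](n%:R * t), +oo[%classic.
    by apply/seteqP; split => u /=; rewrite in_itv/= andbT => // -[].
  have h := @measurable_excess R truncated measurable_truncated n measurableT _ (measurable_itv `](n%:R * t), +oo[).
  exact h.
have G0 : 0 < expR_test l (n%:R * t) by exact: lt_le_trans ltr01 (expR_test_ge1 _ _).
have mark : ((expR_test l (n%:R * t))%:E * wint phis W (\1_[set u : euclid R n | (n%:R * t < excess truncated u)%R]) 1 <=
    ((1 + 2 * kap * b) ^+ n)%:E)%E.
  apply: le_trans mom; rewrite -wintZ//; last exact: ltW.
  apply: le_wint => //.
  - by apply: measurable_funM => //; exact: measurable_indic.
  - by move=> u; rewrite mulr_ge0// ltW.
  - move=> u; rewrite indicE; have [|_] := boolP (u \in _); last first.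
      by rewrite mulr0 expR_test_ge0.
    by rewrite inE/= => h; rewrite mulr1; apply: expR_test_mono => //; exact: ltW.
have I0 : (0 <= wint phis W (\1_[set u : euclid R n | (n%:R * t < excess truncated u)%R]) 1)%E.
  by apply: wint_ge0.
move: mark I0; move: (wint phis W (\1_[set u : euclid R n | (n%:R * t < excess truncated u)%R]) 1).
move=> [p| |] //; last first.
  by rewrite gt0_muley ?lte_fin// leye_eq.
- rewrite -EFinM !lee_fin => mark p0.
  have cn : (1 + 2 * kap * b) ^+ n <= expR (n%:R * (2 * kap * b)).
    by rewrite expRM_natl lerXn2r ?nnegrE ?expR_ge0 ?expR_ge1Dx.
  have h1 : expR (l * (n%:R * t)) * p <= 2 * expR (n%:R * (2 * kap * b)).
    apply: (@le_trans _ _ (2 * (expR_test l (n%:R * t) * p))).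
      by rewrite [leRHS]mulrA ler_wpM2r// expR_le_test.
    by rewrite ler_pM2l// (le_trans mark).
  have h2 : p <= 2 * expR (n%:R * (2 * kap * b) - l * (n%:R * t)).
    by rewrite expRD expRN mulrA ler_pdivlMr ?expR_gt0// mulrC.
  apply: (le_trans h2); rewrite ler_pM2l// ler_expR lerNr.
  (* The exponent at the chosen [l] is Bennett's function for total variance [2 n b], evaluated at
     [v = a t / (2 b)]. *)
  have -> : - (n%:R * (2 * kap * b) - l * (n%:R * t)) = n%:R * (b / a ^+ 2) * (2 * ((1 + v) * ln (1 + v) - v)).
    have v1 : 0 < 1 + v by rewrite addr_gt0.
    rewrite /kap /l divfK ?gt_eqF// lnK ?posrE//.
    have -> : t = 2 * v * b / a by rewrite /v; field; rewrite !gt_eqF.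
    by field; rewrite gt_eqF.
  have := bennett_exponent (ltW v0).
  have u2 : a * t / (5 * L ^+ 4) = 2 * v by rewrite /v /b; field; rewrite !gt_eqF.
  rewrite u2.
  have -> : n%:R * t ^+ 2 / (4 * (a * t + 5 * L ^+ 4)) = n%:R * (b / a ^+ 2) * ((2 * v) ^+ 2 / (4 * (1 + 2 * v))).
    rewrite -/b /v; field.
    by apply/and3P; split; rewrite gt_eqF// addr_gt0// mulr_gt0.
  move=> h; rewrite -mulrA ler_wpM2l// mulr_ge0// divr_ge0 ?sqr_ge0// ltW//.
Qed.

End one_sided.

(** * Orlicz balls *)

Section young_gauge.
Context {R : realType}.

(* Infinite values of f are replaced by 1 + |x|, which keeps {f <= 1} and is large
   at infinity. *)
Definition young_gauge (f : R -> \bar R) (x : R) : R :=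
  if (f `|x|%R <= 1)%E then fine (f `|x|%R) else 1 + `|x|.

Lemma young_gauge_le1 f x : young_function f -> young_gauge f x <= 1 ->
  (f `|x|%R <= 1)%E /\ (young_gauge f x)%:E = f `|x|%R.
Proof.
move=> yf; have [f_ge0 _ f0 _ _] := yf.
rewrite /young_gauge; case: ifPn => [fx _|nfx x1].
  by split => //; rewrite fineK// ge0_fin_numE ?f_ge0// (le_lt_trans fx)// ltry.
exfalso; have x0 : `|x| = 0 by apply/eqP; rewrite eq_le normr_ge0 andbT; lra.
by move: nfx; rewrite x0 f0 lee_fin ler01.
Qed.

Lemma young_gaugeE f x : young_function f -> (f `|x|%R <= 1)%E ->
  (young_gauge f x)%:E = f `|x|%R.
Proof.
move=> yf fx; have [f_ge0 _ _ _ _] := yf.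
by rewrite /young_gauge fx fineK// ge0_fin_numE ?f_ge0// (le_lt_trans fx)// ltry.
Qed.

Lemma young_gauge_ge0 f x : young_function f -> 0 <= young_gauge f x.
Proof.
move=> [f_ge0 _ _ _ _]; rewrite /young_gauge; case: ifPn => _.
  by rewrite fine_ge0// f_ge0.
by rewrite addr_ge0.
Qed.

(** Convexity and [f 0 = 0] force linear growth beyond a point [x0] where [f] is at least some
    [d > 0], namely [f x >= d x / x0]; if [f x0] is infinite, [d = 1] serves. *)
Lemma young_gauge_bounded f : young_function f ->
  exists c : R, forall x : R, (f `|x|%R <= 1)%E -> `|x| <= c.
Proof.
move=> yf; have [f_ge0 f_conv f0 [x0 x00 fx0] _] := yf.
have x0p : 0 < x0.
  by rewrite lt_def x00 andbT; apply: contra_neq fx0 => ->.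
have [d d0 df] : exists2 d : R, 0 < d & (d%:E <= f x0)%E.
  have := f_ge0 _ x00; move: fx0; case: (f x0) => [y| |] //.
    rewrite eqe lee_fin => y0 y1; exists y => //.
    by rewrite lt_def y0.
  by move=> _ _; exists 1 => //; rewrite leey.
exists (Num.max x0 (x0 / d)) => x fx; rewrite le_max.
have [//|xx0] := leP `|x| x0 => /=.
have xp : 0 < `|x| by exact: lt_trans xx0.
have t01 : 0 <= x0 / `|x| <= 1.
  by rewrite divr_ge0//= ler_pdivrMr// mul1r ltW.
have := f_conv (x0 / `|x|) `|x| 0 t01 (normr_ge0 _) (lexx _).
rewrite f0 mule0 adde0 mulr0 addr0 divfK ?gt_eqF// => h.
have : (d%:E <= (x0 / `|x|)%:E * 1)%E.
  apply: (le_trans df); apply: (le_trans h); apply: lee_wpmul2l => //.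
  by rewrite lee_fin; case/andP: t01.
rewrite mule1 lee_fin ler_pdivlMr// => h1.
by rewrite ler_pdivlMr// mulrC.
Qed.

Lemma young_gaugeP f : young_function f -> gauge (young_gauge f).
Proof.
move=> yf; have [f_ge0 f_conv f0 _ _] := yf.
have mono := young_function_nondecreasing yf.
split.
- by rewrite /young_gauge normr0 f0 lee_fin ler01.
- move=> x y xy; rewrite /young_gauge.
  have fin z : (f `|z|%R <= 1)%E -> f `|z|%R \is a fin_num.
    by move=> fz; rewrite ge0_fin_numE ?f_ge0// (le_lt_trans fz)// ltry.
  have [fx|fx] := boolP (f `|x|%R <= 1)%E; have [fy|fy] := boolP (f `|y|%R <= 1)%E.
  + by apply: fine_le; [exact: fin|exact: fin|exact: mono].
  + apply: (@le_trans _ _ 1); last by rewrite lerDl.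
    by rewrite -lee_fin fineK// fin.
  + by move: fx; rewrite (le_trans _ fy)// mono.
  + by rewrite lerD2l.
- move=> t x y t01 /(young_gauge_le1 yf)[fx ex] /(young_gauge_le1 yf)[fy ey].
  have /andP[t0 t1] := t01; have t1' : 0 <= 1 - t by rewrite subr_ge0.
  have h : (f `|t * x + (1 - t) * y|%R <= (t * young_gauge f x + (1 - t) * young_gauge f y)%R%:E)%E.
    rewrite EFinD !EFinM ex ey.
    apply: le_trans (f_conv t `|x| `|y| t01 (normr_ge0 _) (normr_ge0 _)).
    apply: mono => //; apply: (le_trans (ler_normD _ _)).
    by rewrite !normrM (ger0_norm t0) (ger0_norm t1').
  have h1 : t * young_gauge f x + (1 - t) * young_gauge f y <= 1.
    have : young_gauge f x <= 1 by rewrite -lee_fin ex.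
    move=> /(ler_wpM2l t0) hx.
    have : young_gauge f y <= 1 by rewrite -lee_fin ey.
    move=> /(ler_wpM2l t1') hy; lra.
  rewrite -lee_fin young_gaugeE//; apply: (le_trans h).
  by rewrite lee_fin.
- move=> v; have [c hc] := young_gauge_bounded yf.
  exists (Num.max c (v - 1)) => x; rewrite /young_gauge le_max.
  case: ifPn => [/hc -> //|_ h].
  by rewrite [X in _ || X](_ : _ = true) ?orbT//; apply/idP; lra.
Qed.

(** All terms are nonnegative, so membership on either side makes each single term at most 1, where
    [f] and its gauge agree. *)
Lemma orlicz_ball_gauge n (f : 'I_n -> R -> \bar R) :
  (forall i, young_function (f i)) ->
  orlicz_ball f = [set u | gsum (fun i => young_gauge (f i)) u <= 1].
Proof.
move=> yf; have f_ge0 i x : (0 <= f i `|x|%R)%E by have [h _ _ _ _] := yf i; exact: h.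
apply/seteqP; split => u; rewrite /orlicz_ball /gsum /= => h.
  rewrite -lee_fin -sumEFin (le_trans _ h)// le_eqVlt; apply/orP; left; apply/eqP.
  apply: eq_bigr => i _; apply: young_gaugeE => //; apply: le_trans h.
  by rewrite (bigD1 i)//= leeDl// sume_ge0.
have hi i : young_gauge (f i) (tnth u i) <= 1.
  apply: le_trans h; rewrite (bigD1 i)//= lerDl sumr_ge0// => j _.
  exact: young_gauge_ge0.
rewrite -lee_fin -sumEFin in h; apply: le_trans h; rewrite le_eqVlt; apply/orP; left; apply/eqP.
by apply: eq_bigr => i _; have [_ ->] := young_gauge_le1 (yf i) (hi i).
Qed.

(** The weight that starts the induction: evaluated at [1 - gsum] it is the indicator of the
    ball. *)
Definition heaviside (r : R) : R := (0 <= r)%R%:R.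

Lemma weight_heaviside : weight heaviside.
Proof.
split.
- by move=> r r0; rewrite /heaviside leNgt r0.
- move=> r s rs; rewrite /heaviside ler_nat.
  by case: (leP 0 r) => // r0; rewrite (le_trans r0).
- have pos r c : expR c <= heaviside r -> 0 <= r /\ c <= 0.
    rewrite /heaviside; case: (leP 0 r) => //= _; last by rewrite leNgt expR_gt0.
    by rewrite -[X in _ <= X]expR0 ler_expR.
  move=> t r s c d /andP[t0 t1] _ _ /pos[r0 c0] /pos[s0 d0].
  have t1' : 0 <= 1 - t by rewrite subr_ge0.
  rewrite /heaviside (_ : 0 <= _) ?addr_ge0 ?mulr_ge0//=.
  rewrite -[X in _ <= X]expR0 ler_expR.
  have h1 : t * c <= 0 by rewrite mulr_ge0_le0.
  have h2 : (1 - t) * d <= 0 by rewrite mulr_ge0_le0.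
  lra.
Qed.

End young_gauge.

Section orlicz_integrals.
Context {R : realType}.
Variables (n : nat) (f : 'I_n -> R -> \bar R).
Hypothesis yf : forall i, young_function (f i).

Let phis i := young_gauge (f i).
Let K := orlicz_ball f.
Let mK : measurable K := measurable_orlicz_ball yf.

Lemma integral_orlicz_ball (G : euclid R n -> R) :
  (\int[lebesgue_tuple n]_(u in K) (G u)%:E)%E = wint phis heaviside G 1.
Proof.
rewrite /wint integral_mkcond; apply: eq_integral => u _.
rewrite patchE /K orlicz_ball_gauge// /heaviside subr_ge0.
case: ifPn => [|nu].
  by rewrite inE/= => ->; rewrite mulr1.
rewrite (_ : (_ <= 1) = false) ?mulr0//.
by apply/negP => h; move/negP: nu; apply; rewrite inE.
Qed.

Lemma measure_orlicz_ball (A : set (euclid R n)) : measurable A ->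
  lebesgue_tuple n (A `&` K) = wint phis heaviside (\1_A) 1.
Proof. by move=> mA; rewrite -integral_orlicz_ball integral_indic. Qed.

Lemma uniform_orlicz_ball (A : set (euclid R n)) : lebesgue_tuple n K = 1%E ->
  measurable A -> uniform_law K A = wint phis heaviside (\1_A) 1.
Proof.
move=> K1 mA; rewrite uniform_lawE//; last by rewrite K1 lte_fin ltr01 ltry.
by rewrite K1 inve1 mule1 measure_orlicz_ball.
Qed.

Lemma integral_uniform_orlicz_ball (G : euclid R n -> R) : lebesgue_tuple n K = 1%E ->
  measurable_fun setT G -> (forall u, 0 <= G u) ->
  (\int[uniform_law K]_u (G u)%:E)%E = wint phis heaviside G 1.
Proof.
move=> K1 mG G0; rewrite -integral_orlicz_ball -(ge0_integral_mrestr (lebesgue_tuple n) mK).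
- have Kfin : (0 < lebesgue_tuple n K < +oo)%E by rewrite K1 lte_fin ltr01 ltry.
  apply: eq_measure_integral => A mA _.
  apply: (etrans (uniform_lawE A mK Kfin)).
  by rewrite K1 inve1 mule1.
- exact/measurable_EFinP.
- by move=> u; rewrite lee_fin.
Qed.

End orlicz_integrals.

(** * From the maximum of partial sums to the one-sided bounds *)

Lemma sum_tnth_take (V : nmodType) (T : Type) n (u : n.-tuple T) (k : 'I_n) (F : T -> V) :
  \sum_(i < n | (i <= k)%N) F (tnth u i) = \sum_(x <- take k.+1 u) F x.
Proof.
rewrite (big_nth (tnth u k)) size_takel ?size_tuple// big_mkord.
rewrite (big_ord_widen n (fun i => F (nth (tnth u k) (take k.+1 u) i)))//.
apply: eq_bigr => i ik.
by rewrite nth_take// -tnth_nth.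
Qed.

Lemma measurable_bigmax d (T : measurableType d) (R : realType) (I : Type) (r : seq I)
    (F : I -> T -> R) : (forall i, measurable_fun setT (F i)) ->
  measurable_fun setT (fun x => \big[Num.max/0]_(i <- r) F i x).
Proof.
move=> mF; elim: r => [|i r ih].
  by apply: eq_measurable_fun (measurable_cst (0 : R)) => x _; rewrite big_nil.
apply: eq_measurable_fun (measurable_maxr (mF i) ih) => x _.
by rewrite big_cons.
Qed.

Lemma measurable_gt d (T : measurableType d) (R : realType) (F : T -> R) (c : R) :
  measurable_fun setT F -> measurable [set x | c < F x].
Proof.
move=> mF; rewrite (_ : [set _ | _] = setT `&` F @^-1` `]c, +oo[%classic).
  exact: mF.
by rewrite setTI; apply/seteqP; split => x /=; rewrite in_itv/= andbT.
Qed.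

Section maximum_of_partial_sums.
Context {R : realType}.
Variables (n : nat) (L a t : R).
Hypotheses (a0 : 0 < a) (t0 : 0 < t).

Let partial_sum (u : euclid R n) (k : 'I_n) : R :=
  \sum_(i < n | (i <= k)%N) ((tnth u i : R) ^+ 2 - L ^+ 2).

Lemma partial_sum_le_excess (u : euclid R n) (k : 'I_n) (sg : R) : sg = 1 \/ sg = -1 ->
  (forall i, `|(tnth u i : R) ^+ 2 - L ^+ 2| <= a) ->
  sg * partial_sum u k <= excess (truncated L a sg) u.
Proof.
move=> sgP ua; apply: le_trans (excess_ge_prefix _ _ k.+1).
rewrite -sum_tnth_take /partial_sum mulr_sumr le_eqVlt; apply/orP; left; apply/eqP.
apply: eq_bigr => i _; rewrite /truncated min_l//.
by apply: le_trans (ua i); case: sgP => ->; rewrite ?mul1r ?mulN1r ?ler_norm// -normrN ler_norm.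
Qed.

(** Unless some deviation exceeds [a], truncation is inactive for both signs, and a large absolute
    partial sum is a large prefix sum for one of them. *)
Lemma bigmax_partial_sum_subset :
  [set u : euclid R n | n%:R * t < \big[Num.max/0]_(k < n) `|partial_sum u k|] `<=`
  [set u : euclid R n | a < \big[Num.max/0]_(k < n) `|(tnth u k : R) ^+ 2 - L ^+ 2|] `|`
  ([set u : euclid R n | n%:R * t < excess (truncated L a 1) u] `|`
   [set u : euclid R n | n%:R * t < excess (truncated L a (-1)) u]).
Proof.
move=> u /= /bigmax_gtP[|[k _ hk]]; first by rewrite ltNge mulr_ge0// ltW.
have [|ua] := ltP a (\big[Num.max/0]_(k < n) `|(tnth u k : R) ^+ 2 - L ^+ 2|); first by left.
have {}ua i : `|(tnth u i : R) ^+ 2 - L ^+ 2| <= a.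
  by apply: le_trans ua; apply: (le_bigmax _ (fun i : 'I_n => `|(tnth u i : R) ^+ 2 - L ^+ 2|)).
right; have [s0|s0] := leP 0 (partial_sum u k); [left|right]; apply: (lt_le_trans hk).
  by rewrite ger0_norm//; have := partial_sum_le_excess k (or_introl erefl) ua; rewrite mul1r.
by rewrite ltr0_norm//; have := partial_sum_le_excess k (or_intror erefl) ua; rewrite mulN1r.
Qed.

Lemma measurable_bigmax_deviation (c : R) : measurable
  [set u : euclid R n | c < \big[Num.max/0]_(k < n) `|(tnth u k : R) ^+ 2 - L ^+ 2|].
Proof.
apply: measurable_gt; apply: measurable_bigmax => k.
apply: measurableT_comp => //; apply: measurable_funB => //.
exact: measurable_tnthX.
Qed.

Lemma measurable_bigmax_partial_sum (c : R) : measurable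
  [set u : euclid R n | c < \big[Num.max/0]_(k < n) `|partial_sum u k|].
Proof.
apply: measurable_gt; apply: measurable_bigmax => k.
apply: measurableT_comp => //.
apply: (@eq_measurable_fun _ _ _ _ _ (fun u : euclid R n =>
    \sum_(i < n) if (i <= k)%N then (tnth u i : R) ^+ 2 - L ^+ 2 else 0)).
  by move=> u _; rewrite /partial_sum [RHS]big_mkcond.
apply: measurable_sum => i; case: (i <= k)%N => //; apply: measurable_funB => //.
exact: measurable_tnthX.
Qed.

End maximum_of_partial_sums.

Theorem corollary1p7 (R : realType) (n : nat) (hn : (0 < n)%N)
    (f : 'I_n -> R -> \bar R) (hf : forall i, young_function (f i))
    (L : R) (hK : isotropic (orlicz_ball f) L)
    (d : measure_display) (T : measurableType d) (P : probability T R)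
    (X : {RV P >-> euclid R n}) (hX : uniformly_distributed P X (orlicz_ball f))
    (t a : R) (ht : 0 < t) (ha : 0 < a) :
  (P [set w | n%:R * t < \big[Num.max/0]_(k < n)
        `|\sum_(i < n | (i <= k)%N) ((tnth (X w) i : R) ^+ 2 - L ^+ 2)| ]%R
   <= 2%:E * P [set w | a < \big[Num.max/0]_(k < n)
                    `|(tnth (X w) k : R) ^+ 2 - L ^+ 2| ]%R
      + (4 * expR (- (n%:R * t ^+ 2 / (4 * (a * t + 5 * L ^+ 4))
                      * (1 + 2 / 3 * ln (1 + a * t / (5 * L ^+ 4))))))%R%:E)%E.
Proof.
have [K1 L0 E2] := hK; pose phis i := young_gauge (f i).
have gp i : gauge (phis i) := young_gaugeP (hf i).
have V1 : wvol phis heaviside 1 = 1.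
  have := measure_orlicz_ball hf measurableT; rewrite setTI K1 indicT => w1.
  by apply: EFin_inj; rewrite -wvolE//; exact: weight_heaviside.
have m2 i : wint phis heaviside (fun u => (tnth u i : R) ^+ 2) 1 = (L ^+ 2)%:E.
  rewrite -(E2 i) unlock -(integral_uniform_orlicz_ball hf K1)//.
    exact: measurable_tnthX.
  by move=> u; exact: sqr_ge0.
set e := expR _.
pose A sg := [set u : euclid R n | n%:R * t < excess (truncated L a sg) u].
have mA sg : measurable (A sg).
  apply: measurable_gt; apply: measurable_excess; exact: measurable_truncated.
have tail (sg : R) : sg = 1 \/ sg = -1 -> (uniform_law (orlicz_ball f) (A sg) <= (2 * e)%:E)%E.
  move=> sgP; rewrite uniform_orlicz_ball//.
  exact: (one_sided_tail_bound gp weight_heaviside V1 L0 ha ht sgP m2).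
pose D := [set u : euclid R n | a < \big[Num.max/0]_(k < n) `|(tnth u k : R) ^+ 2 - L ^+ 2|].
have mD : measurable D := @measurable_bigmax_deviation R n L a.
pose E := [set u : euclid R n | n%:R * t < \big[Num.max/0]_(k < n)
  `|\sum_(i < n | (i <= k)%N) ((tnth u i : R) ^+ 2 - L ^+ 2)|].
have mE : measurable E := @measurable_bigmax_partial_sum R n L _.
have lawE B : measurable B -> P (X @^-1` B) = uniform_law (orlicz_ball f) B.
  by move=> mB; rewrite -hX.
rewrite (_ : [set w | (n%:R * t < _)%R] = X @^-1` E)// (_ : [set w | (a < _)%R] = X @^-1` D)//.
rewrite !lawE//.
set Q := uniform_law _ in tail *.
apply: (@le_trans _ _ (Q (D `|` (A 1 `|` A (-1)))%classic)).
  apply: le_measure; rewrite ?inE//.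
    by do 2?apply: measurableU => //.
  exact: bigmax_partial_sum_subset.
apply: le_trans (measureU2 _ _ _) _ => //; first exact: measurableU.
apply: leeD.
  by rewrite -[leLHS]mul1e lee_wpmul2r// lee_fin ler1n.
apply: le_trans (measureU2 _ _ _) _ => //.
(* Each of the two signs contributes the factor 2 of the one-sided bound, which gives 4 in total. *)
apply: (@le_trans _ _ ((2 * e)%:E + (2 * e)%:E)%E).
  by apply: leeD; apply: tail; [left|right].
by rewrite -EFinD lee_fin; lra.
Qed.
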